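(* Let $\gamma>0$, $\epsilon>0$ and $\tau=\gamma\epsilon$. Let $E_0^\epsilon\in\widetilde{\mathcal D}_\epsilon$ be a discrete convex Wulff-like hexagon and, for each $k\ge 1$, let $E_k^\epsilon\in\mathcal D_\epsilon$ be a minimizer of the functional $\mathcal F_{\tau,\epsilon}(\cdot,E_{k-1}^\epsilon)$ on $\mathcal D_\epsilon$. Then $E_k^\epsilon$ is a discrete convex Wulff-like hexagon contained in $E_{k-1}^\epsilon$, as long as there exists $\delta>0$ such that the sides of the Wulff-like envelope $\mathcal W(E_{k-1}^\epsilon)$ are larger than $\delta$. (That is, the conclusion holds for every $k\ge1$ such that, for some $\delta>0$, all six sides of each of the envelopes $\mathcal W(E_0^\epsilon),\dots,\mathcal W(E_{k-1}^\epsilon)$ have length larger than $\delta$.)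
   Context: Lattice. Let $\eta_1=(1,0)$, $\eta_2=(1/2,\sqrt3/2)$, $\eta_3=\eta_1-\eta_2$, and let $\mathbb T=\{a\eta_1+b\eta_2:\ a,b\in\mathbb Z\}$ be the triangular lattice. For $e=(e^1,e^2)\in\mathbb R^2$ put $e^\perp=(-e^2,e^1)$. Let $\mathcal R=\{\pm\eta_1^\perp,\pm\eta_2^\perp,\pm\eta_3^\perp\}$ and let $H=\frac{\sqrt3}{3}\,\mathrm{conv}(\mathcal R)$ (a closed regular hexagon of side length $\sqrt3/3$, the cell of the dual lattice). For $\epsilon>0$ and $i\in\epsilon\mathbb T$ put $H_\epsilon(i)=i+\epsilon H$. Admissible sets. For $\mathcal I\subset\epsilon\mathbb T$ let $E_{\mathcal I}=\bigcup_{i\in\mathcal I}H_\epsilon(i)$, and $\mathcal D_\epsilon=\{E\subseteq\mathbb R^2:\ E=E_{\mathcal I}\text{ for some }\mathcal I\subseteq\epsilon\mathbb T\}$. Perimeter energy. For $E=E_{\mathcal I}\in\mathcal D_\epsilon$, $P_\epsilon(E)=\mathcal H^1(\partial E)$; equivalently, $P_\epsilon(E)$ is $\frac{\sqrt3}{3}\epsilon$ times the number of nearest-neighbour pairs ($|i-j|=\epsilon$) of points $i,j\in\epsilon\mathbb T$ with $i\in\mathcal I$, $j\notin\mathcal I$. Norms. $\varphi_{hex}(\nu)=\frac23\sum_{k=1}^3|\langle\nu,\eta_k\rangle|$, with dual norm $\varphi_{hex}^\circ(\xi)=\frac{\sqrt3}{2}\max_{k=1,2,3}|\langle\xi,\eta_k^\perp\rangle|$.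 Discrete distance. For $F\in\mathcal D_\epsilon$ and $x\in\mathbb R^2$ (defined uniquely up to a Lebesgue-null set), $$d^\epsilon(x,\partial F)=\begin{cases}\inf\{\varphi^\circ_{hex}(i-j):\ i,j\in\epsilon\mathbb T,\ x\in H_\epsilon(i),\ H_\epsilon(j)\subset F\},& x\notin F,\\ \inf\{\varphi^\circ_{hex}(i-j):\ i,j\in\epsilon\mathbb T,\ x\in H_\epsilon(i),\ H_\epsilon(j)\not\subset F\},& x\in F.\end{cases}$$ Energy. For $E,F\in\mathcal D_\epsilon$ and $\tau>0$, $$\mathcal F_{\tau,\epsilon}(E,F)=P_\epsilon(E)+\frac1\tau\int_{E\triangle F}d^\epsilon(x,\partial F)\,dx .$$ Wulff-like sets. Let $n_1,\dots,n_6$ be the six unit vectors in $\mathcal R$ listed in cyclic (angular) order, consecutive ones forming an angle $\pi/3$: $n_1=\eta_1^\perp$, $n_2=\eta_2^\perp$, $n_3=-\eta_3^\perp$, $n_4=-n_1$, $n_5=-n_2$, $n_6=-n_3$, indices modulo $6$; they are the exterior unit normals of the Wulff shape $\{\varphi_{hex}^\circ\le1\}$, a regular hexagon. A bounded set $E\subset\mathbb R^2$ is Wulff-like if $\partial E$ is a polygonal closed curve whose consecutive sides $S_1,\dots,S_m$ have exterior unit normals $\nu_1,\dots,\nu_m$ (indices modulo $m$) such that (1) $\nu_i\in\{n_1,\dots,n_6\}$ for every $i$, and (2) if $\nu_i=n_j$ then $\nu_{i+1}\in\{n_{j-1},n_{j+1}\}$. A convex Wulff-like set is automatically a hexagon and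 is called a convex Wulff-like hexagon. Discrete hexagons. $E\in\mathcal D_\epsilon$ is a discrete convex Wulff-like hexagon if there is a convex Wulff-like hexagon $K$ with $E=\bigcup\{H_\epsilon(i):\ i\in\epsilon\mathbb T,\ H_\epsilon(i)\subset K\}$; the class of these sets is $\widetilde{\mathcal D}_\epsilon$. For $E\in\widetilde{\mathcal D}_\epsilon$, the Wulff-like envelope $\mathcal W(E)$ is the smallest convex Wulff-like hexagon containing $E$. *)

(* Defs.v *)
From HB Require Import structures.
From mathcomp Require Import all_boot all_order all_algebra.
From mathcomp Require Import all_classical all_reals all_analysis.
Import numFieldNormedType.Exports.
Import Order.TTheory GRing.Theory Num.Theory.

Set Implicit Arguments.
Unset Strict Implicit.
Unset Printing Implicit Defensive.

Local Open Scope classical_set_scope.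
Local Open Scope ring_scope.

Section Plane.
Variable R : realType.

(* The norm that the library puts on R * R is the sup norm; lengths and
   diameters below use [enorm] instead. The topology is the usual one. *)

Definition dot (x y : R * R) : R := x.1 * y.1 + x.2 * y.2.
Definition enorm (x : R * R) : R := Num.sqrt (dot x x).
Definition perp (e : R * R) : R * R := (- e.2, e.1).

Definition segment (a b : R * R) : set (R * R) :=
  [set a + t *: (b - a) | t in `[0, 1]].

Definition bdry (E : set (R * R)) : set (R * R) := closure E `\` interior E.

Definition convex_hull (A : set (R * R)) : set (R * R) :=
  \bigcap_(C in [set C : set (R * R) | convex_set C /\ A `<=` C]) C.

(* [maxe 0] is there for the empty set, whose ereal_sup is -oo. *)
Definition ediam (U : set (R * R)) : \bar R :=
  maxe 0%E (ereal_sup [set (enorm (z.1 - z.2))%:E | z in U `*` U]).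

Definition hausdorff1_pre (r : R) (A : set (R * R)) : \bar R :=
  ereal_inf [set (\sum_(0 <= k <oo) ediam (U k))%E
    | U in [set U : nat -> set (R * R) |
        (forall k, (ediam (U k) <= r%:E)%E) /\ A `<=` \bigcup_k U k]].

Definition hausdorff1 (A : set (R * R)) : \bar R :=
  ereal_sup [set hausdorff1_pre r A | r in [set r : R | 0 < r]].

Definition lebesgue2 := (@lebesgue_measure R \x @lebesgue_measure R)%E.

End Plane.

Section Lattice.
Variable R : realType.

Definition eta1 : R * R := (1, 0).
Definition eta2 : R * R := (2^-1, Num.sqrt 3 / 2).
Definition eta3 : R * R := eta1 - eta2.
Definition eta (k : 'I_3) : R * R := nth 0 [:: eta1; eta2; eta3] k.

Definition lattice (eps : R) : set (R * R) :=
  [set x | exists a b : int, x = eps *: (a%:~R *: eta1 + b%:~R *: eta2)].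

Definition hex_directions : set (R * R) :=
  [set r | exists k : 'I_3, r = perp (eta k) \/ r = - perp (eta k)].

Definition hexagon : set (R * R) :=
  [set (Num.sqrt 3 / 3) *: x | x in convex_hull hex_directions].

Definition cell (eps : R) (i : R * R) : set (R * R) :=
  [set i + eps *: h | h in hexagon].

Definition cells_union (eps : R) (I : set (R * R)) : set (R * R) :=
  \bigcup_(i in I) cell eps i.

Definition admissible (eps : R) (E : set (R * R)) : Prop :=
  exists2 I, I `<=` lattice eps & E = cells_union eps I.

Definition perimeter (E : set (R * R)) : \bar R := hausdorff1 (bdry E).

(* phi_hex is [fun nu => 2 / 3 * \sum_(k < 3) `|dot nu (eta k)|]; this is the
   explicit formula for its dual norm. *)
Definition phi_hex_dual (xi : R * R) : R :=
  Num.sqrt 3 / 2 * \big[Num.max/0]_(k < 3) `|dot xi (perp (eta k))|.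

(* Extended-real valued, so that the infimum is +oo when no competitor exists
   (x outside F and F empty). *)
Definition discrete_dist (eps : R) (F : set (R * R)) (x : R * R) : \bar R :=
  if x \in F then
    ereal_inf [set u | exists i j, [/\ lattice eps i, lattice eps j,
      cell eps i x, ~ (cell eps j `<=` F) & u = (phi_hex_dual (i - j))%:E]]
  else
    ereal_inf [set u | exists i j, [/\ lattice eps i, lattice eps j,
      cell eps i x, cell eps j `<=` F & u = (phi_hex_dual (i - j))%:E]].

Definition energy (tau eps : R) (E F : set (R * R)) : \bar R :=
  (perimeter E +
   (tau^-1)%:E * \int[@lebesgue2 R]_(x in E `+` F) discrete_dist eps F x)%E.

Definition energy_minimizer (tau eps : R) (F E : set (R * R)) : Prop :=
  admissible eps E /\
  forall E', admissible eps E' ->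
    (energy tau eps E F <= energy tau eps E' F)%E.

End Lattice.

Section Wulff.
Variable R : realType.

Definition wulff_normal (j : 'I_6) : R * R :=
  nth 0 [:: perp (eta1 R); perp (eta2 R); - perp (eta3 R);
            - perp (eta1 R); - perp (eta2 R); perp (eta3 R)] j.

(* The boundary of E is the simple closed polygonal curve with consecutive
   vertices p_0, ..., p_(m-1); the side S_i joins p_i to p_(i+1), with exterior
   unit normal n_(j_i). The indices of p and j are modulo m, those of n modulo
   6. "Exterior" is tested at the relative interior points of the side. *)
Record wulff_boundary (E : set (R * R)) (m : nat)
    (p : 'I_m -> R * R) (j : 'I_m -> 'I_6) : Prop := WulffBoundary {
  wb_size : (2 < m)%N;
  wb_bdry : bdry E = \bigcup_i segment (p i) (p (ordS i));
  wb_nondegenerate : forall i, p i <> p (ordS i);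
  wb_simple : forall i k x, i <> k ->
    segment (p i) (p (ordS i)) x -> segment (p k) (p (ordS k)) x ->
    (k = ordS i /\ x = p k) \/ (i = ordS k /\ x = p i);
  wb_normal : forall i, dot (wulff_normal (j i)) (p (ordS i) - p i) = 0;
  wb_exterior : forall i t, 0 < t < 1 ->
    let x := p i + t *: (p (ordS i) - p i) in
    \forall s \near 0^'+,
      E (x - s *: wulff_normal (j i)) /\ ~ E (x + s *: wulff_normal (j i));
  wb_turn : forall i, j (ordS i) = ordS (j i) \/ j (ordS i) = ord_pred (j i)
}.

Definition wulff_like (E : set (R * R)) : Prop :=
  bounded_set E /\ exists m (p : 'I_m -> R * R) j, wulff_boundary E p j.

(* Hexagons are closed. *)
Definition wulff_hexagon (K : set (R * R)) : Prop :=
  [/\ closed K, convex_set K & wulff_like K].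

Definition discrete_wulff_hexagon (eps : R) (E : set (R * R)) : Prop :=
  admissible eps E /\
  exists2 K, wulff_hexagon K &
    E = cells_union eps [set i | lattice eps i /\ cell eps i `<=` K].

Definition wulff_envelope (E W : set (R * R)) : Prop :=
  [/\ wulff_hexagon W, E `<=` W &
      forall K, wulff_hexagon K -> E `<=` K -> W `<=` K].

Definition sides_larger_than (delta : R) (W : set (R * R)) : Prop :=
  exists m (p : 'I_m -> R * R) j, wulff_boundary W p j /\
    forall i, delta < enorm (p (ordS i) - p i).

End Wulff.

(* Main.v *)
From HB Require Import structures.
Require Import Defs.
From mathcomp Require Import all_boot all_order all_algebra finmap zify ring lra.
From mathcomp Require Import all_classical all_reals all_analysis measurable_realfun.
Import numFieldNormedType.Exports.
Import Order.TTheory GRing.Theory Num.Theory.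

(** One step of the scheme is a discrete isoperimetric problem in the
    triangular lattice.

    A lattice point eps (a eta_1 + b eta_2) is encoded by the pair (a, b) of
    integers, and a discrete set by its set I of sites. The boundary of a union
    of finitely many cells consists of the edges between neighbouring cells of
    which exactly one belongs to the union; edges overlap at end points only,
    so that the perimeter is the length of an edge times the number N(I) of
    pairs of neighbours p in I, q not in I ([perimeter_region]). All cells have
    the same area, and on each of them the distance to the boundary of the
    reference set is constant up to a null set. Hence the energy is an affine
    function of N(I) + lam * (sum of d(p) over the symmetric difference of I and
    J), J being the reference set ([energy_cost]); for infinite I it is
    infinite.

    Nonempty discrete hexagons are exactly the sets of sites given by bounds on
    the three coordinates a, b and a + b, with all six bounds attained; these are
    called tight here ([hexagon_boxset], [boxset_hexagon]). Indeed a convex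
    Wulff-like hexagon is an intersection of half-planes whose normals are among
    the six admissible ones ([halfplanesE]), and a cell lies in such a half-plane
    when its centre satisfies a linear inequality. For J of this form and p in
    J the distance d(p) is the smallest slack of p in the six inequalities.

    It remains to see that a minimiser of N(I) + lam * (sum of d) is empty or a
    tight hexagon, and that it is contained in J ([cost_minimizer]). Cutting a
    set by a lattice half-plane does not increase N, so that I may be replaced
    by its intersection with J, with a strict gain unless I is contained in J.
    Inside J one minimises N(I) - lam * w(I), where w(I) is the sum of the
    slacks. Since every lattice line that meets a finite set leaves it at both
    ends, N is at least twice the number of lattice lines that meet the set, with
    equality for hexagons. The lattice hexagon spanned by a connected set meets
    no further lines, so that each connected component of a minimiser is a tight
    hexagon ([block_box]).

    Two components A and B cannot coexist ([no_two_blocks]). As they do not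
    touch, one of the six directed gaps between them is at least 2. Choose a
    minimiser and two of its components with the smallest sum of squares of the
    positive gaps; by symmetry the largest gap goes from A up to B, and its
    middle is in the lower half of J. If no slack decreases when A moves up by
    one, the moved A gives another minimiser, which either has smaller gaps or
    has a contact that saves perimeter; the same holds for B moving down. When
    both motions decrease some slack, A sits in the lower part of J in such a way
    that w increases strictly, with the same N, under one of two changes: one
    boundary line of A is traded for a longer row on top of A ([swap_absurd]),
    or all of A is moved up by one row ([lift_absurd]). *)

Set Implicit Arguments.
Unset Strict Implicit.
Unset Printing Implicit Defensive.

(** * Finite sets of lattice sites and their boundary pairs *)

Local Open Scope fset_scope.
Local Open Scope ring_scope.

(** The site (a, b) stands for the lattice point eps (a eta_1 + b eta_2). *)
Definition site := (int * int)%type.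
Definition sadd (p v : site) : site := (p.1 + v.1, p.2 + v.2).
Definition sopp (v : site) : site := (- v.1, - v.2).
(** The six nearest neighbours of the origin, in angular order. *)
Definition dirs : seq site :=
  [:: (1, 0); (0, 1); (-1, 1); (-1, 0); (0, -1); (1, -1)].

(** With p in X and p + v outside X, the pair (p, v) is an edge of the
    boundary of the union of the cells of X. *)
Definition exits (v : site) (X : {fset site}) : {fset site} :=
  [fset p in X | sadd p v \notin X].
Definition nbdry (X : {fset site}) : nat := (\sum_(v <- dirs) #|` exits v X|)%N.

(** A lattice hexagon, given by bounds on the three coordinates a, b and a + b
    that are constant along the three families of lattice lines. *)
Record hexbox := Box { amin : int; amax : int; bmin : int; bmax : int;
                       smin : int; smax : int }.

Definition inbox (H : hexbox) (p : site) : bool :=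
  [&& amin H <= p.1, p.1 <= amax H, bmin H <= p.2, p.2 <= bmax H,
      smin H <= p.1 + p.2 & p.1 + p.2 <= smax H].

(** These inequalities say that each of the six bounds is attained by a site of
    the hexagon. *)
Definition tight (H : hexbox) : bool :=
  [&& amin H <= amax H, bmin H <= bmax H, smin H <= smax H,
      smin H <= amin H + bmax H <= smax H, smin H <= amax H + bmin H <= smax H,
      smax H <= amax H + bmax H & amin H + bmin H <= smin H].

(** For a site of the hexagon, the least number of steps to a site outside; this
    is the discrete distance to the complement, up to a constant factor. *)
Definition slack (H : hexbox) (p : site) : int :=
  Num.min (Num.min (Num.min (p.1 - amin H) (amax H - p.1))
                   (Num.min (p.2 - bmin H) (bmax H - p.2)))
          (Num.min (p.1 + p.2 - smin H) (smax H - (p.1 + p.2))) + 1.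

Lemma slack_gt0 H p : (0 < slack H p) = inbox H p.
Proof. rewrite /slack /inbox; lia. Qed.

Definition irange (m n : int) : seq int :=
  [seq m + k%:Z | k <- iota 0 (absz (Num.max 0 (n - m + 1)))].

Lemma mem_irange m n x : (x \in irange m n) = (m <= x <= n).
Proof.
apply/mapP/idP => [[k]|hx]; first by rewrite mem_iota => ? ->; lia.
by exists (absz (x - m)); [rewrite mem_iota; lia | lia].
Qed.

(** Locked, since reduction would enumerate the sites. *)
Definition boxset (H : hexbox) : {fset site} :=
  locked [fset p in [seq (a, b) | a <- irange (amin H) (amax H),
                                  b <- irange (bmin H) (bmax H)] | inbox H p].

Lemma in_boxset H p : (p \in boxset H) = inbox H p.
Proof.
rewrite /boxset -lock !inE /= andbC; case hp: (inbox H p) => //=.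
apply/allpairsP; exists p; rewrite !mem_irange; move: hp; rewrite /inbox.
by case: p => a b /= h; split; [lia|lia|].
Qed.

Lemma shiftK v : cancel (sadd ^~ v) (sadd ^~ (sopp v)).
Proof. by case: v => a b [c d]; rewrite /sadd /=; congr (_, _); lia. Qed.
Lemma shiftNK v : cancel (sadd ^~ (sopp v)) (sadd ^~ v).
Proof. by case: v => a b [c d]; rewrite /sadd /=; congr (_, _); lia. Qed.
Lemma opp_dirs v : v \in dirs -> sopp v \in dirs.
Proof. by rewrite !inE => /or4P[|||/or3P[]] /eqP->. Qed.

Lemma in_exits v X p : (p \in exits v X) = (p \in X) && (sadd p v \notin X).
Proof. by rewrite !inE. Qed.

(** Along every lattice line in direction v, a finite set is left as often
    forwards as backwards. *)
Lemma card_exits_opp v X : #|` exits v X| = #|` exits (sopp v) X|.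
Proof.
pose Y := [fset p in X | sadd p v \in X].
pose Z := [fset p in X | sadd p (sopp v) \in X].
have YZ : #|` Y| = #|` Z|.
  have -> : Z = [fset sadd p v | p in Y].
    apply/fsetP => p; rewrite !inE; apply/andP/imfsetP => [[pX qX]|[q]].
      by exists (sadd p (sopp v)); rewrite ?shiftNK // !inE /= qX shiftNK.
    by rewrite !inE /= => /andP[qX ?] ->; rewrite shiftK qX.
  by rewrite (card_imfset _ _ (can_inj (shiftK v))).
have hY : (#|` Y| + #|` exits v X| = #|` X|)%N.
  rewrite -(cardfsID Y X); congr (_ + _)%N.
    by congr #|` _|; apply/fsetP => p; rewrite !inE andbA andbb.
  by congr #|` _|; apply/fsetP => p; rewrite !inE; case: (p \in X); rewrite ?andbT ?andbF.
have hZ : (#|` Z| + #|` exits (sopp v) X| = #|` X|)%N.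
  rewrite -(cardfsID Z X); congr (_ + _)%N.
    by congr #|` _|; apply/fsetP => p; rewrite !inE andbA andbb.
  by congr #|` _|; apply/fsetP => p; rewrite !inE; case: (p \in X); rewrite ?andbT ?andbF.
lia.
Qed.

Definition halfplane (l : site -> int) (u : int) (X : {fset site}) : {fset site} :=
  [fset p in X | l p <= u].

Lemma exits_cut v X (l : site -> int) (u : int) :
  (forall p, l (sadd p v) <= l p) ->
  exits v (halfplane l u X) `<=` exits v X.
Proof.
move=> lv; apply/fsubsetP => p; rewrite !inE => /andP[/andP[pX lp]] /=.
by rewrite pX (le_trans (lv p) lp) andbT.
Qed.

Lemma card_exits_cut v X (l : site -> int) (u : int) :
  (forall p, l (sadd p v) <= l p) \/ (forall p, l (sadd p (sopp v)) <= l p) ->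
  (#|` exits v (halfplane l u X)| <= #|` exits v X|)%N.
Proof.
case=> lv; first exact/fsubset_leq_card/exits_cut.
by rewrite ![#|` exits v _|]card_exits_opp; apply/fsubset_leq_card/exits_cut.
Qed.

(** Cutting by a lattice half-plane does not increase the perimeter. In each
    direction, or in its opposite, one does not leave the half-plane, so that
    the cut creates no exits there; forward and backward exits are equally
    many. *)
Lemma nbdry_cut X (l : site -> int) (u : int) :
  (forall v, v \in dirs ->
    (forall p, l (sadd p v) <= l p) \/ (forall p, l (sadd p (sopp v)) <= l p)) ->
  (nbdry (halfplane l u X) <= nbdry X)%N.
Proof.
move=> lv; rewrite /nbdry !big_seq; apply: leq_sum => v vd.
exact/card_exits_cut/lv.
Qed.

Ltac dircases := rewrite !inE => /or4P[|||/or3P[]] /eqP-> /=.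

Lemma nbdry_capbox X J : (nbdry (X `&` boxset J) <= nbdry X)%N.
Proof.
pose c := halfplane.
have -> : X `&` boxset J =
  c (fun p : site => p.1) (amax J) (c (fun p : site => - p.1) (- amin J)
 (c (fun p : site => p.2) (bmax J) (c (fun p : site => - p.2) (- bmin J)
 (c (fun p : site => p.1 + p.2) (smax J) (c (fun p : site => - (p.1 + p.2)) (- smin J) X))))).
  apply/fsetP => p; rewrite inE in_boxset !inE /= /inbox.
  case: (p \in X) => //=; lia.
do 5?[apply: leq_trans; [apply: nbdry_cut|]].
1,2,3,4,5,6: try by move=> v; dircases; first [by left => p /=; lia | by right => p /=; lia].
apply: leq_trans; [apply: nbdry_cut|by []].
by move=> v; dircases; first [by left => p /=; lia | by right => p /=; lia].
Qed.

(** * Counting lattice lines *)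

Lemma fset_argmax (T : choiceType) (X : {fset T}) (f : T -> int) :
  X != fset0 -> exists2 p, p \in X & forall q, q \in X -> f q <= f p.
Proof.
case/fset0Pn => x0 x0X.
have [n] : exists n, (#|` X| <= n)%N by exists #|` X|.
elim: n X x0 x0X => [|n IH] X x0 x0X hn.
  by move: x0X; have /cardfs0_eq -> : #|` X| = 0%N by lia.
case: (boolP [exists q : X, f (val q) > f x0]) => [/existsP[[q qX] /= hq]|].
  have [||p] := IH (X `\ x0) q.
  - by rewrite !inE qX andbT; apply: contraTneq hq => ->; rewrite ltxx.
  - by have := cardfsD1 x0 X; rewrite x0X; lia.
  rewrite !inE => /andP[_ pX] hp; exists p => // r rX.
  have fqp : f q <= f p.
    by apply: hp; rewrite !inE qX andbT; apply: contraTneq hq => ->; rewrite ltxx.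
  have [->|rx0] := eqVneq r x0; first exact: le_trans (ltW hq) fqp.
  by apply: hp; rewrite !inE rx0.
rewrite negb_exists => /forallP h; exists x0 => // q qX.
by have := h [` qX]; rewrite -leNgt.
Qed.

(** As [c] is constant and [pos] increases in direction v, the last site of X
    on each level of [c] is an exit. *)
Lemma exits_lines v (c pos : site -> int) X :
  (forall p, c (sadd p v) = c p) -> (forall p, pos p < pos (sadd p v)) ->
  (#|` [fset c p | p in X]| <= #|` exits v X|)%N.
Proof.
move=> cv posv; apply: (@leq_trans #|` [fset c p | p in exits v X]|).
  apply/fsubset_leq_card/fsubsetP => t /imfsetP[p /= pX ->].
  have [|q] := @fset_argmax _ [fset q in X | c q == c p] pos.
    by apply/fset0Pn; exists p; rewrite !inE pX /=.
  rewrite !inE => /andP[qX /eqP cq] hq; apply/imfsetP; exists q => //=.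
  rewrite !inE qX /=; apply/negP => sX.
  by have := hq (sadd q v); rewrite !inE sX cv cq eqxx leNgt posv => /(_ isT).
exact: leq_imfset_card.
Qed.

(** A hexagon is convex, hence is left only once along each line. *)
Lemma exits_box v (c pos : site -> int) H :
  (forall p q, c p = c q -> pos p = pos q -> p = q) ->
  (forall p q, c p = c q -> pos p < pos q -> inbox H p -> inbox H q ->
     inbox H (sadd p v)) ->
  (#|` exits v (boxset H)| <= #|` [fset c p | p in boxset H]|)%N.
Proof.
move=> cpos next.
have ci : {in exits v (boxset H) &, injective c}.
  {
  move=> p q.
  rewrite (in_exits v (boxset H) p).
  rewrite (in_exits v (boxset H) q).
  rewrite (in_boxset H p) (in_boxset H q).
  rewrite (in_boxset H (sadd p v)) (in_boxset H (sadd q v)).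
  move=> /andP[pH sp].
  move=> /andP[qH sq] cpq.
  case: (ltgtP (pos p) (pos q)) => [lt|lt|/(cpos _ _ cpq) //].
    by rewrite (next _ _ cpq lt) in sp.
  by rewrite (next _ _ (esym cpq) lt) in sq.
  }
rewrite -(@card_in_imfset imfset_key _ _ c (mem (exits v (boxset H)))) //.
apply/fsubset_leq_card/fsubsetP => t /imfsetP[p /=]; rewrite in_exits => /andP[pH _] ->.
by apply/imfsetP; exists p.
Qed.

Definition iset (m n : int) : {fset int} := [fset x in irange m n].
Lemma in_iset m n x : (x \in iset m n) = (m <= x <= n).
Proof. by rewrite inE mem_irange. Qed.
Lemma card_iset m n : (#|` iset m n|)%:Z = Num.max 0 (n - m + 1).
Proof.
have -> : #|` iset m n| = absz (Num.max 0 (n - m + 1)).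
  rewrite card_fseq undup_id; first by rewrite size_map size_iota.
  by rewrite map_inj_uniq ?iota_uniq // => i j /addrI [->].
lia.
Qed.

(** Twice the number of lattice lines in the three directions that meet a
    hexagon whose six bounds are attained. *)
Definition box_perimeter (H : hexbox) : int :=
  2 * ((amax H - amin H + 1) + (bmax H - bmin H + 1) + (smax H - smin H + 1)).

Lemma nbdryE X : nbdry X = (2 * (#|` exits (1, 0)%R X| + #|` exits (0, 1)%R X| +
  #|` exits (-1, 1)%R X|))%N.
Proof.
have e1 : #|` exits (-1, 0)%R X| = #|` exits (1, 0)%R X|.
  by rewrite card_exits_opp; congr #|` exits _ X|.
have e2 : #|` exits (0, -1)%R X| = #|` exits (0, 1)%R X|.
  by rewrite card_exits_opp; congr #|` exits _ X|.
have e3 : #|` exits (1, -1)%R X| = #|` exits (-1, 1)%R X|.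
  by rewrite card_exits_opp; congr #|` exits _ X|.
rewrite /nbdry /dirs !big_cons big_nil e1 e2 e3.
by rewrite addn0 !mulnDr !mul2n -!addnn; set x := size _; set y := size _; set z := size _; lia.
Qed.

Lemma nbdry_boxset H : amin H <= amax H -> bmin H <= bmax H -> smin H <= smax H ->
  (nbdry (boxset H))%:Z <= box_perimeter H.
Proof.
move=> ha hb hs; rewrite nbdryE /box_perimeter.
have h1 : (#|` exits (1, 0)%R (boxset H)| <= #|` iset (bmin H) (bmax H)|)%N.
  apply: leq_trans (@exits_box _ (fun p => p.2) (fun p => p.1) H _ _) _.
    by move=> [a b] [c d] /= h e; congr (_, _); lia.
    by move=> [a b] [c d]; rewrite /inbox /=; lia.
  apply/fsubset_leq_card/fsubsetP => t /imfsetP[p /=]; rewrite in_boxset in_iset /inbox.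
  by move=> hp ->; lia.
have h2 : (#|` exits (0, 1)%R (boxset H)| <= #|` iset (amin H) (amax H)|)%N.
  apply: leq_trans (@exits_box _ (fun p => p.1) (fun p => p.2) H _ _) _.
    by move=> [a b] [c d] /= h e; congr (_, _); lia.
    by move=> [a b] [c d]; rewrite /inbox /=; lia.
  apply/fsubset_leq_card/fsubsetP => t /imfsetP[p /=]; rewrite in_boxset in_iset /inbox.
  by move=> hp ->; lia.
have h3 : (#|` exits (-1, 1)%R (boxset H)| <= #|` iset (smin H) (smax H)|)%N.
  apply: leq_trans (@exits_box _ (fun p => p.1 + p.2) (fun p => p.2) H _ _) _.
    by move=> [a b] [c d] /= h e; congr (_, _); lia.
    by move=> [a b] [c d]; rewrite /inbox /=; lia.
  apply/fsubset_leq_card/fsubsetP => t /imfsetP[p /=]; rewrite in_boxset in_iset /inbox.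
  by move=> hp ->; lia.
have := card_iset (amin H) (amax H); have := card_iset (bmin H) (bmax H).
have := card_iset (smin H) (smax H); lia.
Qed.

Definition spans (H : hexbox) (X : {fset site}) : Prop :=
  [/\ forall t : int, amin H <= t <= amax H -> exists2 p : site, p \in X & p.1 = t,
      forall t : int, bmin H <= t <= bmax H -> exists2 p : site, p \in X & p.2 = t &
      forall t : int, smin H <= t <= smax H -> exists2 p : site, p \in X & p.1 + p.2 = t].

Lemma nbdry_spans H X : spans H X -> box_perimeter H <= (nbdry X)%:Z.
Proof.
case=> sa sb ss; rewrite nbdryE /box_perimeter.
have h1 : (#|` iset (bmin H) (bmax H)| <= #|` exits (1, 0)%R X|)%N.
  apply: leq_trans (@exits_lines _ (fun p => p.2) (fun p => p.1) X _ _);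
    [|by move=> p /=; lia|by move=> p /=; lia].
  apply/fsubset_leq_card/fsubsetP => t; rewrite in_iset => /sb[p pX <-].
  by apply/imfsetP; exists p.
have h2 : (#|` iset (amin H) (amax H)| <= #|` exits (0, 1)%R X|)%N.
  apply: leq_trans (@exits_lines _ (fun p => p.1) (fun p => p.2) X _ _);
    [|by move=> p /=; lia|by move=> p /=; lia].
  apply/fsubset_leq_card/fsubsetP => t; rewrite in_iset => /sa[p pX <-].
  by apply/imfsetP; exists p.
have h3 : (#|` iset (smin H) (smax H)| <= #|` exits (-1, 1)%R X|)%N.
  apply: leq_trans (@exits_lines _ (fun p => p.1 + p.2) (fun p => p.2) X _ _);
    [|by move=> p /=; lia|by move=> p /=; lia].
  apply/fsubset_leq_card/fsubsetP => t; rewrite in_iset => /ss[p pX <-].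
  by apply/imfsetP; exists p.
have := card_iset (amin H) (amax H); have := card_iset (bmin H) (bmax H).
have := card_iset (smin H) (smax H); lia.
Qed.

Lemma tight_spans H : tight H -> spans H (boxset H).
Proof.
move=> tH; split=> t ht.
- exists (t, Num.max (bmin H) (smin H - t)) => //; rewrite in_boxset /inbox /=.
  by move: tH; rewrite /tight; lia.
- exists (Num.max (amin H) (smin H - t), t) => //; rewrite in_boxset /inbox /=.
  by move: tH; rewrite /tight; lia.
- exists (Num.max (amin H) (t - bmax H), t - Num.max (amin H) (t - bmax H)) => /=; last lia.
  by rewrite in_boxset /inbox /=; move: tH; rewrite /tight; lia.
Qed.

(** A union of connected components of X, in the graph of nearest
    neighbours. *)
Definition detached (A X : {fset site}) : Prop :=
  A `<=` X /\ forall p v : site, v \in dirs -> p \in A -> sadd p v \in X -> sadd p v \in A.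

(** Connectedness, in the form used below: a set without a proper nonempty
    union of components. *)
Definition linked (A : {fset site}) : Prop :=
  forall B, detached B A -> B = fset0 \/ B = A.

(** The component of p is the smallest detached subset of X that contains p;
    if it were split by a detached subset B of itself, then B or its complement
    would be a smaller one. *)
Lemma component (X : {fset site}) (p : site) : p \in X ->
  exists A : {fset site}, [/\ p \in A, detached A X, linked A &
     forall B : {fset site}, detached B X -> p \in B -> A `<=` B].
Proof.
move=> pX.
have hX : detached X X by split=> //; exact: fsubset_refl.
have [n] : exists n, exists A, [/\ (#|` A| <= n)%N, p \in A & detached A X].
  by exists #|` X|, X; split.
elim: n => [[A [hA pA _]]|n IH [A [hA pA iA]]].
  by move: pA; have /cardfs0_eq -> : #|` A| = 0%N by lia.
case: (pselect (exists A', [/\ (#|` A'| <= n)%N, p \in A' & detached A' X])) => [/IH //|hno].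
have small B : detached B X -> p \in B -> B `<=` A -> B = A.
  move=> iB pB sBA; apply/eqP; rewrite eqEfcard sBA leqNgt; apply/negP => lt.
  by apply: hno; exists B; split => //; lia.
exists A; split => // [B [sBA hB]|B [sBX hB] pB].
  have iBX : detached B X.
    split; first exact: fsubset_trans sBA (iA.1).
    move=> q v vd qB sX; apply: hB => //; apply: iA.2 sX => //.
    exact: (fsubsetP sBA).
  have iCX : detached (A `\` B) X.
    split; first exact: fsubset_trans (fsubsetDl _ _) (iA.1).
    move=> q v vd; rewrite !inE => /andP[qB qA] sX.
    rewrite (iA.2 _ _ vd qA sX) andbT; apply/negP => sB.
    case/negP: qB; rewrite -(shiftK v q); apply: hB => //; first exact: opp_dirs.
    by rewrite shiftK.
  case: (boolP (p \in B)) => pB; first by right; apply: small.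
  left; have := small (A `\` B) iCX; rewrite !inE pB pA => /(_ isT (fsubsetDl _ _)) e.
  apply/fsetP => q; rewrite inE; apply/negP => qB.
  by have := (fsubsetP sBA) _ qB; rewrite -{1}e !inE qB.
have iI : detached (A `&` B) X.
  split; first exact: fsubset_trans (fsubsetIl _ _) (iA.1).
  move=> q v vd; rewrite !inE => /andP[qA qB] sX.
  by rewrite (iA.2 _ _ vd qA sX) (hB _ _ vd qB sX).
rewrite -(small _ iI) ?fsubsetIr ?fsubsetIl //.
by rewrite inE pA.
Qed.

(** * Components of a minimiser are boxes *)

Lemma exitsU v X Y : exits v (X `|` Y) `<=` exits v X `|` exits v Y.
Proof.
apply/fsubsetP => p; rewrite !inE.
by case: (p \in X); case: (p \in Y); case: (_ \in X); case: (_ \in Y).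
Qed.

Lemma card_exitsU v X Y :
  (#|` exits v (X `|` Y)| <= #|` exits v X| + #|` exits v Y|)%N.
Proof.
apply: leq_trans (fsubset_leq_card (exitsU v X Y)) _.
by rewrite cardfsU leq_subr.
Qed.

Lemma nbdryU X Y : (nbdry (X `|` Y) <= nbdry X + nbdry Y)%N.
Proof.
by rewrite /nbdry -big_split /=; apply: leq_sum => v _; apply: card_exitsU.
Qed.

(** A pair of adjacent sites, one in each set, is no longer an exit of the
    union: touching saves perimeter. *)
Lemma nbdryU_lt (X Y : {fset site}) p v : v \in dirs -> p \in X -> sadd p v \in Y ->
  sadd p v \notin X -> (nbdry (X `|` Y) < nbdry X + nbdry Y)%N.
Proof.
move=> vd pX sY sX; rewrite /nbdry -big_split /=.
rewrite [X in (X < _)%N](big_rem v) //= [X in (_ < X)%N](big_rem v) //=.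
rewrite -addSn; apply: leq_add; last by apply: leq_sum => w _; apply: card_exitsU.
have pe : p \in exits v X by rewrite in_exits pX.
have h1 : exits v (X `|` Y) `<=` (exits v X `\ p) `|` exits v Y.
  apply/fsubsetP => q; rewrite !inE.
  have [->|_] := eqVneq q p; first by rewrite sY orbT andbF.
  by case: (q \in X); case: (q \in Y); case: (_ \in X); case: (_ \in Y).
have h2 := fsubset_leq_card h1.
rewrite (cardfsD1 p (exits v X)) pe add1n addSn ltnS.
by apply: leq_trans h2 _; rewrite cardfsU leq_subr.
Qed.

Lemma nbdry_detached A X : detached A X -> nbdry X = (nbdry A + nbdry (X `\` A))%N.
Proof.
move=> [sAX hA]; rewrite /nbdry -big_split /=.
rewrite big_seq [RHS]big_seq; apply: eq_bigr => v vd.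
rewrite -(cardfsID A (exits v X)); congr (_ + _)%N; congr #|` _|; apply/fsetP => p; rewrite !inE.
  case pA: (p \in A); rewrite ?andbF ?andbT //= (fsubsetP sAX _ pA) /=.
  apply/idP/idP => h; first by apply: contra h; apply: (fsubsetP sAX).
  by apply: contra h; apply: hA.
case pA: (p \in A); rewrite ?andbF ?andbT //=; case pX: (p \in X) => //=.
case sA : (sadd p v \in A) => //=.
have := hA _ _ (opp_dirs vd) sA; rewrite shiftK pX pA => h.
by have := h isT.
Qed.

Lemma nbdry_gt0 X : X != fset0 -> (0 < nbdry X)%N.
Proof.
case/fset0Pn => p pX.
have : (0 < #|` exits (1, 0)%R X|)%N.
  apply: leq_trans (@exits_lines _ (fun p => p.2) (fun p => p.1) X _ _);
    [|by move=> q /=; lia|by move=> q /=; lia].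
  by rewrite cardfs_gt0; apply/fset0Pn; exists p.2; apply/imfsetP; exists p.
by rewrite nbdryE; lia.
Qed.

(** The intermediate value theorem on a connected set, for a coordinate that
    moves by at most one along each step. *)
Lemma connected_line (A : {fset site}) (c : site -> int) p q t :
  linked A -> (forall r v, v \in dirs -> c (sadd r v) <= c r + 1) ->
  p \in A -> q \in A -> c p <= t <= c q -> exists2 r, r \in A & c r = t.
Proof.
move=> cA cv pA qA /andP[pt tq].
case: (pselect (exists2 r, r \in A & c r = t)) => // hno.
have hne r : r \in A -> c r <> t by move=> rA rt; apply: hno; exists r.
pose B := [fset r in A | c r < t].
have iB : detached B A.
  split; first by apply/fsubsetP => r; rewrite !inE => /andP[].
  move=> r v vd; rewrite !inE /= => /andP[rA rt] sA; rewrite sA /=.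
  have := cv r v vd; have := hne _ sA; lia.
case: (cA _ iB) => /fsetP e.
  have := e p; rewrite !inE pA /=; have := hne _ pA; lia.
have := e q; rewrite !inE qA /=; lia.
Qed.

Definition tight_hull H A := [/\ A `<=` boxset H, tight H & spans H A].

Definition attains (H : hexbox) (A : {fset site}) := [/\ exists2 p : site, p \in A & p.1 = amin H, exists2 p : site, p \in A & p.1 = amax H,
  exists2 p : site, p \in A & p.2 = bmin H, exists2 p : site, p \in A & p.2 = bmax H &
  exists2 p : site, p \in A & p.1 + p.2 = smin H] /\ exists2 p : site, p \in A & p.1 + p.2 = smax H.

Lemma extreme_hull A : A != fset0 -> exists H, [/\ A `<=` boxset H, tight H & attains H A].
Proof.
move=> A0.
have [a1 a1A /= ha1] := fset_argmax (fun p => - p.1) A0.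
have [a2 a2A /= ha2] := fset_argmax (fun p => p.1) A0.
have [b1 b1A /= hb1] := fset_argmax (fun p => - p.2) A0.
have [b2 b2A /= hb2] := fset_argmax (fun p => p.2) A0.
have [s1 s1A /= hs1] := fset_argmax (fun p => - (p.1 + p.2)) A0.
have [s2 s2A /= hs2] := fset_argmax (fun p => p.1 + p.2) A0.
exists (Box a1.1 a2.1 b1.2 b2.2 (s1.1 + s1.2) (s2.1 + s2.2)); split.
- apply/fsubsetP => p pA; rewrite in_boxset /inbox /=.
  move: (ha1 _ pA) (ha2 _ pA) (hb1 _ pA) (hb2 _ pA) (hs1 _ pA) (hs2 _ pA); lia.
- rewrite /tight /=.
  move: (ha1 _ a2A) (hb1 _ b2A) (hs1 _ s2A) (hb2 _ a1A) (hs1 _ a1A) (hs2 _ b2A)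
    (ha1 _ b2A) (hb1 _ a2A) (hs2 _ a2A) (hs1 _ b1A) (ha2 _ b1A) (ha2 _ s2A) (hb2 _ s2A)
    (ha1 _ s1A) (hb1 _ s1A).
  lia.
- by split; [split; [exists a1|exists a2|exists b1|exists b2|exists s1]|exists s2].
Qed.

(** The lattice hexagon spanned by the extreme coordinates of a connected set
    meets no lattice line that the set misses. *)
Lemma connected_hull A : A != fset0 -> linked A -> exists H, tight_hull H A.
Proof.
move=> A0 cA; have [H [sH tH [[[a1 a1A ea1] [a2 a2A ea2] [b1 b1A eb1] [b2 b2A eb2] [s1 s1A es1]]
  [s2 s2A es2]]]] := extreme_hull A0.
exists H; split=> //; split=> t ht.
- by rewrite -ea1 -ea2 in ht; apply: (@connected_line A (fun p => p.1) a1 a2 t cA _ a1A a2A ht) => r v; clear; dircases; lia.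
- by rewrite -eb1 -eb2 in ht; apply: (@connected_line A (fun p => p.2) b1 b2 t cA _ b1A b2A ht) => r v; clear; dircases; lia.
- by rewrite -es1 -es2 in ht; apply: (@connected_line A (fun p => p.1 + p.2) s1 s2 t cA _ s1A s2A ht) => r v; clear; dircases; lia.
Qed.

(** The integral of the distance over the cells of X, in units of the
    lattice. *)
Definition weight (J : hexbox) (X : {fset site}) : int := \sum_(p <- X) slack J p.

Lemma weightU J X Y : [disjoint X & Y] -> weight J (X `|` Y) = weight J X + weight J Y.
Proof.
move=> dXY; rewrite /weight (big_fsetID _ (mem X) (X `|` Y)) /=; congr (_ + _); apply: eq_fbigl => p.
  by rewrite !inE; case: (p \in X); rewrite ?andbF.
rewrite !inE; case pX: (p \in X) => /=; last by rewrite andbT.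
by rewrite (negbTE (fdisjointP dXY _ pX)).
Qed.

Lemma weightD J A X : A `<=` X -> weight J X = weight J A + weight J (X `\` A).
Proof.
move=> sAX; rewrite -weightU; first by rewrite fsetUDl fsetDv fsetD0; move/fsetUidPr: sAX => ->.
by apply/fdisjointP => p pA; rewrite !inE pA.
Qed.

Section Minimal.
Variables (R : realFieldType) (lam : R) (J : hexbox).
Hypothesis lam_gt0 : 0 < lam.

(** For subsets of J the energy is this function of the set of sites, up to an
    additive and a positive multiplicative constant: removing X from J costs the
    weight of J minus that of X. *)
Definition reduced (X : {fset site}) : R := (nbdry X)%:R - lam * (weight J X)%:~R.

Definition minimal (I : {fset site}) : Prop :=
  I `<=` boxset J /\ forall X, X `<=` boxset J -> reduced I <= reduced X.

Lemma reduced_detached A X : detached A X -> reduced X = reduced A + reduced (X `\` A).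
Proof.
move=> iA; rewrite /reduced (nbdry_detached iA) (weightD J iA.1) natrD intrD; ring.
Qed.

Lemma reducedU X Y : [disjoint X & Y] -> reduced (X `|` Y) <= reduced X + reduced Y.
Proof.
move=> dXY; rewrite /reduced (weightU _ dXY) intrD.
have := nbdryU X Y; rewrite -(ler_nat R) natrD => h.
set w1 := _%:~R; set w2 := _%:~R.
have -> : (nbdry X)%:R - lam * w1 + ((nbdry Y)%:R - lam * w2) =
  (nbdry X)%:R + (nbdry Y)%:R - lam * (w1 + w2) by ring.
by rewrite lerB.
Qed.

Lemma reducedU_lt (X Y : {fset site}) p v : [disjoint X & Y] -> v \in dirs -> p \in X ->
  sadd p v \in Y -> reduced (X `|` Y) < reduced X + reduced Y.
Proof.
move=> dXY vd pX sY.
have sX : sadd p v \notin X by move: dXY; rewrite fdisjoint_sym => /fdisjointP; apply.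
have := nbdryU_lt vd pX sY sX; rewrite -(ltr_nat R) natrD => h.
rewrite /reduced (weightU _ dXY) intrD.
set w1 := _%:~R; set w2 := _%:~R.
have -> : (nbdry X)%:R - lam * w1 + ((nbdry Y)%:R - lam * w2) =
  (nbdry X)%:R + (nbdry Y)%:R - lam * (w1 + w2) by ring.
by rewrite ltrD2r.
Qed.

Lemma reduced_le X Y : (nbdry X <= nbdry Y)%N -> weight J Y <= weight J X -> reduced X <= reduced Y.
Proof.
move=> hN hw; rewrite /reduced lerB ?ler_nat // ler_wpM2l ?ler_int // ltW //.
Qed.

Lemma reduced_lt X Y : (nbdry X <= nbdry Y)%N -> weight J Y < weight J X -> reduced X < reduced Y.
Proof.
by move=> hN hw; rewrite /reduced ler_ltB ?ler_nat // ltr_pM2l ?ltr_int.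
Qed.

Definition around (A' A : {fset site}) : Prop := forall p : site, p \in A' ->
  p \in A \/ exists2 v, v \in dirs & sadd p v \in A.

Lemma near_disjoint I A A' : detached A I -> around A' A -> [disjoint A' & I `\` A].
Proof.
move=> iA nA; apply/fdisjointP => p pA'; rewrite !inE negb_and negbK.
case: (nA _ pA') => [->//|[v vd sA]].
case pI: (p \in I); rewrite ?orbT // orbF.
by have := iA.2 _ _ (opp_dirs vd) sA; rewrite shiftK => /(_ pI).
Qed.

(** A component of a minimiser minimises against all replacements that stay
    within distance one, since these remain disjoint from the other
    components. *)
Lemma minimal_replace I A A' : minimal I -> detached A I -> A' `<=` boxset J ->
  around A' A -> reduced A <= reduced A'.
Proof.
move=> [sI mI] iA sA' nA; have dA := near_disjoint iA nA.
have h : reduced I <= reduced (A' `|` (I `\` A)).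
  apply: mI; rewrite fsubUset sA' /=; exact: fsubset_trans (fsubsetDl _ _) sI.
have := le_trans h (reducedU dA); rewrite (reduced_detached iA); lra.
Qed.

(** A replacement that costs nothing yields a minimiser again, and it cannot
    touch the other components, since touching would save perimeter. *)
Lemma minimal_replace_eq I A A' : minimal I -> detached A I -> A' `<=` boxset J ->
  around A' A -> reduced A' <= reduced A ->
  minimal (A' `|` (I `\` A)) /\ detached A' (A' `|` (I `\` A)).
Proof.
move=> [sI mI] iA sA' nA hg; have dA := near_disjoint iA nA.
have sI' : A' `|` (I `\` A) `<=` boxset J.
  by rewrite fsubUset sA' /=; exact: fsubset_trans (fsubsetDl _ _) sI.
have h := reducedU dA; have e := reduced_detached iA.
split; first by split => // X /mI; lra.
split; first exact: fsubsetUl.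
move=> p v vd pA'; rewrite inE => /orP[//|sR].
have := reducedU_lt dA vd pA' sR; have := mI _ sI'; lra.
Qed.

Lemma weight_subset A X : A `<=` X -> X `<=` boxset J -> A <> X -> weight J A < weight J X.
Proof.
move=> sAX sX neq; rewrite (weightD J sAX) ltrDl.
have : X `\` A != fset0.
  apply: contra_notN neq; rewrite fsetD_eq0 => sXA.
  by apply/eqP; rewrite eqEfsubset sAX sXA.
case/fset0Pn => p pX; rewrite /weight (big_fsetD1 p) //=.
have pos q : q \in X `\` A -> 0 < slack J q.
  by rewrite !inE slack_gt0 -in_boxset => /andP[_ /(fsubsetP sX)].
rewrite ltr_wpDr ?pos // big_seq sumr_ge0 // => q; rewrite !inE => /andP[_ qX].
by apply/ltW/pos; rewrite !inE.
Qed.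

Lemma boxset_sub H A : spans H A -> tight H -> A `<=` boxset J -> boxset H `<=` boxset J.
Proof.
move=> [sa sb ss] tH sA; apply/fsubsetP => p; rewrite !in_boxset.
have inJ q : q \in A -> inbox J q by move=> /(fsubsetP sA); rewrite in_boxset.
have [|a1 /inJ ha1 ea1] := sa (amin H); first by move: tH; rewrite /tight; lia.
have [|a2 /inJ ha2 ea2] := sa (amax H); first by move: tH; rewrite /tight; lia.
have [|b1 /inJ hb1 eb1] := sb (bmin H); first by move: tH; rewrite /tight; lia.
have [|b2 /inJ hb2 eb2] := sb (bmax H); first by move: tH; rewrite /tight; lia.
have [|s1 /inJ hs1 es1] := ss (smin H); first by move: tH; rewrite /tight; lia.
have [|s2 /inJ hs2 es2] := ss (smax H); first by move: tH; rewrite /tight; lia.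
move: ha1 ha2 hb1 hb2 hs1 hs2; rewrite /inbox. lia.
Qed.

(** The hull of a component meets the same lattice lines, so that it has no
    larger perimeter; sites of J have positive weight, so that a minimiser
    contains the hull already. As the component is detached, a site of the hull
    outside the component would add its own perimeter. *)
Lemma block_box I A : minimal I -> detached A I -> linked A -> A != fset0 ->
  exists2 H, tight H & A = boxset H.
Proof.
move=> mI iA cA A0; have [H [sAH tH sp]] := connected_hull A0 cA.
have sHJ := boxset_sub sp tH (fsubset_trans iA.1 mI.1).
have hN : (nbdry (boxset H) <= nbdry A)%N.
  have := nbdry_spans sp; have : (nbdry (boxset H))%:Z <= box_perimeter H.
    by apply: nbdry_boxset; move: tH; rewrite /tight; lia.
  lia.
set R' := I `\` A.
have sHI : boxset H `<=` I.
  case: (boolP (boxset H `<=` I)) => // nsub; exfalso.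
  have sIU : I `<=` boxset H `|` R'.
    apply/fsubsetP => p pI; rewrite in_fsetU in_fsetD pI andbT.
    by case pA: (p \in A); rewrite ?orbT // (fsubsetP sAH).
  have sUJ : boxset H `|` R' `<=` boxset J.
    rewrite fsubUset sHJ /=; exact: fsubset_trans (fsubsetDl _ _) mI.1.
  have := mI.2 _ sUJ; apply/negP; rewrite -ltNge; apply: reduced_lt.
    by rewrite (nbdry_detached iA); apply: leq_trans (nbdryU _ _) _; rewrite leq_add2r.
  apply: weight_subset => // e; case/negP: nsub; rewrite e; exact: fsubsetUl.
exists H => //; apply/eqP; rewrite eqEfsubset sAH /= -fsetD_eq0.
apply/negPn/negP => /nbdry_gt0.
have iAH : detached A (boxset H).
  split => // p v vd pA sH; apply: iA.2 => //; exact: (fsubsetP sHI).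
have := nbdry_detached iAH; lia.
Qed.

End Minimal.

(** * Translations and symmetries of the lattice *)

Lemma sum_fsetD (f : site -> int) (A X : {fset site}) : A `<=` X ->
  \sum_(p <- X) f p = \sum_(p <- A) f p + \sum_(p <- X `\` A) f p.
Proof.
move=> sAX; rewrite (big_fsetID _ (mem A) X) /=; congr (_ + _); apply: eq_fbigl => p.
  by rewrite !inE andbC; case pA: (p \in A) => //=; rewrite (fsubsetP sAX).
by rewrite !inE andbC.
Qed.

Lemma sum_fset_const (c : int) (X : {fset site}) :
  \sum_(p <- X) c = c * (#|` X|)%:Z.
Proof. by rewrite big_const_seq count_predT iter_addr_0 -mulr_natr natz. Qed.

Lemma sum_fset_ge (f : site -> int) (c : int) (X : {fset site}) :
  (forall p : site, p \in X -> c <= f p) -> c * (#|` X|)%:Z <= \sum_(p <- X) f p.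
Proof.
by move=> h; rewrite -sum_fset_const big_seq [leRHS]big_seq; apply: ler_sum.
Qed.

Lemma sum_fset_le (f : site -> int) (c : int) (X : {fset site}) :
  (forall p : site, p \in X -> f p <= c) -> \sum_(p <- X) f p <= c * (#|` X|)%:Z.
Proof.
by move=> h; rewrite -sum_fset_const big_seq [leRHS]big_seq; apply: ler_sum.
Qed.

Lemma slack_ge J p t : (t <= slack J p) =
  [&& t <= p.1 - amin J + 1, t <= amax J - p.1 + 1, t <= p.2 - bmin J + 1,
      t <= bmax J - p.2 + 1, t <= p.1 + p.2 - smin J + 1 & t <= smax J - (p.1 + p.2) + 1].
Proof. rewrite /slack; lia. Qed.

Definition btrans (H : hexbox) (v : site) : hexbox :=
  Box (amin H + v.1) (amax H + v.1) (bmin H + v.2) (bmax H + v.2)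
      (smin H + (v.1 + v.2)) (smax H + (v.1 + v.2)).

Lemma inbox_trans H v p : inbox (btrans H v) p = inbox H (sadd p (sopp v)).
Proof. rewrite /inbox /=; lia. Qed.

Lemma boxset_trans H v : boxset (btrans H v) = [fset sadd p v | p in boxset H].
Proof.
apply/fsetP => p; rewrite in_boxset inbox_trans; apply/idP/imfsetP => [h|[q /=]].
  by exists (sadd p (sopp v)); rewrite /= ?in_boxset // shiftNK.
by rewrite in_boxset => hq ->; rewrite shiftK.
Qed.

Lemma sum_trans (f : site -> int) H v :
  \sum_(p <- boxset (btrans H v)) f p = \sum_(p <- boxset H) f (sadd p v).
Proof.
by rewrite boxset_trans big_imfset //= => p q _ _ /(can_inj (shiftK v)).
Qed.

Lemma nbdry_tight_le H H' : tight H -> amin H' <= amax H' -> bmin H' <= bmax H' ->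
  smin H' <= smax H' -> box_perimeter H' <= box_perimeter H -> (nbdry (boxset H') <= nbdry (boxset H))%N.
Proof.
move=> tH h1 h2 h3 hh; have := nbdry_spans (tight_spans tH).
have := nbdry_boxset h1 h2 h3; lia.
Qed.

Lemma tight_trans H v : tight (btrans H v) = tight H.
Proof. rewrite /tight /=; lia. Qed.

Lemma nbdry_trans H v : tight H -> (nbdry (boxset (btrans H v)) <= nbdry (boxset H))%N.
Proof.
move=> tH; apply: nbdry_tight_le => //=; last (by rewrite /box_perimeter /=; lia);
  by move: tH; rewrite /tight; lia.
Qed.

Lemma near_trans H v : v \in dirs -> around (boxset (btrans H v)) (boxset H).
Proof.
move=> vd p; rewrite in_boxset inbox_trans => h; right; exists (sopp v); first exact: opp_dirs.
by rewrite in_boxset.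
Qed.

Definition pos2 (x : int) : int := Num.max 0 x * Num.max 0 x.
(** Of the six directed gaps between two hexagons the positive ones are
    squared, so that shrinking the largest gap by one outweighs growing the
    neighbouring ones by one. *)
Definition gapsum (A B : hexbox) : int :=
  pos2 (amin B - amax A) + pos2 (amin A - amax B) +
  (pos2 (bmin B - bmax A) + pos2 (bmin A - bmax B)) +
  (pos2 (smin B - smax A) + pos2 (smin A - smax B)).

Lemma gapsum_ge0 A B : 0 <= gapsum A B.
Proof. rewrite /gapsum /pos2; nia. Qed.

(** A linear symmetry of the lattice with its action on hexagons. The largest
    gap between two hexagons can thereby be put in a standard direction. *)
Record lsym (t t' : site -> site) (tb : hexbox -> hexbox) : Prop := LSym {
  lsymK : cancel t t';
  lsymVK : cancel t' t;
  lsym_shift : forall p v, t (sadd p v) = sadd (t p) (t v);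
  lsym_dirs : perm_eq (map t dirs) dirs;
  lsym_slack : forall H p, slack (tb H) (t p) = slack H p;
  lsym_tight : forall H, tight (tb H) = tight H }.

(** The rotation by sixty degrees. *)
Definition rotp (p : site) : site := (- p.2, p.1 + p.2).
Definition rotp' (p : site) : site := (p.1 + p.2, - p.1).
Definition rotb (H : hexbox) : hexbox :=
  Box (- bmax H) (- bmin H) (smin H) (smax H) (amin H) (amax H).
(** The reflection that fixes the coordinate b, that is the rows. *)
Definition mirp (p : site) : site := (- (p.1 + p.2), p.2).
Definition mirb (H : hexbox) : hexbox :=
  Box (- smax H) (- smin H) (bmin H) (bmax H) (- amax H) (- amin H).

Lemma lsym_rot : lsym rotp rotp' rotb.
Proof.
split=> //.
- by case=> a b; rewrite /rotp /rotp' /=; congr (_, _); lia.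
- by case=> a b; rewrite /rotp /rotp' /=; congr (_, _); lia.
- by move=> [a b] [c d]; rewrite /rotp /sadd /=; congr (_, _); lia.
- by move=> H [a b]; rewrite /slack /=; lia.
- by move=> H; rewrite /tight /=; lia.
Qed.

Lemma lsym_mir : lsym mirp mirp mirb.
Proof.
split=> //.
- by case=> a b; rewrite /mirp /=; congr (_, _); lia.
- by case=> a b; rewrite /mirp /=; congr (_, _); lia.
- by move=> [a b] [c d]; rewrite /mirp /sadd /=; congr (_, _); lia.
- by move=> H [a b]; rewrite /slack /=; lia.
- by move=> H; rewrite /tight /=; lia.
Qed.

Section Configurations.
Variables (R : realFieldType) (lam : R).
Hypothesis lam_gt0 : 0 < lam.

(** The situation to be excluded: a minimiser with two different components,
    which are hexagons. *)
Record two_blocks (J : hexbox) (I : {fset site}) (A B : hexbox) : Prop := Conf {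
  conf_min : minimal lam J I;
  conf_tA : tight A;
  conf_tB : tight B;
  conf_iA : detached (boxset A) I;
  conf_iB : detached (boxset B) I;
  conf_dis : [disjoint boxset A & boxset B] }.

Lemma block_inbox J I A B : two_blocks J I A B -> forall p, inbox A p -> inbox J p.
Proof.
move=> c p; rewrite -!in_boxset => pA.
exact: (fsubsetP (conf_min c).1 _ (fsubsetP (conf_iA c).1 _ pA)).
Qed.

Lemma two_blocksC J I A B : two_blocks J I A B -> two_blocks J I B A.
Proof. by case=> *; split; rewrite // fdisjoint_sym. Qed.

Lemma box_corners A : tight A ->
  [/\ inbox A (amin A, bmax A), inbox A (amax A, bmin A),
      inbox A (amax A, smax A - amax A) & inbox A (amin A, smin A - amin A)].
Proof. by clear lam_gt0; rewrite /tight /inbox /= => h; split; lia. Qed.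

Lemma block_bounds J I A B : two_blocks J I A B ->
  [/\ amin J <= amin A, amax A <= amax J, bmin J <= bmin A & bmax A <= bmax J] /\
  (smin J <= smin A /\ smax A <= smax J).
Proof.
clear lam_gt0 => c; have [h1 h2 h3 h4] := box_corners (conf_tA c).
move: (block_inbox c h1) (block_inbox c h2) (block_inbox c h3) (block_inbox c h4).
by rewrite /inbox /= => *; do !split; lia.
Qed.

Lemma improvement_absurd J I A B A' : two_blocks J I A B -> A' `<=` boxset J ->
  around A' (boxset A) -> (nbdry A' <= nbdry (boxset A))%N ->
  weight J (boxset A) < weight J A' -> False.
Proof.
move=> c sA' nA' hN hw.
have := minimal_replace (conf_min c) (conf_iA c) sA' nA'.
by rewrite leNgt (reduced_lt lam_gt0 hN hw).
Qed.

(** Translating a component in a direction in which the slack of none of its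
    sites decreases gives a minimiser again; the translated component stays
    apart from the others by [minimal_replace_eq]. *)
Lemma slide J I A B v : two_blocks J I A B -> v \in dirs ->
  (forall p, inbox A p -> slack J p <= slack J (sadd p v)) ->
  exists I', two_blocks J I' (btrans A v) B.
Proof.
move=> c vd hs; have nA := near_trans (H := A) vd.
have sA' : boxset (btrans A v) `<=` boxset J.
  apply/fsubsetP => p; rewrite !in_boxset inbox_trans => h.
  have := hs _ h; rewrite shiftNK; move: (block_inbox c h); rewrite -!slack_gt0; lia.
have hg : reduced lam J (boxset (btrans A v)) <= reduced lam J (boxset A).
  apply: reduced_le => //; first exact: nbdry_trans (conf_tA c).
  by rewrite /weight sum_trans big_seq [leRHS]big_seq; apply: ler_sum => p; rewrite in_boxset; apply: hs.
have [mI' iA'] := minimal_replace_eq (conf_min c) (conf_iA c) sA' nA hg.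
have dA' := near_disjoint (conf_iA c) nA.
have sB : boxset B `<=` I `\` boxset A.
  apply/fsubsetP => p pB; rewrite in_fsetD (fsubsetP (conf_iB c).1) // andbT.
  by move: (conf_dis c); rewrite fdisjoint_sym => /fdisjointP; apply.
exists (boxset (btrans A v) `|` (I `\` boxset A)); split => //.
- by rewrite tight_trans (conf_tA c).
- exact: conf_tB c.
- split; first exact: fsubset_trans sB (fsubsetUr _ _).
  move=> p w wd pB; rewrite in_fsetU => /orP[sA|].
    exfalso; have := iA'.2 _ _ (opp_dirs wd) sA; rewrite shiftK in_fsetU (fsubsetP sB _ pB) orbT.
    by move=> /(_ isT) pA'; have := fdisjointP dA' _ pA'; rewrite (fsubsetP sB _ pB).
  by rewrite in_fsetD => /andP[_ sI]; apply: (conf_iB c).2.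
- apply/fdisjointP => p pA'; apply: contra (fdisjointP dA' _ pA'); exact: (fsubsetP sB).
Qed.

Lemma two_blocks_symm t t' tb J I A B : lsym t t' tb -> two_blocks J I A B ->
  exists I', two_blocks (tb J) I' (tb A) (tb B).
Proof.
case=> tK tVK tsh td tsl tti c.
pose T (X : {fset site}) := [fset t p | p in X].
have mT X p : (p \in T X) = (t' p \in X).
  apply/imfsetP/idP => [[q /= qX ->]|h]; first by rewrite tK.
  by exists (t' p); rewrite //= tVK.
have Tbox H : boxset (tb H) = T (boxset H).
  apply/fsetP => p; rewrite mT !in_boxset -!slack_gt0 -{1}(tVK p) tsl //.
have Tnb X : nbdry (T X) = nbdry X.
  rewrite /nbdry -(perm_big _ td) big_map; apply: eq_bigr => v _.
  have -> : exits (t v) (T X) = T (exits v X).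
    apply/fsetP => p; rewrite mT (in_exits (t v)) (in_exits v) !mT.
    suff -> : t' (sadd p (t v)) = sadd (t' p) v by [].
    by apply: (can_inj tK); rewrite tVK tsh tVK.
  by rewrite (card_imfset _ _ (can_inj tK)).
have TgE X : reduced lam (tb J) (T X) = reduced lam J X.
  rewrite /reduced Tnb; congr (_ - lam * _%:~R); rewrite /weight big_imfset /=; last first.
    by move=> p q _ _ /(can_inj tK).
  by apply: eq_bigr => p _; rewrite tsl.
have Tiso X Y : detached X Y -> detached (T X) (T Y).
  move=> [sXY h]; split; first by apply/fsubsetP => p; rewrite !mT; apply: (fsubsetP sXY).
  move=> p v; rewrite -(perm_mem td) => /mapP[w wd ->]; rewrite !mT.
  have -> : t' (sadd p (t w)) = sadd (t' p) w.
    by apply: (can_inj tK); rewrite tVK tsh tVK.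
  exact: h.
have sT X Y : X `<=` Y -> T X `<=` T Y.
  by move=> s; apply/fsubsetP => p; rewrite !mT; apply: (fsubsetP s).
exists (T I); split.
- split; first by rewrite Tbox; apply: sT; exact: (conf_min c).1.
  move=> X sX; pose Y := [fset t' p | p in X].
  have eX : X = T Y.
    apply/fsetP => p; rewrite mT; apply/idP/imfsetP => [pX|[q /= qX e]]; first by exists p.
    by rewrite (can_inj tVK e).
  rewrite eX !TgE; apply: (conf_min c).2; apply/fsubsetP => p /imfsetP[q /= qX ->].
  by have := fsubsetP sX _ qX; rewrite Tbox mT.
- by rewrite tti (conf_tA c).
- by rewrite tti (conf_tB c).
- by rewrite Tbox; apply: Tiso; exact: conf_iA c.
- by rewrite Tbox; apply: Tiso; exact: conf_iB c.
- rewrite !Tbox; apply/fdisjointP => p; rewrite !mT; exact: (fdisjointP (conf_dis c)).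
Qed.

End Configurations.

(** * Two strict improvements of a low block *)

Section Improvements.
Variables (R : realFieldType) (lam : R).
Hypothesis lam_gt0 : 0 < lam.
Local Notation two_blocks := (two_blocks lam).

(** Take away from A its last line parallel to the sides of the third kind,
    a + b = smax A, and add a row above its top row. The number of lattice lines
    met is the same. The slack is at most r on the line that is lost and, by the
    position of A in J, at least r on the row that is gained; and the row is
    longer than the line. *)
Lemma swap_absurd J I A B : two_blocks J I A B -> bmax A < bmax J ->
  smax J - amax J <= bmax A -> smin J - amin J <= bmax A ->
  bmax A - bmin J + 1 < bmax J - bmax A + 1 ->
  smax J - smax A + 1 <= amin A - amin J + 1 ->
  smax J - smax A + 1 <= bmax A - bmin J + 1 ->
  2 <= smax A - bmax A - amin A ->
  bmax A - (smax A - amax A) + 1 < smax A - bmax A - amin A - 1 -> False.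
Proof.
move=> c hb hUR hUL ht hl hr hm hlR; have tA := conf_tA c.
have [[ba1 ba2 bb1 bb2] [bs1 bs2]] := block_bounds c.
pose A' := Box (amin A) (amax A) (bmin A) (bmax A + 1) (smin A) (smax A - 1).
set r := smax J - smax A + 1 in hl hr.
move: (tA); rewrite /tight => tA'.
have sA' : boxset A' `<=` boxset J.
  apply/fsubsetP => -[a b]; rewrite !in_boxset /inbox /A' /=; lia.
have nA' : around (boxset A') (boxset A).
  move=> p; rewrite !in_boxset => pA'.
  have [pb|pb] := leP p.2 (bmax A).
    by left; move: pA'; rewrite /inbox /A' /=; lia.
  right; exists (0, -1)%R => //; rewrite in_boxset; move: pA'; rewrite /inbox /A' /=; lia.
apply: (improvement_absurd lam_gt0 c sA' nA').
  apply: nbdry_tight_le => //=; try lia.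
  by rewrite /box_perimeter /A' /=; lia.
pose M := boxset A `&` boxset A'.
rewrite /weight (sum_fsetD _ (fsubsetIl _ _ : M `<=` boxset A)).
rewrite [X in _ < X](sum_fsetD _ (fsubsetIr _ _ : M `<=` boxset A')) ltrD2l.
(* On the lost line the bound by smax J already gives slack at most r. *)
have hlost : \sum_(p <- boxset A `\` M) slack J p <= r * (#|` boxset A `\` M|)%:Z.
  apply: sum_fset_le => p; rewrite in_fsetD in_fsetI !in_boxset => /andP[hM pA].
  have : smax A <= p.1 + p.2.
    rewrite leNgt; apply/negP => lt; move: hM; rewrite pA /= => /negP; apply.
    by move: pA; rewrite /inbox /A' /=; lia.
  have := slack_ge J p (slack J p); rewrite lexx => /esym /and5P[_ _ _ _ /andP[_]]; lia.
(* On the new row each of the six bounds is at distance at least r. *)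
have hgain : r * (#|` boxset A' `\` M|)%:Z <= \sum_(p <- boxset A' `\` M) slack J p.
  apply: sum_fset_ge => p; rewrite in_fsetD in_fsetI !in_boxset => /andP[hM pA'].
  have pb : bmax A < p.2.
    rewrite ltNge; apply/negP => le; move: hM; rewrite pA' andbT => /negP; apply.
    by move: pA'; rewrite /inbox /A' /=; lia.
  by rewrite slack_ge /r; move: pA'; rewrite /inbox /A' /=; lia.
have clost : (#|` boxset A `\` M|)%:Z <= bmax A - (smax A - amax A) + 1.
  have h : (#|` boxset A `\` M| <= #|` iset (smax A - amax A) (bmax A)|)%N.
    have sE (p : site) : p \in boxset A `\` M -> p.1 + p.2 = smax A /\ inbox A p.
      rewrite in_fsetD in_fsetI !in_boxset => /andP[hM pA]; split=> //.
      suff : smax A <= p.1 + p.2 by move: pA; rewrite /inbox; lia.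
      rewrite leNgt; apply/negP => lt; move: hM; rewrite pA /= => /negP; apply.
      by move: pA; rewrite /inbox /A' /=; lia.
    have ci : {in boxset A `\` M &, injective (fun p : site => p.2)}.
      by move=> [a b] [a' b'] /sE[/= e1 _] /sE[/= e2 _] e; congr (_, _); lia.
    rewrite -(@card_in_imfset imfset_key _ _ _ (mem (boxset A `\` M)) ci).
    apply/fsubset_leq_card/fsubsetP => t /imfsetP[p /= /sE[e pA] ->].
    by rewrite in_iset; move: pA; rewrite /inbox; lia.
  have := card_iset (smax A - amax A) (bmax A); lia.
have cgain : smax A - bmax A - amin A - 1 <= (#|` boxset A' `\` M|)%:Z.
  have h : (#|` iset (amin A) (smax A - bmax A - 2)| <= #|` boxset A' `\` M|)%N.
    pose f (k : int) : site := (k, bmax A + 1).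
    have fi : injective f by move=> k l [].
    rewrite -(@card_imfset imfset_key _ _ f (mem (iset (amin A) (smax A - bmax A - 2))) fi).
    apply/fsubset_leq_card/fsubsetP => p /imfsetP[k /=]; rewrite in_iset => hk ->.
    by rewrite in_fsetD in_fsetI !in_boxset /inbox /A' /=; lia.
  have := card_iset (amin A) (smax A - bmax A - 2); lia.
have r0 : 1 <= r by rewrite /r; lia.
nia.
Qed.

(** Move A up by one row and cut it with J. The slack of a site changes by at
    most one. It drops for the sites of a triangle below the corner of A where
    the line a + b = smax A meets the top row, where the bound by smax J is the
    nearest one; it grows for the sites for which the bottom of J is strictly
    the nearest side. The low position of A in J makes the latter more
    numerous. *)
Lemma lift_absurd J I A B : two_blocks J I A B ->
  smax J - amax J <= bmax A -> smin J - amin J <= bmax A ->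
  bmax A - bmin J + 2 <= bmax J - bmax A ->
  smax J - smax A <= bmax A - bmin J ->
  amin A - amin J <= bmax A - bmin J ->
  3 * bmax A + 4 <= smax J - amin J + 2 * bmin J ->
  smax A - bmax A - amin A - 1 <= bmax A - (smax A - amax A) + 1 ->
  smax J - smax A <= amin A - amin J -> False.
Proof.
move=> c hUR hUL ht hr hl hbeta hlR hrl; have tA := conf_tA c.
have [[ba1 ba2 bb1 bb2] [bs1 bs2]] := block_bounds c.
move: (tA); rewrite /tight => tA'.
pose v : site := (0, 1); have vd : v \in dirs by [].
have nA := near_trans (H := A) vd.
pose A' := boxset (btrans A v) `&` boxset J.
apply: (@improvement_absurd _ _ lam_gt0 J I A B A' c).
- exact: fsubsetIr.
- by move=> p; rewrite in_fsetI => /andP[/nA].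
- by apply: leq_trans (nbdry_capbox _ _) _; apply: nbdry_trans.
have : \sum_(p <- boxset (btrans A v)) slack J p <= weight J A'.
  rewrite (sum_fsetD _ (fsubsetIl _ _ : A' `<=` boxset (btrans A v))) gerDl.
  rewrite -(mul0r (#|` boxset (btrans A v) `\` A'|)%:Z); apply: sum_fset_le => p.
  rewrite in_fsetD in_fsetI => /andP[h pT]; move: h; rewrite pT in_boxset /= -slack_gt0; lia.
apply: lt_le_trans; rewrite sum_trans -subr_gt0 /weight -sumrB.
pose D p := slack J (sadd p v) - slack J p.
rewrite -/(\sum_(p <- boxset A) D p).
pose L := [fset p in boxset A | D p < 0].
pose G := [fset p in boxset A | 0 < D p].
have sL : L `<=` boxset A by apply/fsubsetP => p; rewrite !inE => /andP[].
have sG : G `<=` boxset A `\` L.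
  by apply/fsubsetP => p; rewrite !inE => /andP[-> h]; rewrite andbT negb_and orbC -leNgt ltW.
change (0 < \sum_(p <- boxset A) D p).
rewrite (sum_fsetD _ sL) (sum_fsetD _ sG).
have hL : -1 * (#|` L|)%:Z <= \sum_(p <- L) D p.
  by apply: sum_fset_ge => p _; rewrite /D /slack /=; lia.
have hG : 1 * (#|` G|)%:Z <= \sum_(p <- G) D p.
  by apply: sum_fset_ge => p; rewrite !inE => /andP[_]; lia.
have h0 : 0 * (#|` (boxset A `\` L) `\` G|)%:Z <= \sum_(p <- (boxset A `\` L) `\` G) D p.
  apply: sum_fset_ge => p; rewrite !in_fsetD => /and3P[_ hpL pA].
  by rewrite leNgt; apply: contra hpL => h; rewrite !inE /= pA.
(* If a loser is j lines before the line a + b = smax A and k rows below the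
   top row, f sends it to the site that is dR + 2 - k lines before that line
   and j + k rows below the top. The site e, with j + k = 0 and one line
   further, is a gainer outside the image. *)
suff : (#|` L| < #|` G|)%N by lia.
set dR := (bmax A - bmin J) - (smax J - smax A).
pose f (p : site) : site :=
  (smax A - dR - 2 + bmax A - p.2 - (p.2 - smax A + (p.1 + p.2)), p.2 - smax A + (p.1 + p.2)).
clear hL hG h0 sG.
pose e : site := (smax A - dR - 3 - bmax A, bmax A).
have fi : injective f by move=> [a b] [a' b'] [] h1 h2; congr (_, _); lia.
rewrite -(@card_imfset imfset_key _ _ f (mem L) fi).
have gain p : inbox A p -> dR + 2 - (bmax A - p.2) <= smax A - (p.1 + p.2) ->
  dR + 2 - (bmax A - (smax J - amax J)) <= smax A - (p.1 + p.2) ->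
  smax A - (p.1 + p.2) <= dR + 3 -> p \in G.
  move=> pA h1 h2 h3; rewrite !inE in_boxset pA /= /D.
  have : slack J p + 1 <= slack J (sadd p v).
    have hs := slack_ge J p (slack J p); move: hs; rewrite lexx => /esym hs.
    rewrite slack_ge /=; move: hs pA; rewrite /inbox; lia.
  by rewrite subr_gt0; lia.
have eG : e \in G.
  by apply: gain; rewrite /e /inbox /=; lia.
have fG (q : site) : inbox A q -> D q < 0 -> f q != e /\ f q \in G.
  move=> qA Dq; split; first by apply/eqP => -[]; move: qA; rewrite /inbox; lia.
  have hq : smax J - (q.1 + q.2) + 1 <= q.2 - bmin J + 1 /\
            smax J - (q.1 + q.2) + 1 <= amax J - q.1 + 1.
    by move: Dq qA; rewrite /D /slack /inbox /=; lia.
  by apply: gain; move: qA; rewrite /f /dR /inbox /=; lia.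
rewrite (cardfsD1 e G) eG add1n ltnS; apply/fsubset_leq_card/fsubsetP => p.
case/imfsetP => q /= qL ->; rewrite in_fsetD1; apply/andP; apply: fG.
  by move: qL; rewrite !inE /= in_boxset => /andP[].
by move: qL; rewrite !inE /= in_boxset => /andP[].
Qed.

End Improvements.

(** * A minimiser has at most one component *)

Lemma gapsumC A B : gapsum A B = gapsum B A.
Proof. by rewrite /gapsum; ring. Qed.

Lemma gapsum_mir A B : gapsum (mirb A) (mirb B) = gapsum A B.
Proof.
have E (x y : int) : - x + y = y - x by rewrite addrC.
by rewrite /gapsum /= !opprK !E; ring.
Qed.

Lemma gapsum_rot A B : gapsum (rotb A) (rotb B) = gapsum A B.
Proof.
have E (x y : int) : - x + y = y - x by rewrite addrC.
by rewrite /gapsum /= !opprK !E; ring.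
Qed.

Lemma gapsum_transr A B : gapsum A (btrans B (0, -1)) = gapsum (btrans A (0, 1)) B.
Proof. by rewrite /gapsum /=; do ![congr (_ + _)]; congr pos2; lia. Qed.

(** Moving A up by one decreases the square of the gap g >= 2 from A to B by at
    least 3. The gaps in the horizontal coordinate stay; among those in a + b,
    the one from A to B does not grow, and the opposite one becomes at most 1,
    since the gap from B to A in the coordinate a is at most g. *)
Lemma gapsum_up A B : tight A -> tight B -> 2 <= bmin B - bmax A ->
  amin A - amax B <= bmin B - bmax A -> gapsum (btrans A (0, 1)) B < gapsum A B.
Proof.
rewrite /tight => tA tB hg ha; rewrite /gapsum /= !addr0 add0r.
have e1 : pos2 (bmin B - (bmax A + 1)) + 3 <= pos2 (bmin B - bmax A).
  have -> : bmin B - (bmax A + 1) = (bmin B - bmax A) - 1 by lia.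
  rewrite /pos2; set g := bmin B - bmax A in hg *; rewrite !max_r; nia.
have e2 : pos2 (bmin A + 1 - bmax B) = 0 by rewrite /pos2 max_l ?mul0r; lia.
have e3 : 0 <= pos2 (bmin A - bmax B) by rewrite /pos2; nia.
have e4 : pos2 (smin B - (smax A + 1)) <= pos2 (smin B - smax A).
  rewrite /pos2; set x := smin B - (smax A + 1); have -> : smin B - smax A = x + 1 by lia.
  nia.
have e5 : pos2 (smin A + 1 - smax B) <= 1.
  have : smin A + 1 - smax B <= 1 by lia.
  rewrite /pos2; set x := smin A + 1 - smax B; nia.
have e6 : 0 <= pos2 (smin A - smax B) by rewrite /pos2; nia.
lia.
Qed.

Section TwoBlocks.
Variables (R : realFieldType) (lam : R).
Hypothesis lam_gt0 : 0 < lam.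
Local Notation two_blocks := (two_blocks lam).

Definition no_smaller (n : int) : Prop :=
  forall J I A B, gapsum A B < n -> two_blocks J I A B -> False.

(** The largest gap is the one from A upwards to B, and it is at least 2; the
    opposite one, bmin A - bmax B, is then negative. *)
Definition top_gap (A B : hexbox) : Prop :=
  let g := bmin B - bmax A in
  [/\ 2 <= g, amin B - amax A <= g, amin A - amax B <= g, smin B - smax A <= g
    & smin A - smax B <= g].

(** Moving up brings a site nearer to the sides b = bmax J and a + b = smax J
    only. As A lies in the lower half of J the bottom is nearer than the former;
    the two conditions say that the side a = amax J, respectively the bottom, is
    nearer than the latter. So no slack decreases and A may slide. *)
Lemma up_slide J I A B : no_smaller (gapsum A B) -> two_blocks J I A B -> top_gap A B ->
  bmax A + bmin B <= bmin J + bmax J ->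
  bmax A < smax J - amax J \/ bmax A - bmin J < smax J - smax A -> False.
Proof.
move=> IH c [g1 g2 g3 g4 g5] hm hc.
have [||I' c'] := slide lam_gt0 (v := (0, 1)) c; first by [].
  move=> p pA; have := slack_ge J p (slack J p); rewrite lexx slack_ge => /esym.
  by move: pA; rewrite /inbox /=; lia.
by apply: IH c'; apply: gapsum_up => //; [exact: conf_tA c|exact: conf_tB c].
Qed.

(** When neither block can slide, A admits a strict improvement: the swap if
    the row that fits above A is longer than the line a + b = smax A of A, and
    the lift otherwise. *)
Lemma last_case J I A B : two_blocks J I A B -> top_gap A B ->
  bmax A + bmin B <= bmin J + bmax J ->
  smax J - amax J <= bmax A -> smin J - amin J <= bmax A ->
  smax J - smax A <= bmax A - bmin J -> amin A - amin J <= bmax A - bmin J ->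
  3 * bmin B <= smax J - amin J + 2 * bmin J ->
  smax J - smax A <= amin A - amin J -> False.
Proof.
move=> c [g1 _ _ _ _] hm hUR hUL hr hl hB hrl.
have [[ba1 ba2 bb1 bb2] [bs1 bs2]] := block_bounds c.
have [[_ _ bb3 bb4] _] := block_bounds (two_blocksC c).
have := conf_tB c; rewrite /tight => tB.
have [lt|ge] := ltP (bmax A - (smax A - amax A) + 1) (smax A - bmax A - amin A - 1).
  by apply: (swap_absurd lam_gt0 c) lt => //; lia.
by apply: (lift_absurd lam_gt0 c) ge hrl => //; lia.
Qed.

Lemma two_blocks_mir J I A B : two_blocks J I A B -> exists I', two_blocks (mirb J) I' (mirb A) (mirb B).
Proof. by move=> c; apply: (two_blocks_symm lsym_mir c). Qed.
Lemma two_blocks_rot J I A B : two_blocks J I A B -> exists I', two_blocks (rotb J) I' (rotb A) (rotb B).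
Proof. by move=> c; apply: (two_blocks_symm lsym_rot c). Qed.

(** The case in which the middle of the gap lies in the lower half of J, which
    is symmetric under reflection: A slides up, or B slides down, or the last
    case applies to the blocks or to their mirror images. *)
Lemma lower_half J I A B : no_smaller (gapsum A B) -> two_blocks J I A B -> top_gap A B ->
  bmax A + bmin B <= bmin J + bmax J -> False.
Proof.
move=> IH c g hm.
have [I' c'] := two_blocks_mir c.
have g' : top_gap (mirb A) (mirb B).
  by move: g; rewrite /top_gap /= => -[g1 g2 g3 g4 g5]; split; lia.
have up := up_slide IH c g hm.
have up' : bmax A < amin J * -1 + smin J \/ bmax A - bmin J < amin A - amin J -> False.
  move=> h; apply: (@up_slide (mirb J) I' (mirb A) (mirb B)) => //; first by rewrite gapsum_mir.
  by rewrite /=; lia.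
have [lt|h1] := ltP (bmax A) (smax J - amax J); first by apply: up; left.
have [lt|h2] := ltP (bmax A - bmin J) (smax J - smax A); first by apply: up; right.
have [lt|h3] := ltP (bmax A) (smin J - amin J); first by apply: up'; left; lia.
have [lt|h4] := ltP (bmax A - bmin J) (amin A - amin J); first by apply: up'; right.
have [lt|h5] := ltP (smax J - amin J + 2 * bmin J) (3 * bmin B).
  move: (g) => [g1 g2 g3 g4 g5].
  have [||I2 c2] := slide lam_gt0 (v := (0, -1)) (two_blocksC c); first by [].
    move=> p pB; have := slack_ge J p (slack J p); rewrite lexx slack_ge => /esym.
    by move: pB; rewrite /inbox /=; lia.
  apply: IH c2; rewrite gapsumC gapsum_transr.
  by apply: gapsum_up => //; [exact: conf_tA c|exact: conf_tB c].
have [le|gt] := leP (smax J - smax A) (amin A - amin J); first exact: (last_case c).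
by apply: (last_case c') => //=; lia.
Qed.

Lemma top_gap_absurd J I A B : no_smaller (gapsum A B) -> two_blocks J I A B -> top_gap A B ->
  False.
Proof.
move=> IH c g.
have [le|gt] := leP (bmax A + bmin B) (bmin J + bmax J); first exact: lower_half IH c g le.
have [I1 c1] := two_blocks_rot c; have [I2 c2] := two_blocks_rot c1; have [I3 c3] := two_blocks_rot c2.
apply: (lower_half _ (two_blocksC c3)) => /=; last lia.
  by rewrite gapsumC !gapsum_rot.
by move: g; rewrite /top_gap /= => -[g1 g2 g3 g4 g5]; split; lia.
Qed.

(** The Helly property of lattice hexagons with attained bounds: overlap in the
    three coordinates forces a common site. *)
Lemma tight_meet H1 H2 : tight H1 -> tight H2 ->
  amin H1 <= amax H2 -> amin H2 <= amax H1 -> bmin H1 <= bmax H2 -> bmin H2 <= bmax H1 ->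
  smin H1 <= smax H2 -> smin H2 <= smax H1 -> exists p, inbox H1 p && inbox H2 p.
Proof.
rewrite /tight => t1 t2 *.
pose aL := Num.max (amin H1) (amin H2); pose bL := Num.max (bmin H1) (bmin H2).
pose bU := Num.min (bmax H1) (bmax H2); pose sL := Num.max (smin H1) (smin H2).
pose a := Num.max aL (sL - bU).
exists (a, Num.max bL (sL - a)); rewrite /inbox /a /aL /bL /bU /sL /=; lia.
Qed.

(** Without a gap of at least 2, the hexagon A meets the hexagon B enlarged by
    one in all directions, hence A and B have equal or adjacent sites. *)
Lemma blocks_gap J I A B : two_blocks J I A B ->
  [\/ 2 <= bmin B - bmax A, 2 <= bmin A - bmax B, 2 <= amin B - amax A |
    2 <= amin A - amax B] \/ (2 <= smin B - smax A \/ 2 <= smin A - smax B).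
Proof.
move=> c; apply: contrapT => hno.
have [h1 h2 h3 h4] : [/\ bmin B - bmax A < 2, bmin A - bmax B < 2, amin B - amax A < 2 &
    amin A - amax B < 2].
  by split; rewrite ltNge; apply/negP => h; apply: hno; left;
    [apply: Or41|apply: Or42|apply: Or43|apply: Or44].
have [h5 h6] : smin B - smax A < 2 /\ smin A - smax B < 2.
  by split; rewrite ltNge; apply/negP => h; apply: hno; right; [left|right].
pose B1 := Box (amin B - 1) (amax B + 1) (bmin B - 1) (bmax B + 1) (smin B - 1) (smax B + 1).
have tB1 : tight B1 by move: (conf_tB c); rewrite /tight /B1 /=; lia.
have [||||||[a b] /andP[pA pB1]] := tight_meet (conf_tA c) tB1; rewrite ?/B1 /=; try lia.
pose D := Box (a - 1) (a + 1) (b - 1) (b + 1) (a + b - 1) (a + b + 1).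
have tD : tight D by rewrite /tight /D /=; lia.
have [||||||[a' b'] /andP[qD qB]] := tight_meet tD (conf_tB c); rewrite ?/D /=;
  try (by move: pB1; rewrite /inbox /B1 /=; lia).
have pA' : (a, b) \in boxset A by rewrite in_boxset.
have qB' : (a', b') \in boxset B by rewrite in_boxset.
have dis q : q \in boxset A -> q \in boxset B -> False.
  by move=> /(fdisjointP (conf_dis c)) /negP.
have [e|ne] := eqVneq (a', b') (a, b); first by apply: (dis _ pA'); rewrite -e.
pose v : site := (a' - a, b' - b).
have vd : v \in dirs.
  rewrite !inE /v !xpair_eqE; move: qD ne; rewrite /inbox /D xpair_eqE /=; lia.
have ev : (a', b') = sadd (a, b) v by rewrite /sadd /v /= ![_ + (_ - _)]addrC !subrK.
apply: (dis _ _ qB'); rewrite ev; apply: (conf_iA c).2 => //; rewrite -ev.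
exact: (fsubsetP (conf_iB c).1).
Qed.

(** Induction on [gapsum]: sliding gives another pair of blocks with a smaller
    one, so that for a smallest one no slide is possible. The rotations bring
    the largest gap to the direction upwards. *)
Lemma no_two_blocks J I A B : two_blocks J I A B -> False.
Proof.
have [n] : exists n : nat, gapsum A B < n%:Z.
  by exists (absz (gapsum A B)).+1; have := gapsum_ge0 A B; lia.
elim: n J I A B => [|n IHn] J I A B hn c; first by have := gapsum_ge0 A B; lia.
have IH : no_smaller (gapsum A B) by move=> J' I' A' B' h; apply: IHn; lia.
have IHC : no_smaller (gapsum B A) by rewrite gapsumC.
have [I1 c1] := two_blocks_rot c; have [I2 c2] := two_blocks_rot c1.
have IH1 : no_smaller (gapsum (rotb A) (rotb B)) by rewrite gapsum_rot.
have IH1C : no_smaller (gapsum (rotb B) (rotb A)) by rewrite gapsumC.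
have IH2 : no_smaller (gapsum (rotb (rotb A)) (rotb (rotb B))) by rewrite !gapsum_rot.
have IH2C : no_smaller (gapsum (rotb (rotb B)) (rotb (rotb A))) by rewrite gapsumC.
have gap := blocks_gap c.
have t1 := top_gap_absurd IH c; have t2 := top_gap_absurd IHC (two_blocksC c).
have t3 := top_gap_absurd IH1 c1; have t4 := top_gap_absurd IH1C (two_blocksC c1).
have t5 := top_gap_absurd IH2 c2; have t6 := top_gap_absurd IH2C (two_blocksC c2).
pose m := Num.max (Num.max (Num.max (bmin B - bmax A) (bmin A - bmax B))
  (Num.max (amin B - amax A) (amin A - amax B)))
  (Num.max (smin B - smax A) (smin A - smax B)).
have m2 : 2 <= m by rewrite /m; case: gap => [[]|[]]; lia.
have : [|| m == bmin B - bmax A, m == bmin A - bmax B, m == amin B - amax A,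
    m == amin A - amax B, m == smin B - smax A | m == smin A - smax B].
  by rewrite /m; lia.
case/or4P => [/eqP e|/eqP e|/eqP e|/or3P[] /eqP e];
  [apply: t1|apply: t2|apply: t5|apply: t6|apply: t3|apply: t4];
  move: m2 e; rewrite /top_gap /m /= => *; split; lia.
Qed.

(** A nonempty minimiser is a single component, hence a hexagon. *)
Theorem minimal_box J I : minimal lam J I ->
  I = fset0 \/ exists2 H, tight H & I = boxset H.
Proof.
move=> mI; have [->|/fset0Pn[p pI]] := eqVneq I fset0; [by left|right].
have [A [pA iA cA _]] := component pI.
have A0 : A != fset0 by apply/fset0Pn; exists p.
have [HA tA eA] := block_box lam_gt0 mI iA cA A0.
case: (boolP (I `<=` A)) => [sIA|].
  by exists HA => //; apply/eqP; rewrite eqEfsubset -eA sIA iA.1.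
rewrite -fsetD_eq0 => /fset0Pn[q]; rewrite inE => /andP[qA qI]; exfalso.
have [B [qB iB cB mB]] := component qI.
have B0 : B != fset0 by apply/fset0Pn; exists q.
have [HB tB eB] := block_box lam_gt0 mI iB cB B0.
have iIA : detached (I `\` A) I.
  split; first exact: fsubsetDl.
  move=> r v vd; rewrite !inE => /andP[rA rI] sI; rewrite sI andbT; apply/negP => sA.
  case/negP: rA; rewrite -(shiftK v r); apply: iA.2 => //; first exact: opp_dirs.
  by rewrite shiftK.
have sB : B `<=` I `\` A by apply: mB; rewrite // !inE qA.
apply: (@no_two_blocks J I HA HB); split => //; rewrite -?eA -?eB //.
apply/fdisjointP => r rA; apply/negP => /(fsubsetP sB).
by rewrite !inE rA.
Qed.

End TwoBlocks.

(** * Sites outside the reference box *)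

Section Outside.
Variables (R : realFieldType) (lam : R) (J : hexbox) (d : site -> R).
Hypothesis lam_gt0 : 0 < lam.
Hypothesis d_out : forall p, ~~ inbox J p -> 0 < d p.
Hypothesis d_in : forall p, inbox J p -> d p = (slack J p)%:~R.

(** The energy in units of the length of an edge; d is the distance in units
    of the lattice, known explicitly only inside the box. *)
Definition cost (I : {fset site}) : R :=
  (nbdry I)%:R + lam * (\sum_(p <- boxset J `\` I) d p + \sum_(p <- I `\` boxset J) d p).

Lemma cost_inside I : I `<=` boxset J ->
  cost I = reduced lam J I + lam * (weight J (boxset J))%:~R.
Proof.
move=> sI; rewrite /cost /reduced.
have -> : I `\` boxset J = fset0 by apply/eqP; rewrite fsetD_eq0.
rewrite big_seq_fset0 addr0 {2}/weight (sum_fsetD _ sI) -/(weight J I) intrD.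
have -> : \sum_(p <- boxset J `\` I) d p = (\sum_(p <- boxset J `\` I) slack J p)%:~R.
  rewrite raddf_sum big_seq [RHS]big_seq; apply: eq_bigr => p.
  by rewrite in_fsetD in_boxset => /andP[_ /d_in].
by ring.
Qed.

(** Intersecting with the box does not increase the perimeter and removes
    sites of positive distance, so that a minimiser lies in the box, where
    [minimal_box] applies. *)
Theorem cost_minimizer I : (forall X, cost I <= cost X) ->
  I `<=` boxset J /\ (I = fset0 \/ exists2 H, tight H & I = boxset H).
Proof.
move=> hI.
have sI : I `<=` boxset J.
  apply: contraT => nsub; have := hI (I `&` boxset J); rewrite leNgt => /negP; case.
  rewrite /cost ler_ltD //; first by rewrite ler_nat nbdry_capbox.
  rewrite ltr_pM2l //.
  have -> : (I `&` boxset J) `\` boxset J = fset0 by apply/eqP; rewrite fsetD_eq0 fsubsetIr.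
  have -> : boxset J `\` (I `&` boxset J) = boxset J `\` I.
    by apply/fsetP => p; rewrite !inE; case: (p \in boxset J); rewrite ?andbF ?andbT.
  rewrite big_seq_fset0 ltrD2l; move: nsub; rewrite -fsetD_eq0 => /fset0Pn[p pD].
  have pos q : q \in I `\` boxset J -> 0 < d q by rewrite in_fsetD in_boxset => /andP[/d_out].
  rewrite (big_fsetD1 p) //= ltr_wpDr ?pos // big_seq sumr_ge0 // => q.
  by rewrite in_fsetD1 => /andP[_ /pos/ltW].
split => //; apply: (minimal_box lam_gt0 (J := J)); split => // X sX.
by have := hI X; rewrite !cost_inside // lerD2r.
Qed.

End Outside.

(** * Hexagonal cells *)

Local Close Scope fset_scope.
Local Open Scope classical_set_scope.
Local Open Scope ring_scope.

Section Cells.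
Variable R : realType.
Implicit Types (x y z i : R * R) (eps : R).

Local Notation s3 := (Num.sqrt (3 : R)).

Lemma s3_gt0 : 0 < s3. Proof. by rewrite sqrtr_gt0. Qed.
Lemma s3_sq : s3 * s3 = 3. Proof. by rewrite -expr2 sqr_sqrtr. Qed.

Lemma fst_add x y : (x + y).1 = x.1 + y.1. Proof. by []. Qed.
Lemma snd_add x y : (x + y).2 = x.2 + y.2. Proof. by []. Qed.
Lemma fst_opp x : (- x).1 = - x.1. Proof. by []. Qed.
Lemma snd_opp x : (- x).2 = - x.2. Proof. by []. Qed.
Lemma fst_scale (a : R) x : (a *: x).1 = a * x.1. Proof. by []. Qed.
Lemma snd_scale (a : R) x : (a *: x).2 = a * x.2. Proof. by []. Qed.
Definition coordE := (fst_add, snd_add, fst_opp, snd_opp, fst_scale, snd_scale).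

Lemma convex_setP (C : set (R * R)) : convex_set C <->
  forall x y t, C x -> C y -> 0 <= t <= 1 -> C (t *: x + (1 - t) *: y).
Proof.
split=> [cC x y t Cx Cy /andP[t0 t1]|h].
  have ht : Itv.spec (@Itv.num_sem R) (Itv.Real `[0%Z, 1%Z]) t.
    by apply/andP; split; [exact: ger0_real|rewrite /= in_itv /= t0 t1].
  have := cC x y (Itv.mk ht).
  by rewrite !inE => /(_ Cx Cy).
move=> x y l; rewrite !inE => Cx Cy.
by apply: h => //; apply/andP; split.
Qed.

Lemma pair_conv (t a b c d : R) :
  t *: (a, b) + (1 - t) *: (c, d) = (t * a + (1 - t) * c, t * b + (1 - t) * d).
Proof. by []. Qed.

(** The scalar products of x with eta_1, eta_2 and eta_3. *)
Definition yc1 x : R := x.1.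
Definition yc2 x : R := x.1 / 2 + s3 / 2 * x.2.
Definition yc3 x : R := x.1 / 2 - s3 / 2 * x.2.

Definition hexball (r : R) x : Prop :=
  [/\ `|yc1 x| <= r, `|yc2 x| <= r & `|yc3 x| <= r].

(** The convex hull of the six directions, described by its three pairs of
    parallel sides. A point that satisfies the inequalities lies on a vertical
    segment between two points of the boundary, each of which is a combination
    of two vertices. *)
Lemma hexagonE x : hexagon x <-> hexball 2^-1 x.
Proof.
have s30 := s3_gt0; have s33 := s3_sq.
split.
  case=> z hz <-.
  have : [set z | hexball (s3 / 2) z] z.
    apply: hz; split.
      apply/convex_setP => u v t [u1 u2 u3] [v1 v2 v3] /andP[t0 t1].
      split; move: u1 u2 u3 v1 v2 v3; rewrite /yc1 /yc2 /yc3 !coordE !ler_norml; nra.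
    move=> u [[[|[|[|//]]] /= hk]]; rewrite /eta /eta1 /eta2 /eta3 /eta1 /eta2 /perp /=;
      by case=> ->; split; rewrite /yc1 /yc2 /yc3 ?coordE /= ler_norml; nra.
  case=> h1 h2 h3; split; move: h1 h2 h3; rewrite /yc1 /yc2 /yc3 !coordE !ler_norml; nra.
case=> h1 h2 h3; exists (s3 *: x); last first.
  by rewrite scalerA mulrAC s33 divff ?scale1r //; lra.
move=> C [/convex_setP cC sC].
have C1 : C (0, 1).
  by apply: sC; exists ord0; left; rewrite /eta /= /perp /eta1 /= oppr0.
have C1' : C (0, -1).
  by apply: sC; exists ord0; right; rewrite /eta /= /perp /eta1 /= oppr0; congr (_, _); rewrite ?oppr0.
have C2 : C (- s3 / 2, 2^-1).
  by apply: sC; exists (@Ordinal 3 1 isT); left; rewrite /eta /= /perp /eta2 /= mulNr.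
have C2' : C (s3 / 2, - 2^-1).
  apply: sC; exists (@Ordinal 3 1 isT); right; rewrite /eta /= /perp /eta2 /=.
  by congr (_, _); rewrite ?opprK.
have C3 : C (s3 / 2, 2^-1).
  apply: sC; exists (@Ordinal 3 2 isT); left; rewrite /eta /= /perp /eta3 /eta1 /eta2 /=.
  by congr (_, _) => /=; lra.
have C3' : C (- s3 / 2, - 2^-1).
  apply: sC; exists (@Ordinal 3 2 isT); right; rewrite /eta /= /perp /eta3 /eta1 /eta2 /=.
  by congr (_, _) => /=; lra.
have vertex u h w : C (u, h) -> C (u, - h) -> 0 < h -> - h <= w <= h -> C (u, w).
  move=> Ch Cnh h0 /andP[w1 w2].
  have -> : (u, w) = ((w + h) / (2 * h)) *: (u, h) + (1 - (w + h) / (2 * h)) *: (u, - h).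
    by rewrite pair_conv; congr (_, _); field; lra.
  apply: cC => //; rewrite divr_ge0 ?ler_pdivrMr /=; lra.
have -> : s3 *: x = (s3 * x.1, s3 * x.2) by [].
move: h1 h2 h3; rewrite /yc1 /yc2 /yc3 !ler_norml => /andP[h1 h1'] /andP[h2 h2'] /andP[h3 h3'].
case: (leP 0 x.1) => x0.
  have h0 : 0 < 1 - x.1 by lra.
  have hw : - (1 - x.1) <= s3 * x.2 <= 1 - x.1 by apply/andP; split; lra.
  apply: (vertex _ (1 - x.1)) h0 hw.
    have -> : (s3 * x.1, 1 - x.1) = (2 * x.1) *: (s3 / 2, 2^-1) + (1 - 2 * x.1) *: (0, 1).
      by rewrite pair_conv; congr (_, _); field.
    by apply: cC => //; apply/andP; split; lra.
  have -> : (s3 * x.1, - (1 - x.1)) = (2 * x.1) *: (s3 / 2, - 2^-1) + (1 - 2 * x.1) *: (0, - 1).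
    by rewrite pair_conv; congr (_, _); field.
  by apply: cC => //; apply/andP; split; lra.
have h0 : 0 < 1 + x.1 by lra.
  have hw : - (1 + x.1) <= s3 * x.2 <= 1 + x.1 by apply/andP; split; lra.
  apply: (vertex _ (1 + x.1)) h0 hw.
  have -> : (s3 * x.1, 1 + x.1) = (- 2 * x.1) *: (- s3 / 2, 2^-1) + (1 - - 2 * x.1) *: (0, 1).
    by rewrite pair_conv; congr (_, _); field.
  by apply: cC => //; apply/andP; split; lra.
have -> : (s3 * x.1, - (1 + x.1)) = (- 2 * x.1) *: (- s3 / 2, - 2^-1) + (1 - - 2 * x.1) *: (0, - 1).
  by rewrite pair_conv; congr (_, _); field.
by apply: cC => //; apply/andP; split; lra.
Qed.

Lemma hexball_scale a r x : 0 < a -> hexball (a * r) (a *: x) <-> hexball r x.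
Proof.
move=> a0; have a1 := ltW a0.
have e1 : yc1 (a *: x) = a * yc1 x by [].
have e2 : yc2 (a *: x) = a * yc2 x by rewrite /yc2 !coordE; ring.
have e3 : yc3 (a *: x) = a * yc3 x by rewrite /yc3 !coordE; ring.
by rewrite /hexball e1 e2 e3 !normrM (ger0_norm a1) !ler_pM2l.
Qed.

Lemma cellE eps i x : 0 < eps -> cell eps i x <-> hexball (eps / 2) (x - i).
Proof.
move=> e0; split.
  case=> h /hexagonE[h1 h2 h3] <-; rewrite addrAC subrr add0r.
  split; move: h1 h2 h3; rewrite /yc1 /yc2 /yc3 !coordE !ler_norml; nra.
move=> hx; exists (eps^-1 *: (x - i)).
  apply/hexagonE; have -> : 2^-1 = eps^-1 * (eps / 2) by rewrite mulrA mulVf ?mul1r // gt_eqF.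
  by apply/hexball_scale; rewrite ?invr_gt0.
by rewrite scalerA divff ?gt_eqF // scale1r addrC subrK.
Qed.

Definition pt eps (p : site) : R * R :=
  eps *: (p.1%:~R *: eta1 R + p.2%:~R *: eta2 R).

Lemma latticeE eps x : lattice eps x <-> exists p, x = pt eps p.
Proof.
split=> [[a [b ->]]|[p ->]]; first by exists (a, b).
by exists p.1, p.2.
Qed.

Lemma pt1 eps p : (pt eps p).1 = eps * (p.1%:~R + p.2%:~R / 2).
Proof. by rewrite /pt /eta1 /eta2 !coordE /= mulr1. Qed.
Lemma pt2 eps p : (pt eps p).2 = eps * (p.2%:~R * (s3 / 2)).
Proof. by rewrite /pt /eta1 /eta2 !coordE /= mulr0 add0r. Qed.

End Cells.

Arguments yc1 {R} x : simpl never.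
Arguments yc2 {R} x : simpl never.
Arguments yc3 {R} x : simpl never.

(** * The tiling by cells *)

Section Tiling.
Variables (R : realType) (eps : R).
Hypothesis eps0 : 0 < eps.
Implicit Types (x y z : R * R) (p q : site).

Local Notation s3 := (Num.sqrt (3 : R)).
Local Notation pt := (pt eps).

Definition gcell p : set (R * R) := cell eps (pt p).
Definition ocell p : set (R * R) := [set x |
  [/\ `|yc1 (x - pt p)| < eps / 2, `|yc2 (x - pt p)| < eps / 2 & `|yc3 (x - pt p)| < eps / 2]].

Lemma ycB (x y : R * R) : [/\ yc1 (x - y) = yc1 x - yc1 y, yc2 (x - y) = yc2 x - yc2 y
  & yc3 (x - y) = yc3 x - yc3 y].
Proof. by rewrite /yc1 /yc2 /yc3 !coordE; split; ring. Qed.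

Lemma yc_pt p : [/\ yc1 (pt p) = eps / 2 * (2 * p.1 + p.2)%:~R,
  yc2 (pt p) = eps / 2 * (p.1 + 2 * p.2)%:~R & yc3 (pt p) = eps / 2 * (p.1 - p.2)%:~R].
Proof.
have h := s3_sq R.
rewrite /yc1 /yc2 /yc3 pt1 pt2 !(intrD, intrB, intrM).
set a := p.1%:~R; set b := p.2%:~R; set t := Num.sqrt _ in h *.
have e : t / 2 * (eps * (b * (t / 2))) = eps * b * 3 / 4 by rewrite -h; field.
by rewrite e; split; field.
Qed.

Lemma gcellP p x : gcell p x <->
  [/\ `|yc1 x - eps / 2 * (2 * p.1 + p.2)%:~R| <= eps / 2,
      `|yc2 x - eps / 2 * (p.1 + 2 * p.2)%:~R| <= eps / 2
    & `|yc3 x - eps / 2 * (p.1 - p.2)%:~R| <= eps / 2].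
Proof.
have [e1 e2 e3] := ycB x (pt p); have [f1 f2 f3] := yc_pt p.
by rewrite /gcell cellE // /hexball e1 e2 e3 f1 f2 f3.
Qed.

Lemma ocellP p x : ocell p x <->
  [/\ `|yc1 x - eps / 2 * (2 * p.1 + p.2)%:~R| < eps / 2,
      `|yc2 x - eps / 2 * (p.1 + 2 * p.2)%:~R| < eps / 2
    & `|yc3 x - eps / 2 * (p.1 - p.2)%:~R| < eps / 2].
Proof.
have [e1 e2 e3] := ycB x (pt p); have [f1 f2 f3] := yc_pt p.
by rewrite /ocell /= e1 e2 e3 f1 f2 f3.
Qed.

Lemma sub_ocell p : ocell p `<=` gcell p.
Proof. by move=> x /ocellP[h1 h2 h3]; apply/gcellP; split; exact: ltW. Qed.

Lemma pt_ocell p : ocell p (pt p).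
Proof.
by rewrite /ocell /= subrr /yc1 /yc2 /yc3 /= !mul0r ?mulr0 addr0 subr0 normr0; split; rewrite divr_gt0.
Qed.

Lemma int_close (m n : int) (t : R) :
  `|t - eps / 2 * m%:~R| <= eps / 2 -> `|t - eps / 2 * n%:~R| <= eps / 2 -> `|m - n| <= 2.
Proof.
move=> h1 h2; have e2 : 0 < eps / 2 by rewrite divr_gt0.
rewrite -(ler_int R) intr_norm intrB -(ler_pM2l e2).
rewrite -{1}(gtr0_norm e2) -normrM mulrBr.
rewrite [_ * m%:~R - _](_ : _ = (t - eps / 2 * n%:~R) - (t - eps / 2 * m%:~R)); last by ring.
by apply: le_trans (ler_normB _ _) _; lra.
Qed.

Lemma int_close_lt (m n : int) (t : R) :
  `|t - eps / 2 * m%:~R| <= eps / 2 -> `|t - eps / 2 * n%:~R| < eps / 2 -> `|m - n| <= 1.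
Proof.
move=> h1 h2; have e2 : 0 < eps / 2 by rewrite divr_gt0.
rewrite -ltzD1 -(ltr_int R) intr_norm intrB -(ltr_pM2l e2).
rewrite -{1}(gtr0_norm e2) -normrM mulrBr.
rewrite [_ * m%:~R - _](_ : _ = (t - eps / 2 * n%:~R) - (t - eps / 2 * m%:~R)); last by ring.
apply: le_lt_trans (ler_normB _ _) _.
have -> : eps / 2 * (1 + 1)%:~R = eps / 2 + eps / 2 by rewrite intrD !mulr1z mulrDr !mulr1.
lra.
Qed.

(** Two cells through x have centres at distance at most two half-widths in
    each of the three coordinates; the differences of sites allowed by this are
    0 and the six directions. *)
Lemma gcells_meet p q x : gcell p x -> gcell q x -> p = q \/ exists2 v, v \in dirs & q = sadd p v.
Proof.
move=> /gcellP[a1 a2 a3] /gcellP[b1 b2 b3].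
have h1 := int_close a1 b1; have h2 := int_close a2 b2; have h3 := int_close a3 b3.
case: p q {a1 a2 a3 b1 b2 b3} h1 h2 h3 => [a b] [c d] /= h1 h2 h3.
have [ne|ne] := eqVneq (a, b) (c, d); [by left|right].
exists (c - a, d - b); last by rewrite /sadd /= ![_ + (_ - _)]addrC !subrK.
by rewrite !inE !xpair_eqE; move: ne; rewrite xpair_eqE; lia.
Qed.

Lemma ocell_gcell p q x : gcell p x -> ocell q x -> p = q.
Proof.
move=> /gcellP[a1 a2 a3] /ocellP[b1 b2 b3].
have h1 := int_close_lt a1 b1; have h2 := int_close_lt a2 b2; have h3 := int_close_lt a3 b3.
case: p q {a1 a2 a3 b1 b2 b3} h1 h2 h3 => [a b] [c d] /= h1 h2 h3; congr (_, _); lia.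
Qed.

(** In lattice coordinates x lies in a parallelogram with corners at lattice
    points; which of these four points is the centre of a cell through x
    depends on the position of x relative to the sides of the cells. *)
Lemma gcell_cover x : exists p, gcell p x.
Proof.
have s30 := s3_gt0 R; have s33 := s3_sq R.
pose beta := x.2 * 2 / (s3 * eps); pose alpha := x.1 / eps - beta / 2.
have [e1 e2 e3] : [/\ yc1 x = eps / 2 * (2 * alpha + beta),
  yc2 x = eps / 2 * (alpha + 2 * beta) & yc3 x = eps / 2 * (alpha - beta)].
  have hb : s3 / 2 * x.2 = eps * beta * 3 / 4.
    have -> : s3 / 2 * x.2 = eps * beta * (s3 * s3) / 4.
      by rewrite /beta; field; rewrite !gt_eqF.
    by rewrite s33.
  have ha : x.1 = eps * (alpha + beta / 2) by rewrite /alpha; field; rewrite !gt_eqF.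
  by rewrite /yc1 /yc2 /yc3 hb ha; split; field.
have [fa0 fa1] : 0 <= alpha - (Num.floor alpha)%:~R /\ alpha - (Num.floor alpha)%:~R < 1.
  by have := floor_itv alpha; rewrite intrD => /andP[? ?]; split; lra.
have [fb0 fb1] : 0 <= beta - (Num.floor beta)%:~R /\ beta - (Num.floor beta)%:~R < 1.
  by have := floor_itv beta; rewrite intrD => /andP[? ?]; split; lra.
set a := Num.floor alpha in fa0 fa1; set b := Num.floor beta in fb0 fb1.
set f := alpha - a%:~R in fa0 fa1; set g := beta - b%:~R in fb0 fb1.
have crit (m n : int) : `|2 * (f - m%:~R) + (g - n%:~R)| <= 1 ->
    `|(f - m%:~R) + 2 * (g - n%:~R)| <= 1 -> `|(f - m%:~R) - (g - n%:~R)| <= 1 ->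
    exists p, gcell p x.
  move=> h1 h2 h3; exists (a + m, b + n); apply/gcellP.
  have ee : 0 < eps / 2 by rewrite divr_gt0.
  have nn c : (`|eps / 2 * c| <= eps / 2) = (`|c| <= 1).
    by rewrite normrM (gtr0_norm ee) -[X in _ <= X]mulr1 ler_pM2l.
  rewrite e1 e2 e3 -!mulrBr !nn /=.
  by split; [move: h1|move: h2|move: h3]; congr (`|_| <= 1);
    rewrite !(intrD, intrB, intrM) /f /g; ring.
have [c1|c1] := leP (2 * f + g) 1; have [c2|c2] := leP (f + 2 * g) 1.
- by apply: (crit 0 0); rewrite ler_norml; apply/andP; split; lra.
- by apply: (crit 0 1); rewrite ler_norml; apply/andP; split; lra.
- by apply: (crit 1 0); rewrite ler_norml; apply/andP; split; lra.
have [c3|c3] := leP (2 * f + g) 2; have [c4|c4] := leP (f + 2 * g) 2.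
- have [c5|c5] := leP f g.
    by apply: (crit 0 1); rewrite ler_norml; apply/andP; split; lra.
  by apply: (crit 1 0); rewrite ler_norml; apply/andP; split; lra.
- by apply: (crit 0 1); rewrite ler_norml; apply/andP; split; lra.
- by apply: (crit 1 0); rewrite ler_norml; apply/andP; split; lra.
by apply: (crit 1 1); rewrite ler_norml; apply/andP; split; lra.
Qed.

End Tiling.

(** * Unions of cells and their boundaries *)

Section Boundary.
Variables (R : realType) (eps : R).
Hypothesis eps0 : 0 < eps.
Implicit Types (x y z : R * R) (p q : site) (P : set site).

Local Notation s3 := (Num.sqrt (3 : R)).
Local Notation pt := (pt eps).
Local Notation gcell := (gcell eps).
Local Notation ocell := (ocell eps).

Lemma fst_continuous : continuous (fst : R * R -> R).
Proof. by move=> [a b]; exact: cvg_fst. Qed.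
Lemma snd_continuous : continuous (snd : R * R -> R).
Proof. by move=> [a b]; exact: cvg_snd. Qed.

Lemma yc1_continuous : continuous (@yc1 R).
Proof. exact: fst_continuous. Qed.
Lemma yc2_continuous : continuous (@yc2 R).
Proof.
move=> x; apply: cvgD; last by apply: cvgM; [exact: cvg_cst|exact: snd_continuous].
by apply: cvgM; [exact: fst_continuous|exact: cvg_cst].
Qed.
Lemma yc3_continuous : continuous (@yc3 R).
Proof.
move=> x; apply: cvgB; last by apply: cvgM; [exact: cvg_cst|exact: snd_continuous].
by apply: cvgM; [exact: fst_continuous|exact: cvg_cst].
Qed.

Lemma near_yc x (e : R) : 0 < e ->
  \forall y \near x, [/\ `|yc1 x - yc1 y| < e, `|yc2 x - yc2 y| < e & `|yc3 x - yc3 y| < e].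
Proof.
move=> e0.
have /cvgrPdist_lt/(_ _ e0) h1 := @yc1_continuous x.
have /cvgrPdist_lt/(_ _ e0) h2 := @yc2_continuous x.
have /cvgrPdist_lt/(_ _ e0) h3 := @yc3_continuous x.
by apply: filterS3 h1 h2 h3 => y.
Qed.

Lemma ngcell_near p x : ~ gcell p x -> \forall y \near x, ~ gcell p y.
Proof.
move=> np.
have [e e0 he] : exists2 e : R, 0 < e & [\/ eps / 2 + e < `|yc1 x - eps / 2 * (2 * p.1 + p.2)%:~R|,
  eps / 2 + e < `|yc2 x - eps / 2 * (p.1 + 2 * p.2)%:~R| |
  eps / 2 + e < `|yc3 x - eps / 2 * (p.1 - p.2)%:~R|].
  have room (t : R) : eps / 2 < t -> exists2 e : R, 0 < e & eps / 2 + e < t.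
    by move=> h; exists ((t - eps / 2) / 2); lra.
  have [h1|/room[e e0 h]] := leP `|yc1 x - eps / 2 * (2 * p.1 + p.2)%:~R| (eps / 2); last first.
    by exists e => //; apply: Or31.
  have [h2|/room[e e0 h]] := leP `|yc2 x - eps / 2 * (p.1 + 2 * p.2)%:~R| (eps / 2); last first.
    by exists e => //; apply: Or32.
  have [h3|/room[e e0 h]] := leP `|yc3 x - eps / 2 * (p.1 - p.2)%:~R| (eps / 2); last first.
    by exists e => //; apply: Or33.
  by case: np; apply/gcellP.
have far (s t c : R) : eps / 2 + e < `|s - c| -> `|s - t| < e -> eps / 2 < `|t - c|.
  move=> h1 h2; have := ler_normD (s - t) (t - c); rewrite addrA subrK; lra.
apply: filterS (near_yc x e0) => y [d1 d2 d3] /gcellP[//|h1 h2 h3].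
by case: he => /far => [/(_ _ d1)|/(_ _ d2)|/(_ _ d3)]; rewrite ltNge ?h1 ?h2 ?h3.
Qed.

Lemma int_close3 (m n : int) (s t : R) :
  `|t - eps / 2 * m%:~R| <= eps / 2 -> `|s - eps / 2 * n%:~R| <= eps / 2 ->
  `|s - t| < eps / 2 -> `|m - n| <= 2.
Proof.
move=> h1 h2 h3; have e2 : 0 < eps / 2 by rewrite divr_gt0.
suff : `|m - n| < 3 by lia.
rewrite -(ltr_int R) intr_norm intrB -(ltr_pM2l e2).
rewrite -{1}(gtr0_norm e2) -normrM mulrBr.
set a := _ * m%:~R in h1 *; set b := _ * n%:~R in h2 *.
move: h1 h2 h3; rewrite !ler_norml !ltr_norml => /andP[? ?] /andP[? ?] /andP[? ?].
by apply/andP; split; lra.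
Qed.

(** The cells are closed and locally finite, so that near x only the cells
    through x are met. *)
Lemma local_cells x : \forall y \near x, forall q, gcell q y -> gcell q x.
Proof.
have [p0 px] := gcell_cover eps0 x.
pose B := [fset p in [seq (a, b) | a <- irange (p0.1 - 2) (p0.1 + 2),
   b <- irange (p0.2 - 2) (p0.2 + 2)]]%fset.
have inB : \forall y \near x, forall q, gcell q y -> q \in B.
  have e2 : 0 < eps / 2 by rewrite divr_gt0.
  apply: filterS (near_yc x e2) => y [d1 d2 d3] q qy.
  move: px qy => /(gcellP eps0)[a1 a2 a3] /(gcellP eps0)[b1 b2 b3].
  have h1 := int_close3 b1 a1 d1; have h2 := int_close3 b2 a2 d2; have h3 := int_close3 b3 a3 d3.
  rewrite !inE /=; apply/allpairsP; exists q; rewrite !mem_irange.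
  by case: q {b1 b2 b3} h1 h2 h3 => c d /= h1 h2 h3; split; [lia|lia|].
have fin (s : seq site) : \forall y \near x, forall q, q \in s -> gcell q y -> gcell q x.
  elim: s => [|q s IH]; first by apply: filterE.
  have hq : \forall y \near x, gcell q y -> gcell q x.
    have [qx|nq] := pselect (gcell q x); first exact: filterE.
    by apply: filterS (ngcell_near nq).
  near=> y => r; rewrite inE => /orP[/eqP ->|rs]; first by near: y.
  by move: r rs; near: y.
near=> y => q qy.
have qB : q \in enum_fset B by move: q qy; near: y.
by move: q qB qy; near: y; exact: fin.
Unshelve. all: by end_near. Qed.

Definition region P : set (R * R) := \bigcup_(p in P) gcell p.

Lemma region_closed P : closed (region P).
Proof.
move=> x clx; have := clx _ (local_cells x) => -[y [[p Pp py] h]].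
by exists p => //; exact: h.
Qed.

(** Moving from a point of a cell towards the centre enters the open cell at
    once. *)
Lemma toward_center q x : gcell q x -> forall A, nbhs x A -> exists2 y, A y & ocell q y.
Proof.
move=> qx A /nbhs_ballP[d /= d0 dA].
set c := pt q - x; pose m := d + `|c.1| + `|c.2|.
have m0 : 0 < m by rewrite /m -addrA ltr_pwDl // addr_ge0.
have dm : 0 < d / m by rewrite divr_gt0.
have dm1 : d / m <= 1 by rewrite ler_pdivrMr // mul1r /m -addrA lerDl addr_ge0.
have e1 : `|x.1 - (x + (d / m) *: c).1| < d.
  rewrite !coordE opprD addrA subrr add0r normrN normrM (gtr0_norm dm).
  by rewrite mulrAC ltr_pdivrMr // ltr_pM2l // /m; have := normr_ge0 c.2; lra.
have e2' : `|x.2 - (x + (d / m) *: c).2| < d.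
  rewrite !coordE opprD addrA subrr add0r normrN normrM (gtr0_norm dm).
  by rewrite mulrAC ltr_pdivrMr // ltr_pM2l // /m; have := normr_ge0 c.1; lra.
exists (x + (d / m) *: c); first by apply: dA; split; rewrite -ball_normE.
move: qx; rewrite /gcell cellE // => -[h1 h2 h3].
have e2 : 0 < eps / 2 by rewrite divr_gt0.
have lin : [/\ yc1 (x + (d / m) *: c - pt q) = (1 - d / m) * yc1 (x - pt q),
  yc2 (x + (d / m) *: c - pt q) = (1 - d / m) * yc2 (x - pt q) &
  yc3 (x + (d / m) *: c - pt q) = (1 - d / m) * yc3 (x - pt q)].
  by rewrite /yc1 /yc2 /yc3 /c !coordE; split; ring.
have small (a : R) : `|a| <= eps / 2 -> `|(1 - d / m) * a| < eps / 2.
  move=> ha; rewrite normrM ger0_norm ?subr_ge0 //.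
  have := ler_wpM2l (_ : 0 <= 1 - d / m) ha; rewrite subr_ge0 => /(_ dm1) h.
  by apply: le_lt_trans h _; rewrite mulrBl mul1r gtrBl mulr_gt0.
by case: lin => l1 l2 l3; rewrite /ocell /= l1 l2 l3; split; apply: small.
Qed.

Lemma region_ocell P q x : region P x -> ocell q x -> P q.
Proof. by move=> [p Pp px] qx; rewrite -(ocell_gcell eps0 px qx). Qed.

(** Different cells do not overlap, so that the set of sites is determined by
    the union of its cells. *)
Lemma gcell_sub_region P q : gcell q `<=` region P <-> P q.
Proof.
split=> [h|Pq x qx]; last by exists q.
apply: (@region_ocell P q (pt q)); last exact: pt_ocell.
by apply: h; apply: sub_ocell => //; exact: pt_ocell.
Qed.

(** A boundary point of the union lies in a cell of the union, and, as the cells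
    cover a neighbourhood, in a cell outside; the two are neighbours. Conversely
    a point of a cell outside is a limit of points of its interior. *)
Lemma bdry_region P : bdry (region P) =
  [set x | exists p v, [/\ P p, v \in dirs, ~ P (sadd p v), gcell p x & gcell (sadd p v) x]].
Proof.
apply/seteqP; split=> x.
  case; rewrite -(closure_id _).1; last exact: region_closed.
  move=> [p Pp px] nint.
  have [q [qx nPq]] : exists q, gcell q x /\ ~ P q.
    apply: contrapT => hno; apply: nint; rewrite /interior.
    apply: filterS (local_cells x) => y hy; have [q qy] := gcell_cover eps0 y.
    by exists q => //; apply: contrapT => nP; apply: hno; exists q; split=> //; exact: hy.
  have [e|[v vd e]] := gcells_meet eps0 px qx; first by rewrite e in Pp.
  by exists p, v; split=> //; rewrite -e.
move=> [p [v [Pp vd nP px qx]]]; split; first by apply: subset_closure; exists p.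
rewrite /interior => /(toward_center qx)[y Py qy].
by apply: nP; exact: region_ocell Py qy.
Qed.

Lemma admissibleP E : admissible eps E <-> exists P, E = region P.
Proof.
split.
  case=> I sI ->; exists [set p | I (pt p)]; apply/seteqP; split=> x.
    by move=> [i Ii ix]; have /latticeE[p e] := sI _ Ii; exists p; rewrite /= -?e //= /gcell -e.
  by move=> [p Ip px]; exists (pt p).
case=> P ->; exists [set i | exists2 p, P p & i = pt p].
  by move=> _ [p _ ->]; apply/latticeE; exists p.
apply/seteqP; split=> x; first by move=> [p Pp px]; exists (pt p) => //; exists p.
by move=> [_ [p Pp ->] px]; exists p.
Qed.

End Boundary.

(** * Hausdorff measure of finitely many segments *)

Section Hausdorff.
Variable R : realType.
Implicit Types (x y z : R * R) (U V A : set (R * R)).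

Lemma enorm_ge0 x : 0 <= enorm x. Proof. exact: sqrtr_ge0. Qed.
Lemma dotxx_ge0 x : 0 <= dot x x.
Proof. by rewrite /dot addr_ge0 // -expr2 sqr_ge0. Qed.
Lemma enorm_sq x : enorm x ^+ 2 = dot x x.
Proof. by rewrite sqr_sqrtr // dotxx_ge0. Qed.

Lemma enormZ (a : R) x : enorm (a *: x) = `|a| * enorm x.
Proof.
rewrite /enorm (_ : dot (a *: x) (a *: x) = a ^+ 2 * dot x x).
  by rewrite sqrtrM ?sqr_ge0 // sqrtr_sqr.
by rewrite /dot !coordE; ring.
Qed.

Lemma cauchy_schwarz x y : `|dot x y| <= enorm x * enorm y.
Proof.
rewrite -(ler_pXn2r (_ : 0 < 2)%N) ?nnegrE ?mulr_ge0 ?enorm_ge0 //.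
rewrite real_normK ?num_real // exprMn !enorm_sq /dot -subr_ge0.
have -> : (x.1 * x.1 + x.2 * x.2) * (y.1 * y.1 + y.2 * y.2) - (x.1 * y.1 + x.2 * y.2) ^+ 2
  = (x.1 * y.2 - x.2 * y.1) ^+ 2 by ring.
exact: sqr_ge0.
Qed.

Lemma ediam_ge0 U : (0 <= ediam U)%E.
Proof. by rewrite /ediam le_max lexx. Qed.

Lemma ediam_pair U x y : U x -> U y -> ((enorm (x - y))%:E <= ediam U)%E.
Proof.
move=> Ux Uy; rewrite /ediam le_max; apply/orP; right.
by apply: ereal_sup_ubound; exists (x, y).
Qed.

Lemma ediam_le U (r : R) : 0 <= r ->
  (forall x y, U x -> U y -> enorm (x - y) <= r) -> (ediam U <= r%:E)%E.
Proof.
move=> r0 h; rewrite /ediam ge_max lee_fin r0 /=; apply: ge_ereal_sup.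
by move=> _ [[x y] [/= Ux Uy] <-]; rewrite lee_fin; apply: h.
Qed.

Lemma ediam_mono U V : U `<=` V -> (ediam U <= ediam V)%E.
Proof.
move=> UV; rewrite /ediam ge_max ediam_ge0 /=; apply: ge_ereal_sup.
by move=> _ [[x y] [/= Ux Uy] <-]; apply: ediam_pair; apply: UV.
Qed.

Lemma ediam0 : ediam (set0 : set (R * R)) = 0%E.
Proof. by apply/eqP; rewrite eq_le ediam_ge0 andbT; apply: ediam_le. Qed.

Definition along (p d : R * R) (t : R) : R * R := p + t *: d.

(** Orthogonal projection to the line of the segment does not increase
    diameters, and sends a cover of the segment to a cover of an interval by
    sets that lie in intervals of length their diameter; Lebesgue measure is
    countably subadditive. *)
Lemma cover_length (p d : R * R) (a b : R) (V : nat -> set (R * R)) :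
  0 < enorm d -> a <= b ->
  (forall t, a <= t <= b -> exists k, V k (along p d t)) ->
  (((b - a) * enorm d)%:E <= \sum_(0 <= k <oo) ediam (V k))%E.
Proof.
move=> d0 ab cov.
have d2 : 0 < dot d d by rewrite -enorm_sq exprn_gt0.
case: (pselect (exists k, ediam (V k) = +oo%E)) => [[k kP]|hfin].
  rewrite (nneseries_pinfty _ (isT : xpredT k) kP) ?leey // => n _; exact: ediam_ge0.
have finV k : exists D : R, 0 <= D /\ ediam (V k) = D%:E.
  have := ediam_ge0 (V k); case e : (ediam (V k)) => [D| |] //.
    by rewrite lee_fin => D0; exists D.
  by move=> _; case: hfin; exists k.
pose D k := projT1 (cid (finV k)).
have [D0 DE] : (forall k, 0 <= D k) /\ (forall k, ediam (V k) = (D k)%:E).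
  by split=> k; rewrite /D; case: cid => ? [].
pose f x : R := dot (x - p) d / dot d d.
have fa t : f (along p d t) = t.
  rewrite /f /along (_ : dot _ d = t * dot d d); first by rewrite mulfK // gt_eqF.
  by rewrite /dot !coordE; ring.
have flip x y : `|f x - f y| <= enorm (x - y) / enorm d.
  rewrite /f -mulrBl (_ : dot (x - p) d - dot (y - p) d = dot (x - y) d); last first.
    by rewrite /dot !coordE; ring.
  rewrite normrM (gtr0_norm (_ : 0 < (dot d d)^-1)) ?invr_gt0 // ler_pdivrMr //.
  apply: le_trans (cauchy_schwarz _ _) _; rewrite -enorm_sq expr2 mulrA mulfVK ?gt_eqF //.
pose J k : set R := [set` `[inf (f @` V k), inf (f @` V k) + D k / enorm d]].
have VJ k x : V k x -> J k (f x).
  move=> Vx.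
  have lb : has_lbound (f @` V k).
    exists (f x - D k / enorm d) => _ [y Vy <-].
    have := flip x y; have : enorm (x - y) <= D k by rewrite -lee_fin -DE; apply: ediam_pair.
    move=> h; have : enorm (x - y) / enorm d <= D k / enorm d by rewrite ler_pM2r ?invr_gt0.
    by move=> h1 /ler_normlP[]; lra.
  rewrite /J /= in_itv /=; apply/andP; split; first by apply: ge_inf => //; exists x.
  rewrite -lerBlDr; apply: lb_le_inf; first by exists (f x), x.
  move=> _ [y Vy <-].
  have := flip x y; have : enorm (x - y) <= D k by rewrite -lee_fin -DE; apply: ediam_pair.
  move=> h; have : enorm (x - y) / enorm d <= D k / enorm d by rewrite ler_pM2r ?invr_gt0.
  by move=> h1 /ler_normlP[]; lra.
have sub : [set` `[a, b]] `<=` \bigcup_k J k.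
  move=> t /=; rewrite in_itv /= => /cov[k Vk]; exists k => //.
  by rewrite -(fa t); apply: VJ.
have : (lebesgue_measure ([set` `[a, b]] : set R) <=
    \sum_(0 <= k <oo) lebesgue_measure (J k))%E.
  by apply: measure_sigma_subadditive => // k; exact: measurable_itv.
rewrite lebesgue_measure_itv /= => hm.
have hab : ((b - a)%:E <= if (a%:E < b%:E)%E then (b%:E - a%:E) else 0)%E.
  by case: ifP => [_|]; rewrite ?lee_fin // lte_fin => /negbT; rewrite -leNgt subr_le0.
have hJ : (\sum_(0 <= k <oo) lebesgue_measure (J k) <=
   \sum_(0 <= k <oo) ((enorm d)^-1%:E * ediam (V k)))%E.
  apply: lee_nneseries => [k _ _|k _]; first exact: measure_ge0.
  rewrite lebesgue_measure_itv /= DE; case: ifP => _.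
    by rewrite -EFinD -EFinM lee_fin addrC addKr mulrC.
  by rewrite -EFinM lee_fin mulr_ge0 ?invr_ge0 // ltW.
have := le_trans hab (le_trans hm hJ); rewrite nneseriesZl; last by move=> k _; exact: ediam_ge0.
move=> h; have := lee_wpmul2l (_ : (0 <= (enorm d)%:E)%E) h; rewrite lee_fin enorm_ge0 => /(_ isT).
by rewrite muleA -!EFinM divff ?gt_eqF // mul1e mulrC.
Qed.

End Hausdorff.

Section Segments.
(** Segments of the same length that may share end points: away from these they
    have positive distance from each other. *)
Variables (R : realType) (N : nat) (P D : 'I_N -> R * R) (L : R).
Hypothesis L0 : 0 < L.
Hypothesis DL : forall e, enorm (D e) = L.
Hypothesis sep : forall th : R, 0 < th -> th < 2^-1 -> exists2 del : R, 0 < del &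
  forall e e' t t', e != e' -> th <= t <= 1 - th -> th <= t' <= 1 - th ->
    del <= enorm (along (P e) (D e) t - along (P e') (D e') t').

Definition segments : set (R * R) :=
  [set x | exists e t, 0 <= t <= 1 /\ x = along (P e) (D e) t].

(** After shortening all segments by the fraction th at both ends, a set of
    sufficiently small diameter meets at most one of them. Then the lengths of
    the shortened segments add up. *)
Lemma segments_lower (th : R) : 0 < th -> th < 2^-1 ->
  ((N%:R * ((1 - 2 * th) * L))%:E <= hausdorff1 segments)%E.
Proof.
move=> th0 th1; have [del del0 hdel] := sep th0 th1.
have r0 : 0 < del / 2 by rewrite divr_gt0.
apply: le_trans (ereal_sup_ubound (ex_intro2 _ _ (del / 2) r0 erefl)).
apply: le_ereal_inf_tmp => _ [U [diamU covU] <-].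
pose V e k := U k `&` [set x | exists t, th <= t <= 1 - th /\ x = along (P e) (D e) t].
have one k : (\sum_e ediam (V e k) <= ediam (U k))%E.
  case: (pselect (exists e, V e k !=set0)) => [[e [x [Ux [t [ht ex]]]]]|hno].
    rewrite (bigD1 e) //= big1; first by rewrite adde0; apply: ediam_mono; exact: subIsetl.
    move=> e' ne; suff -> : V e' k = set0 by exact: ediam0.
    apply/seteqP; split=> // y [Uy [t' [ht' ey]]]; exfalso.
    have ne' : e != e' by rewrite eq_sym.
    have := hdel _ _ _ _ ne' ht ht'; rewrite -ey -ex.
    have := le_trans (ediam_pair Ux Uy) (diamU k); rewrite lee_fin; lra.
  rewrite big1; first exact: ediam_ge0.
  move=> e _; suff -> : V e k = set0 by exact: ediam0.
  by apply/seteqP; split=> // y Vy; case: hno; exists e, y.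
apply: (@le_trans _ _ (\sum_(0 <= k <oo) \sum_e ediam (V e k))%E); last first.
  apply: lee_nneseries => [k _ _|k _]; last exact: one.
  by apply: sume_ge0 => e _; exact: ediam_ge0.
rewrite nneseries_sum; last by move=> *; exact: ediam_ge0.
have -> : (N%:R * ((1 - 2 * th) * L))%:E = (\sum_(e < N) ((1 - 2 * th) * L)%:E)%E.
  by rewrite sumEFin sumr_const card_ord mulr_natl.
apply: lee_sum => e _; rewrite -{1}(DL e).
have -> : 1 - 2 * th = (1 - th) - th by ring.
apply: cover_length; [by rewrite DL|lra|].
move=> t /andP[ht1 ht2]; have /covU[k _ Uk] : segments (along (P e) (D e) t).
  by exists e, t; split=> //; apply/andP; split; lra.
exists k; apply: (conj Uk); exists t; split; [by rewrite ht1 ht2|by []].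
Qed.

(** Each segment is cut into m pieces of length L / m, and the sets of the cover
    with index k from e m to e m + m - 1 are the pieces of the segment e. *)
Lemma segments_upper : (hausdorff1 segments <= (N%:R * L)%:E)%E.
Proof.
apply: ge_ereal_sup => _ [r /= r0 <-].
have [M hM] : exists M : nat, L / M.+1%:R <= r.
  exists (Num.truncn (L / r)); rewrite ler_pdivrMr ?ltr0n // mulrC -ler_pdivrMr //.
  by apply/ltW; apply: truncnS_gt; rewrite ?divr_ge0 // ltW.
set m := M.+1 in hM; have m0 : 0 < m%:R :> R by rewrite ltr0n.
pose U k : set (R * R) := [set x | exists (e : 'I_N) t, [/\ (k %/ m = e)%N,
  (k %% m)%:R / m%:R <= t <= (k %% m).+1%:R / m%:R & x = along (P e) (D e) t]].
have diamU k : (ediam (U k) <= (L / m%:R)%:E)%E.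
  apply: ediam_le; first by rewrite divr_ge0 // ltW.
  move=> _ _ [e [t [ke /andP[ht1 ht2] ->]]] [e' [t' [ke' /andP[ht1' ht2'] ->]]].
  have <- : e = e' by apply: val_inj; rewrite /= -ke -ke'.
  rewrite /along [X in enorm X](_ : _ = (t - t') *: D e); last first.
    by rewrite scalerBl opprD addrACA subrr add0r.
  rewrite enormZ DL mulrC ler_pM2l // ler_norml.
  by move: ht2 ht2'; rewrite -natr1 mulrDl => ? ?; apply/andP; split; lra.
apply: ge_ereal_inf; exists (\sum_(0 <= k <oo) ediam (U k))%E.
  exists U => //; split.
    by move=> k; apply: le_trans (diamU k) _; rewrite lee_fin.
  move=> x [e [t [/andP[t0 t1] ->]]].
  have [j jm [j1 j2]] : exists2 j, (j < m)%N & j%:R / m%:R <= t /\ t <= j.+1%:R / m%:R.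
    have [->|tn1] := eqVneq t 1.
      by exists M => //; rewrite ler_pdivrMr // mul1r ler_nat leqnSn divff ?gt_eqF.
    have tm0 : 0 <= t * m%:R by rewrite mulr_ge0 // ltW.
    have /andP[h1 h2] := truncn_itv tm0.
    exists (Num.truncn (t * m%:R)).
      rewrite -(ltr_nat R); apply: le_lt_trans h1 _.
      by rewrite -[X in _ < X]mul1r ltr_pM2r // lt_neqAle tn1.
    by rewrite ler_pdivrMr // h1 ler_pdivlMr // ltW.
  exists (e * m + j)%N => //; exists e, t.
  by rewrite divnMDl // divn_small // addn0 modnMDl modn_small // j1 j2.
rewrite (nneseries_split 0%N (N * m)%N); last by move=> *; exact: ediam_ge0.
rewrite [X in (_ + X)%E]eseries0 ?adde0; last first.
  move=> k hk _; suff -> : U k = set0 by exact: ediam0.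
  apply/seteqP; split=> // x [e [t [ke _ _]]].
  have := ltn_ord e; rewrite -ke; have := leq_div2r m hk; rewrite add0n mulnK //.
  by move=> /leq_ltn_trans h /h; rewrite ltnn.
apply: (@le_trans _ _ (\sum_(0 <= k < 0 + N * m) (L / m%:R)%:E)%E).
  by apply: lee_sum => k _; exact: diamU.
rewrite sumEFin add0n sumr_const_nat subn0 lee_fin -[_ *+ (N * m)]mulr_natl natrM.
by rewrite -mulrA [m%:R * _]mulrC divfK // gt_eqF.
Qed.

(** The lower bounds tend to the upper one as th tends to 0. *)
Theorem hausdorff1_segments : hausdorff1 segments = (N%:R * L)%:E.
Proof.
apply/eqP; rewrite eq_le segments_upper /=.
have h4 : 0 < 4^-1 :> R by rewrite invr_gt0.
have h42 : 4^-1 < 2^-1 :> R by lra.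
have := segments_upper; have := segments_lower.
case: (hausdorff1 segments) => [h| |] hl; rewrite ?leey //; last first.
  by have := hl _ h4 h42; rewrite leeNy_eq.
move=> hu; rewrite lee_fin leNgt; apply/negP => lt.
have NL0 : 0 < N%:R * L.
  have := hl _ h4 h42; rewrite lee_fin => h5.
  have : 0 <= N%:R * L by rewrite mulr_ge0 // ltW.
  by rewrite le_eqVlt => /orP[/eqP e|//]; nra.
pose th := Num.min (4^-1) ((N%:R * L - h) / (4 * (N%:R * L))).
have th0 : 0 < th by rewrite lt_min h4 /=; apply: divr_gt0; [rewrite subr_gt0|apply: mulr_gt0].
have th1 : th < 2^-1 by rewrite gt_min; apply/orP; left; lra.
have := hl th th0 th1; rewrite lee_fin.
have : th * (4 * (N%:R * L)) <= N%:R * L - h.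
  have hth : th <= (N%:R * L - h) / (4 * (N%:R * L)) by rewrite /th ge_min lexx orbT.
  by move: hth; rewrite ler_pdivlMr //; apply: mulr_gt0.
nra.
Qed.

End Segments.

(** * Cell edges and the perimeter *)

Section Edges.
Variables (R : realType) (eps : R).
Hypothesis eps0 : 0 < eps.
Implicit Types (x y z : R * R) (p q v : site).

Local Notation s3 := (Num.sqrt (3 : R)).
Local Notation dir := (pt (1 : R)).
Local Notation pt := (pt eps).
Local Notation gcell := (gcell eps).

Lemma perp1 x : (perp x).1 = - x.2. Proof. by []. Qed.
Lemma perp2 x : (perp x).2 = x.1. Proof. by []. Qed.

Definition edge_dir v : R * R := (eps * s3 / 3) *: perp (dir v).
Definition edge_start p v : R * R :=
  pt p + (eps / 2) *: (dir v - (s3 / 3) *: perp (dir v)).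

Lemma edge_dir_norm v : v \in dirs -> enorm (edge_dir v) = eps * s3 / 3.
Proof.
have s30 := s3_gt0 R; have s33 := s3_sq R.
move=> vd; rewrite enormZ ger0_norm; last by rewrite !mulr_ge0 ?invr_ge0 // ltW.
suff -> : enorm (perp (dir v)) = 1 by rewrite mulr1.
rewrite /enorm /dot perp1 perp2 pt1 pt2 !mul1r.
set t := s3 in s33 *.
suff -> : - (v.2%:~R * (t / 2)) * - (v.2%:~R * (t / 2)) +
    (v.1%:~R + v.2%:~R / 2) * (v.1%:~R + v.2%:~R / 2) = 1 by rewrite sqrtr1.
rewrite mulrNN mulrACA (_ : t / 2 * (t / 2) = 3 / 4); last first.
  by rewrite mulrACA s33; field.
by move: vd; dircases; rewrite ?intrN; field.
Qed.

(** Division by 2 under a name, so that eps / 2 stays the only visible halving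
    in the coordinates of the points of an edge. *)
Definition half (a : R) : R := a / 2.

Lemma edge_yc p v t : [/\
  yc1 (along (edge_start p v) (edge_dir v) t) =
    eps / 2 * ((2 * p.1 + p.2)%:~R + half ((2 * v.1 + v.2)%:~R - (2 * t - 1) * v.2%:~R)),
  yc2 (along (edge_start p v) (edge_dir v) t) =
    eps / 2 * ((p.1 + 2 * p.2)%:~R + half ((v.1 + 2 * v.2)%:~R + (2 * t - 1) * v.1%:~R)) &
  yc3 (along (edge_start p v) (edge_dir v) t) =
    eps / 2 * ((p.1 - p.2)%:~R + half ((v.1 - v.2)%:~R - (2 * t - 1) * (v.1 + v.2)%:~R))].
Proof.
have s33 := s3_sq R.
have e1 : (along (edge_start p v) (edge_dir v) t).1 =
    eps * (p.1%:~R + p.2%:~R / 2) + eps / 2 * ((v.1%:~R + v.2%:~R / 2)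
     - (2 * t - 1) * v.2%:~R * (s3 * s3) / 6).
  by rewrite /along /edge_start /edge_dir !(pt1, pt2, coordE, perp1, perp2); field.
have e2 : s3 / 2 * (along (edge_start p v) (edge_dir v) t).2 = (s3 * s3) * (
    eps * p.2%:~R / 4 + eps / 2 * (v.2%:~R / 4 + (2 * t - 1) * (v.1%:~R + v.2%:~R / 2) / 6)).
  by rewrite /along /edge_start /edge_dir !(pt1, pt2, coordE, perp1, perp2); field.
rewrite s33 in e1 e2.
rewrite /yc1 /yc2 /yc3 e1 e2 /half !(intrD, intrB, intrM).
by split; field.
Qed.

Lemma yc_inj x y : yc1 x = yc1 y -> yc2 x = yc2 y -> x = y.
Proof.
have s30 := s3_gt0 R.
case: x y => [a b] [c d]; rewrite /yc1 /yc2 /= => -> /addrI h; congr (_, _).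
by apply: (mulfI _ h); rewrite mulf_neq0 ?gt_eqF ?invr_gt0.
Qed.

(** Neighbouring cells meet in the edge between them. In the coordinates along
    eta_1, eta_2, eta_3 the points of both cells satisfy twelve inequalities;
    two of them fix the coordinate in direction v, and the parameter sg is the
    coordinate along the edge, scaled to the interval from -1 to 1. *)
Lemma edgeE p v x : v \in dirs -> (gcell p x /\ gcell (sadd p v) x) <->
  exists t, 0 <= t <= 1 /\ x = along (edge_start p v) (edge_dir v) t.
Proof.
move=> vd; have ee : 0 < eps / 2 by rewrite divr_gt0.
have nn (c d : R) : (`|eps / 2 * c - eps / 2 * d| <= eps / 2) = (`|c - d| <= 1).
  by rewrite -mulrBr normrM (gtr0_norm ee) -[X in _ <= X]mulr1 ler_pM2l.
split.
  move=> [/(gcellP eps0) px /(gcellP eps0) qx].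
  pose u1 := yc1 x / (eps / 2); pose u2 := yc2 x / (eps / 2).
  have y1 : yc1 x = eps / 2 * u1 by rewrite /u1 mulrC divfK ?gt_eqF.
  have y2 : yc2 x = eps / 2 * u2 by rewrite /u2 mulrC divfK ?gt_eqF.
  have y3 : yc3 x = eps / 2 * (u1 - u2).
    have -> : yc3 x = yc1 x - yc2 x by rewrite /yc1 /yc2 /yc3; field.
    by rewrite y1 y2 mulrBr.
  move: px qx; rewrite y1 y2 y3 !nn /sadd /= => -[a1 a2 a3] [b1 b2 b3].
  pose w1 := u1 - (2 * p.1 + p.2)%:~R; pose w2 := u2 - (p.1 + 2 * p.2)%:~R.
  pose sg := (2 * v.1 + v.2)%:~R * w2 - (v.1 + 2 * v.2)%:~R * w1 : R.
  have {a1} a1 : `|w1| <= 1 by [].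
  have {a2} a2 : `|w2| <= 1 by [].
  have {a3} a3 : `|w1 - w2| <= 1.
    by move: a3; congr (`|_| <= 1); rewrite /w1 /w2 !(intrD, intrB, intrM); ring.
  have {b1} b1 : `|w1 - (2 * v.1 + v.2)%:~R| <= 1.
    by move: b1; congr (`|_| <= 1); rewrite /w1 !(intrD, intrB, intrM); ring.
  have {b2} b2 : `|w2 - (v.1 + 2 * v.2)%:~R| <= 1.
    by move: b2; congr (`|_| <= 1); rewrite /w2 !(intrD, intrB, intrM); ring.
  have {b3} b3 : `|w1 - w2 - (v.1 - v.2)%:~R| <= 1.
    by move: b3; congr (`|_| <= 1); rewrite /w1 /w2 !(intrD, intrB, intrM); ring.
  have {sg} [sg [sg1 e1 e2]] : exists sg : R, [/\ `|sg| <= 1,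
      w1 = half ((2 * v.1 + v.2)%:~R - sg * v.2%:~R) &
      w2 = half ((v.1 + 2 * v.2)%:~R + sg * v.1%:~R)].
    exists sg; move: w1 w2 @sg a1 a2 a3 b1 b2 b3 => w1 w2 /=; rewrite /half.
    move: vd; dircases; rewrite !(intrD, intrB, intrM, intrN) !ler_norml;
      move=> /andP[? ?] /andP[? ?] /andP[? ?] /andP[? ?] /andP[? ?] /andP[? ?];
      by split; [apply/andP; split; lra|lra|lra].
  exists ((sg + 1) / 2); split.
    by move: sg1; rewrite ler_norml => /andP[? ?]; apply/andP; split; lra.
  have [f1 f2 _] := edge_yc p v ((sg + 1) / 2).
  have es : 2 * ((sg + 1) / 2) - 1 = sg by field.
  rewrite es -?e1 -?e2 in f1 f2.
  by apply: yc_inj; rewrite ?f1 ?f2 ?y1 ?y2; congr (_ * _); rewrite /w1 /w2; ring.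
move=> [t [/andP[t0 t1] ->]].
have [f1 f2 f3] := edge_yc p v t.
have sg1 : -1 <= 2 * t - 1 by lra.
have sg2 : 2 * t - 1 <= 1 by lra.
set sg := 2 * t - 1 in f1 f2 f3 sg1 sg2.
split; apply/(gcellP eps0); rewrite f1 f2 f3 !nn /sadd /= /half !(intrD, intrB, intrM) !ler_norml;
  move: vd; dircases; rewrite ?(intrN); split; apply/andP; split; lra.
Qed.

End Edges.

Section Edges.
Variables (R : realType) (eps : R).
Hypothesis eps0 : 0 < eps.
Implicit Types (x y z : R * R) (p q v : site).

Local Notation s3 := (Num.sqrt (3 : R)).
Local Notation pt := (pt eps).
Local Notation gcell := (gcell eps).
Local Notation edge_start := (edge_start eps).
Local Notation edge_dir := (edge_dir eps).

Lemma yc_enorm z : [/\ `|yc1 z| <= enorm z, `|yc2 z| <= enorm z & `|yc3 z| <= enorm z].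
Proof.
have s33 := s3_sq R.
have key (u : R * R) : dot u u = 1 -> `|dot z u| <= enorm z.
  move=> u1; have := cauchy_schwarz z u.
  have -> : enorm u = 1 by rewrite /enorm u1 sqrtr1.
  by rewrite mulr1.
split.
- by have := key (1, 0); rewrite /dot /yc1 /= !mulr0 !mulr1 !addr0; apply.
- rewrite (_ : yc2 z = dot z (2^-1, s3 / 2)); last by rewrite /dot /yc2 /= [_ * (s3 / 2)]mulrC.
  by apply: key; rewrite /dot /= mulrACA s33; field.
- rewrite (_ : yc3 z = dot z (2^-1, - (s3 / 2))).
    by apply: key; rewrite /dot /= mulrNN mulrACA s33; field.
  by rewrite /dot /yc3 /= mulrN [_ * (s3 / 2)]mulrC.
Qed.

Lemma norm_lt3 (n : int) : `|n| < 3 -> `|n| <= 2.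
Proof. lia. Qed.

(** Away from its ends, the coordinates of a point of the edge other than the
    one in direction v differ from those of the centre of the edge by less than
    half the width of a cell. Hence a cell that comes near such a point has its
    centre so close to the edge that, the coordinates of sites being integers,
    the centre can only be p or p + v. *)
Lemma edge_away p v q t (th : R) y : v \in dirs -> 0 < th -> th <= t <= 1 - th ->
  gcell q y -> q <> p -> q <> sadd p v ->
  eps * th / 4 <= enorm (along (edge_start p v) (edge_dir v) t - y).
Proof.
move=> vd th0 /andP[t0 t1] /(gcellP eps0)[q1 q2 q3] nqp nqv; rewrite leNgt; apply/negP => lt.
set x := along _ _ _ in lt.
have [n1 n2 n3] := yc_enorm (x - y).
have [d1 d2 d3] := ycB x y.
have ee : 0 < eps / 2 by rewrite divr_gt0.
have [f1 f2 f3] := edge_yc eps p v t; rewrite -/x in f1 f2 f3.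
have key (X Y M : R) (a k l : int) : X = eps / 2 * (k%:~R + half (l%:~R + M)) ->
    `|Y - eps / 2 * a%:~R| <= eps / 2 -> `|X - Y| <= enorm (x - y) -> `|M| <= 1 - 2 * th ->
    `|2 * (a - k) - l| <= 2.
  move=> eX hY hXY hM.
  have h : `|X - eps / 2 * a%:~R| < eps / 2 * (1 + th / 2).
    have := ler_normD (X - Y) (Y - eps / 2 * a%:~R); rewrite addrA subrK.
    by move=> h; apply: le_lt_trans h _; rewrite mulrDr mulr1; lra.
  apply: norm_lt3.
  rewrite -(ltr_int R) intr_norm !(intrB, intrM).
  move: h; rewrite eX -mulrBr normrM (gtr0_norm ee) ltr_pM2l // /half.
  move: hM; rewrite ler_norml !ltr_norml => /andP[? ?] /andP[? ?].
  by apply/andP; split; lra.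
have small (m : int) : `|m| <= 1 -> `|(2 * t - 1) * m%:~R| <= 1 - 2 * th.
  move=> hm; rewrite normrM -intr_norm; apply: (@le_trans _ _ (`|2 * t - 1| * 1)).
    by apply: ler_wpM2l => //; rewrite -(ler_int R) in hm.
  by rewrite mulr1 ler_norml; apply/andP; split; lra.
have [v1 v2 v3] : [/\ `|v.1| <= 1, `|v.2| <= 1 & `|v.1 + v.2| <= 1].
  by move: vd; clear; dircases.
have c1 := key _ _ _ _ _ _ f1 q1; rewrite -d1 normrN in c1; have {}c1 := c1 n1 (small _ v2).
have c2 := key _ _ _ _ _ _ f2 q2; rewrite -d2 in c2; have {}c2 := c2 n2 (small _ v1).
have c3 := key _ _ _ _ _ _ f3 q3; rewrite -d3 normrN in c3; have {}c3 := c3 n3 (small _ v3).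
move: vd c1 c2 c3 nqp nqv; clear; case: p q => [a b] [c d] /= vd c1 c2 c3 nqp nqv.
have h : (c, d) = (a, b) \/ (c, d) = sadd (a, b) v.
  move: vd c1 c2 c3; rewrite /sadd; dircases => c1 c2 c3;
    (have [e|e] := eqVneq (c, d) (a, b); [by left|right]);
    move: e; rewrite xpair_eqE => e; congr (_, _); lia.
by case: h.
Qed.

Definition edges (I : {fset site}) : seq (site * site) :=
  [seq (p, v) | v <- dirs, p <- enum_fset (exits v I)].

Lemma size_edges I : size (edges I) = nbdry I.
Proof. by rewrite size_allpairs_dep sumnE big_map. Qed.

Lemma edges_uniq I : uniq (edges I).
Proof.
apply: allpairs_uniq_dep => // [v _|[v p] [v' p'] _ _ /= [-> ->]] //.
exact: fset_uniq.
Qed.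

Lemma mem_edges I p v : ((p, v) \in edges I) =
  [&& v \in dirs, p \in I & sadd p v \notin I].
Proof.
apply/allpairsPdep/and3P => [[w [q [wd]]]|[vd pI sI]].
  by rewrite in_exits => /andP[qI sI] [-> ->].
by exists v, p; rewrite in_exits pI sI.
Qed.

(** The boundary consists of the edges between cells of the union and cells
    outside, all of length eps sqrt 3 / 3, and two different edges are apart
    except near their ends. *)
Theorem perimeter_region (I : {fset site}) :
  perimeter (region eps [set p | p \in I]) = ((nbdry I)%:R * (eps * s3 / 3))%:E.
Proof.
have s30 := s3_gt0 R.
have L0 : 0 < eps * s3 / 3 by rewrite !mulr_gt0 // invr_gt0.
pose e0 : site * site := ((0, 0), (0, 0)).
pose N := size (edges I); pose E (i : 'I_N) := nth e0 (edges I) i.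
have Emem i : [/\ (E i).2 \in dirs, (E i).1 \in I & sadd (E i).1 (E i).2 \notin I].
  have : E i \in edges I by apply: mem_nth; exact: ltn_ord.
  by case: (E i) => p v; rewrite mem_edges => /and3P.
rewrite /perimeter -size_edges -/N.
pose P i := edge_start (E i).1 (E i).2; pose D i := edge_dir (E i).2.
rewrite -(@hausdorff1_segments R N P D (eps * s3 / 3)) //; first last.
- move=> th th0 th1; exists (eps * th / 4); first by rewrite !mulr_gt0 // invr_gt0.
  move=> i j t t' nij ht ht'.
  have [id iI iO] := Emem i; have [jd jI jO] := Emem j.
  have ht01 : 0 <= t' <= 1 by move/andP: ht' => [? ?]; apply/andP; split; lra.
  have [c1 c2] := (edgeE eps0 (E j).1 _ jd).2 (ex_intro _ t' (conj ht01 erefl)).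
  have [e1|n1] := eqVneq (E j).1 (E i).1; last first.
    by apply: (edge_away id th0 ht c1); [exact/eqP|move=> e; rewrite -e jI in iO].
  apply: (edge_away id th0 ht c2); first by move=> e; rewrite e iI in jO.
  move=> e; case/negP: nij; apply/eqP/val_inj/eqP.
  rewrite -(nth_uniq e0 (ltn_ord i) (ltn_ord j) (edges_uniq I)); apply/eqP.
  rewrite -/(E i) -/(E j); move: e1 e; case: (E i) (E j) => [p v] [p' v'] /= -> [].
  by case: v v' => [a b] [c d] /= /addrI -> /addrI ->.
- by move=> i; apply: (edge_dir_norm eps0); have [] := Emem i.
congr hausdorff1; rewrite bdry_region //; apply/seteqP; split=> x.
  move=> [p [v [/= pI vd /negP sI px qx]]].
  have ev : (p, v) \in edges I by rewrite mem_edges vd pI.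
  have hi : (index (p, v) (edges I) < N)%N by rewrite index_mem.
  have [t [ht ->]] := (edgeE eps0 p x vd).1 (conj px qx).
  by exists (Ordinal hi), t; rewrite /P /D /E /= nth_index.
move=> [i [t [ht ->]]]; have [id iI iO] := Emem i.
have [c1 c2] := (edgeE eps0 (E i).1 _ id).2 (ex_intro _ t (conj ht erefl)).
by exists (E i).1, (E i).2; split=> //=; apply/negP.
Qed.

End Edges.

(** * Area of the cells *)

HB.instance Definition _ (R : realType) := Measure.on (@lebesgue2 R).

Section Measure.
Variables (R : realType) (eps : R).
Hypothesis eps0 : 0 < eps.
Implicit Types (x y z : R * R) (p q : site) (P : set site).
Local Notation MR := (measurableTypeR R).
Local Notation T := (MR * MR)%type.
Local Notation mu := (@lebesgue2 R).
Local Notation s3 := (Num.sqrt (3 : R)).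
Local Notation pt := (pt eps).
Local Notation gcell := (gcell eps).
Local Notation ocell := (ocell eps).

Lemma yc1_measurable : measurable_fun setT (@yc1 R : T -> MR).
Proof. exact: measurable_fst. Qed.
Lemma yc2_measurable : measurable_fun setT (@yc2 R : T -> MR).
Proof.
apply: measurable_funD; first by apply: measurable_funM => //; exact: measurable_fst.
by apply: measurable_funM => //; exact: measurable_snd.
Qed.
Lemma yc3_measurable : measurable_fun setT (@yc3 R : T -> MR).
Proof.
apply: measurable_funB; first by apply: measurable_funM => //; exact: measurable_fst.
by apply: measurable_funM => //; exact: measurable_snd.
Qed.

Lemma preimage_itv_measurable (f : T -> MR) (i : interval R) :
  measurable_fun setT f -> measurable (f @^-1` [set` i] : set T).
Proof. by move=> mf; rewrite -[X in measurable X]setTI; apply: mf => //; exact: measurable_itv. Qed.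

Lemma gcell_itv p : gcell p =
  (@yc1 R @^-1` [set` `[eps / 2 * (2 * p.1 + p.2)%:~R - eps / 2, eps / 2 * (2 * p.1 + p.2)%:~R + eps / 2]]) `&`
  (@yc2 R @^-1` [set` `[eps / 2 * (p.1 + 2 * p.2)%:~R - eps / 2, eps / 2 * (p.1 + 2 * p.2)%:~R + eps / 2]]) `&`
  (@yc3 R @^-1` [set` `[eps / 2 * (p.1 - p.2)%:~R - eps / 2, eps / 2 * (p.1 - p.2)%:~R + eps / 2]]).
Proof.
apply/seteqP; split=> x.
  by move=> /(gcellP eps0)[h1 h2 h3]; rewrite /= !in_itv /= -!ler_distl.
by move=> [[]]; rewrite /= !in_itv /= -!ler_distl => h1 h2 h3; apply/(gcellP eps0).
Qed.

Lemma ocell_itv p : ocell p =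
  (@yc1 R @^-1` [set` `]eps / 2 * (2 * p.1 + p.2)%:~R - eps / 2, eps / 2 * (2 * p.1 + p.2)%:~R + eps / 2[]) `&`
  (@yc2 R @^-1` [set` `]eps / 2 * (p.1 + 2 * p.2)%:~R - eps / 2, eps / 2 * (p.1 + 2 * p.2)%:~R + eps / 2[]) `&`
  (@yc3 R @^-1` [set` `]eps / 2 * (p.1 - p.2)%:~R - eps / 2, eps / 2 * (p.1 - p.2)%:~R + eps / 2[]).
Proof.
apply/seteqP; split=> x.
  by move=> /ocellP[h1 h2 h3]; rewrite /= !in_itv /= -!ltr_distl.
by move=> [[]]; rewrite /= !in_itv /= -!ltr_distl => h1 h2 h3; apply/ocellP.
Qed.

Lemma gcell_measurable p : measurable (gcell p : set T).
Proof.
rewrite gcell_itv; apply: measurableI; first apply: measurableI.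
- exact: (preimage_itv_measurable _ yc1_measurable).
- exact: (preimage_itv_measurable _ yc2_measurable).
- exact: (preimage_itv_measurable _ yc3_measurable).
Qed.

Lemma ocell_measurable p : measurable (ocell p : set T).
Proof.
rewrite ocell_itv; apply: measurableI; first apply: measurableI.
- exact: (preimage_itv_measurable _ yc1_measurable).
- exact: (preimage_itv_measurable _ yc2_measurable).
- exact: (preimage_itv_measurable _ yc3_measurable).
Qed.

Lemma bigcup_site_measurable P (F : site -> set T) : (forall p, measurable (F p)) ->
  measurable (\bigcup_(p in P) F p : set T).
Proof.
move=> mF; have -> : \bigcup_(p in P) F p =
    \bigcup_n (match (choice.unpickle n : option site) with
      | Some p => if `[< P p >] then F p else set0 | None => set0 end).
  apply/seteqP; split=> x.
    move=> [p Pp Fx]; apply: (ex_intro2 _ _ (choice.pickle p) I); rewrite choice.pickleK.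
    by move/asboolP: Pp => ->.
  by move=> [n _]; case: (choice.unpickle n : option site) => [p|//]; case: asboolP => // Pp Fx; exists p.
apply: bigcupT_measurable => n; case: (choice.unpickle n : option site) => [p|]; last exact: measurable0.
by case: ifP => _; [exact: mF|exact: measurable0].
Qed.

Lemma region_measurable P : measurable (region eps P : set T).
Proof. by apply: bigcup_site_measurable => p; exact: gcell_measurable. Qed.

Lemma mu_setU (A B : set T) : measurable A -> measurable B ->
  (mu (A `|` B) <= mu A + mu B)%E.
Proof. exact: measureU2. Qed.

(** As f is injective in the second coordinate, the vertical sections of the
    level set have at most one point. *)
Lemma line_null (f : T -> MR) (c : R) : measurable_fun setT f ->
  (forall a b b', f (a, b) = f (a, b') -> b = b') -> mu (f @^-1` [set c]) = 0%E.
Proof.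
move=> mf finj; have mA : measurable (f @^-1` [set c] : set T).
  by rewrite -[X in measurable X]setTI; apply: mf => //; exact: measurable_set1.
rewrite /lebesgue2 /= /product_measure1 /=; apply: integral0_eq => a _.
have -> : lebesgue_measure (xsection (f @^-1` [set c]) a) = 0%E; last by [].
have [[b hb]|hno] := pselect (exists b, f (a, b) = c).
  have -> : xsection (f @^-1` [set c]) a = [set b].
    apply/seteqP; split=> b'; last by move=> /= ->; rewrite /xsection /= inE.
    by rewrite /xsection /= inE => hb'; apply: (finj a); rewrite hb hb'.
  by rewrite lebesgue_measure_set1.
suff -> : xsection (f @^-1` [set c]) a = set0 by exact: measure0.
by apply/seteqP; split=> // b'; rewrite /xsection /= inE => hb'; apply: hno; exists b'.
Qed.

Lemma yc1_null (c : R) : mu (@yc1 R @^-1` [set c]) = 0%E.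
Proof.
have -> : @yc1 R @^-1` [set c] = [set c] `*` setT.
  by apply/seteqP; split=> [x h|x [h _]]; [split|exact: h].
have -> : mu ([set c] `*` setT) = (lebesgue_measure [set c] * lebesgue_measure (@setT R))%E.
  by apply: (@product_measure1E _ _ MR MR); [exact: measurable_set1|exact: measurableT].
by rewrite lebesgue_measure_set1 mul0e.
Qed.

(** The boundary of a cell lies on six lines. *)
Lemma cell_boundary_null p : mu (gcell p `\` ocell p) = 0%E.
Proof.
have s30 := s3_gt0 R.
have n2 c : mu (@yc2 R @^-1` [set c]) = 0%E.
  apply: (line_null _ yc2_measurable) => a b b'; rewrite /yc2 /= => /addrI h.
  by apply: (mulfI _ h); rewrite mulf_neq0 ?gt_eqF ?invr_gt0.
have n3 c : mu (@yc3 R @^-1` [set c]) = 0%E.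
  apply: (line_null _ yc3_measurable) => a b b'; rewrite /yc3 /= => /addrI /oppr_inj h.
  by apply: (mulfI _ h); rewrite mulf_neq0 ?gt_eqF ?invr_gt0.
set k1 := eps / 2 * (2 * p.1 + p.2)%:~R; set k2 := eps / 2 * (p.1 + 2 * p.2)%:~R.
set k3 := eps / 2 * (p.1 - p.2)%:~R.
pose L (f : R * R -> R) (k : R) := (f @^-1` [set k - eps / 2]) `|` (f @^-1` [set k + eps / 2]).
have mline (f : T -> MR) c : measurable_fun setT f -> measurable (f @^-1` [set c] : set T).
  by move=> mf; rewrite -[X in measurable X]setTI; apply: mf => //; exact: measurable_set1.
have sub : gcell p `\` ocell p `<=` L (@yc1 R) k1 `|` (L (@yc2 R) k2 `|` L (@yc3 R) k3).
  move=> x [/(gcellP eps0)[h1 h2 h3]]; apply: contra_notP => h; apply/ocellP.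
  have aux (t k : R) : `|t - k| <= eps / 2 -> t <> k - eps / 2 -> t <> k + eps / 2 -> `|t - k| < eps / 2.
    move=> ht hm hp; rewrite lt_neqAle ht andbT; apply/eqP => e.
    have e2 : 0 <= eps / 2 by rewrite divr_ge0 // ltW.
    by move: e; case: (ger0P (t - k)) => _ e; [apply: hp|apply: hm]; lra.
  split; apply: aux => // e; apply: h.
  - by left; left.
  - by left; right.
  - by right; left; left.
  - by right; left; right.
  - by right; right; left.
  - by right; right; right.
have mL (f : T -> MR) k : measurable_fun setT f -> measurable (L f k : set T).
  by move=> mf; apply: measurableU; exact: mline.
have zL (f : T -> MR) k : measurable_fun setT f -> (forall c, mu (f @^-1` [set c]) = 0%E) ->
    mu (L f k) = 0%E.
  move=> mf z; apply/eqP; rewrite eq_le measure_ge0 andbT.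
  by apply: le_trans (mu_setU (mline _ _ mf) (mline _ _ mf)) _; rewrite !z adde0.
apply/eqP; rewrite eq_le measure_ge0 andbT.
have h1 := zL _ k1 yc1_measurable yc1_null; have h2 := zL _ k2 yc2_measurable n2.
have h3 := zL _ k3 yc3_measurable n3.
apply: (@le_trans _ _ (mu (L (@yc1 R) k1 `|` (L (@yc2 R) k2 `|` L (@yc3 R) k3)))).
  apply: le_measure; rewrite ?inE //.
    by apply: measurableD; [exact: gcell_measurable|exact: ocell_measurable].
  by apply: measurableU; [|apply: measurableU];
    apply: mL; [exact: yc1_measurable|exact: yc2_measurable|exact: yc3_measurable].
have m1 := mL _ k1 yc1_measurable; have m2 := mL _ k2 yc2_measurable.
have m3 := mL _ k3 yc3_measurable.
apply: le_trans (mu_setU m1 (measurableU _ _ m2 m3)) _; rewrite h1 add0e.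
by apply: le_trans (mu_setU m2 m3) _; rewrite h2 h3 adde0.
Qed.

End Measure.

Section Area.
Variables (R : realType) (eps : R).
Hypothesis eps0 : 0 < eps.
Implicit Types (x y z : R * R) (p q : site) (P : set site).
Local Notation MR := (measurableTypeR R).
Local Notation T := (MR * MR)%type.
Local Notation mu := (@lebesgue2 R).
Local Notation s3 := (Num.sqrt (3 : R)).
Local Notation pt := (pt eps).
Local Notation gcell := (gcell eps).
Local Notation ocell := (ocell eps).

Lemma addr_measurable (c : R) : measurable_fun setT ((fun t => t + c) : MR -> MR).
Proof. by apply: measurable_funD => //; exact: measurable_id. Qed.

Lemma lebesgue_measure_shift (c : R) (A : set R) : measurable A ->
  pushforward lebesgue_measure ((fun t => t + c) : R -> MR) A = lebesgue_measure A.
Proof.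
move=> mA; apply/esym/lebesgue_measure_unique => //=; [exact: addr_measurable|move=> mf].
move=> _ [[a b]] _ <-; rewrite /pushforward.
have -> : (fun t => t + c) @^-1` [set` `]a, b]] = [set` `]a - c, b - c]].
  by apply/seteqP; split=> t /=; rewrite !in_itv /= ltrBlDr lerBrDr.
by rewrite !lebesgue_measure_itv /= !lte_fin ltrD2r -!EFinD opprD addrACA subrr addr0.
Qed.

Lemma shift2_measurable (c : R * R) :
  measurable_fun setT ((fun x => (x.1 + c.1, x.2 + c.2)) : T -> T).
Proof.
apply/measurable_fun_pairP; split => /=.
  by apply: measurable_funD => //; exact: measurable_fst.
by apply: measurable_funD => //; exact: measurable_snd.
Qed.

(** Translation invariance, from that of the measure of intervals and the
    uniqueness of product measures. *)
Lemma lebesgue2_shift (c : R * R) (A : set T) : measurable A ->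
  mu ((fun x => (x.1 + c.1, x.2 + c.2)) @^-1` A) = mu A.
Proof.
move=> mA.
have -> : mu ((fun x => (x.1 + c.1, x.2 + c.2)) @^-1` A) =
  pushforward mu (fun x : T => (x.1 + c.1, x.2 + c.2) : T) A by [].
apply/esym/(@product_measure_unique _ _ MR MR) => //=; [exact: shift2_measurable|move=> mf].
move=> B C mB mC; rewrite /pushforward.
have -> : (fun x : T => (x.1 + c.1, x.2 + c.2) : T) @^-1` (B `*` C) =
    ((fun t : R => t + c.1)%R @^-1` B) `*` ((fun t : R => t + c.2)%R @^-1` C) by [].
transitivity (lebesgue_measure ((fun t : R => t + c.1)%R @^-1` B) *
  lebesgue_measure ((fun t : R => t + c.2)%R @^-1` C))%E.
  apply: (@product_measure1E _ _ MR MR).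
    by rewrite -[X in measurable X]setTI; apply: addr_measurable.
  by rewrite -[X in measurable X]setTI; apply: addr_measurable.
congr (_ * _)%E; exact: lebesgue_measure_shift.
Qed.

Lemma ocell_shift p q : ocell p =
  (fun x => (x.1 + (pt q - pt p).1, x.2 + (pt q - pt p).2)) @^-1` ocell q.
Proof.
apply/seteqP; split=> x; rewrite /ocell /=;
  by rewrite (_ : (x.1 + (pt q - pt p).1, x.2 + (pt q - pt p).2) - pt q = x - pt p) //;
    rewrite [LHS](_ : _ = x + (pt q - pt p) - pt q) // -addrA addrAC subrr add0r.
Qed.

Definition area : \bar R := mu (ocell (0, 0)).

Lemma ocell_area p : mu (ocell p) = area.
Proof. by rewrite (ocell_shift p (0, 0)) lebesgue2_shift //; exact: ocell_measurable. Qed.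

Lemma area_gt0 : (0 < area)%E.
Proof.
pose I : set R := [set` `]- (eps / 4), eps / 4[].
have mI : measurable I by exact: measurable_itv.
have hI : lebesgue_measure I = (eps / 2)%:E.
  rewrite lebesgue_measure_itv /= lte_fin -EFinD opprK -mulrDl.
  rewrite ifT; first by congr _%:E; field.
  have h : 0 < eps / 4 by rewrite divr_gt0.
  lra.
have hII : mu (I `*` I) = ((eps / 2) * (eps / 2))%:E.
  transitivity (lebesgue_measure I * lebesgue_measure I)%E; last by rewrite hI.
  by apply: (@product_measure1E _ _ MR MR).
apply: (@lt_le_trans _ _ (mu (I `*` I))).
  by rewrite hII lte_fin mulr_gt0 // divr_gt0.
apply: le_measure; rewrite ?inE; [exact: measurableX|exact: ocell_measurable|].
move=> x [] ; rewrite /I /= !in_itv /= => /andP[h1 h2] /andP[h3 h4].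
have s30 := s3_gt0 R; have s33 := s3_sq R.
have s32 : s3 < 2 by nra.
apply/ocellP => /=; rewrite !mulr0 !subr0 !ltr_norml /yc1 /yc2 /yc3.
by split; apply/andP; split; nra.
Qed.

Lemma area_lty : (area < +oo)%E.
Proof.
pose I : set R := [set` `]- eps, eps[].
have mI : measurable I by exact: measurable_itv.
have hI : lebesgue_measure I = (eps + eps)%:E.
  by rewrite lebesgue_measure_itv /= lte_fin -EFinD opprK ifT //; have := eps0; lra.
have hII : mu (I `*` I) = ((eps + eps) * (eps + eps))%:E.
  transitivity (lebesgue_measure I * lebesgue_measure I)%E; last by rewrite hI.
  by apply: (@product_measure1E _ _ MR MR).
apply: (@le_lt_trans _ _ (mu (I `*` I))); last by rewrite hII ltry.
apply: le_measure; rewrite ?inE; [exact: ocell_measurable|exact: measurableX|].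
move=> x /ocellP /=; rewrite !mulr0 !subr0 !ltr_norml /yc1 /yc2 /yc3.
move=> [/andP[h1 h2] /andP[h3 h4] /andP[h5 h6]].
have s30 := s3_gt0 R; have s33 := s3_sq R.
have s31 : 1 < s3 by nra.
rewrite /I /=; split; rewrite /= in_itv /=; apply/andP; split; nra.
Qed.

End Area.

(** * The discrete distance *)

Section Dist.
Variables (R : realType) (eps : R).
Hypothesis eps0 : 0 < eps.
Implicit Types (x y z : R * R) (p q : site) (P : set site).
Local Notation MR := (measurableTypeR R).
Local Notation T := (MR * MR)%type.
Local Notation mu := (@lebesgue2 R).
Local Notation s3 := (Num.sqrt (3 : R)).
Local Notation pt := (pt eps).
Local Notation gcell := (gcell eps).
Local Notation ocell := (ocell eps).

(** The graph distance from the origin in the triangular lattice; by [phi_pt]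
    it is the dual norm up to the factor 3 eps / 4. *)
Definition hexnorm (v : site) : int := Num.max (Num.max `|v.1| `|v.2|) `|v.1 + v.2|.

Lemma max_intr (m n : int) : (Num.max m n)%:~R = Num.max m%:~R n%:~R :> R.
Proof. by rewrite !maxEle ler_int; case: ifP. Qed.

Lemma phi_pt p q : phi_hex_dual (pt p - pt q) = 3 / 4 * eps * (hexnorm (p.1 - q.1, p.2 - q.2))%:~R.
Proof.
have s30 := s3_gt0 R; have s33 := s3_sq R.
set a : int := p.1 - q.1; set b : int := p.2 - q.2.
have ea : a%:~R = p.1%:~R - q.1%:~R :> R by rewrite /a intrB.
have eb : b%:~R = p.2%:~R - q.2%:~R :> R by rewrite /b intrB.
have c0 : 0 <= eps * s3 / 2 by rewrite divr_ge0 // mulr_ge0 // ltW.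
have e1 : (pt p - pt q).1 = eps * (a%:~R + b%:~R / 2).
  by rewrite fst_add fst_opp !pt1 ea eb; field.
have e2 : (pt p - pt q).2 = eps * s3 / 2 * b%:~R.
  by rewrite snd_add snd_opp !pt2 eb; field.
have d1 : dot (pt p - pt q) (perp (eta1 R)) = eps * s3 / 2 * b%:~R.
  by rewrite /dot e1 e2 /perp /eta1 /=; ring.
have d2 : dot (pt p - pt q) (perp (eta2 R)) = eps * s3 / 2 * - a%:~R.
  by rewrite /dot e1 e2 /perp /eta2 /=; field.
have d3 : dot (pt p - pt q) (perp (eta3 R)) = eps * s3 / 2 * (a + b)%:~R.
  by rewrite /dot e1 e2 /perp /eta3 /eta1 /eta2 /= intrD; field.
have [c ec] : exists c, c = eps * s3 / 2 by exists (eps * s3 / 2).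
rewrite -!ec in c0 d1 d2 d3.
rewrite /phi_hex_dual !big_ord_recl big_ord0 /eta /= d1 d2 d3.
rewrite !normrM !(ger0_norm c0) normrN -!intr_norm.
rewrite [Num.max _ 0]max_l ?mulr_ge0 ?ler0z // -!maxr_pMr // -!max_intr.
rewrite mulrA (_ : s3 / 2 * c = (s3 * s3) / 4 * eps); last by rewrite ec; field.
by rewrite s33 /hexnorm /=; congr (_ * _%:~R); rewrite maxA [Num.max `|b| _]maxC.
Qed.

Variable P : set site.
Let F := region eps P.
Definition dists_compl p : set (\bar R) := [set (phi_hex_dual (pt p - pt q))%:E | q in ~` P].
Definition dists_set p : set (\bar R) := [set (phi_hex_dual (pt p - pt q))%:E | q in P].

Lemma dist_in x : F x -> discrete_dist eps F x =
  ereal_inf [set u | exists p, gcell p x /\ dists_compl p u].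
Proof.
move=> Fx; rewrite /discrete_dist mem_set //; congr ereal_inf; apply/seteqP; split=> u.
  move=> [_ [_ [/latticeE[p ->] /latticeE[q ->] px nq ->]]]; exists p; split=> //.
  by exists q => // Pq; apply: nq; apply/(gcell_sub_region eps0).
move=> [p [px [q nq <-]]]; exists (pt p), (pt q); split=> //.
- by apply/latticeE; exists p.
- by apply/latticeE; exists q.
- by move=> h; apply: nq; apply/(gcell_sub_region eps0).
Qed.

Lemma dist_out x : ~ F x -> discrete_dist eps F x =
  ereal_inf [set u | exists p, gcell p x /\ dists_set p u].
Proof.
move=> Fx; rewrite /discrete_dist memNset //; congr ereal_inf; apply/seteqP; split=> u.
  move=> [_ [_ [/latticeE[p ->] /latticeE[q ->] px nq ->]]]; exists p; split=> //.
  by exists q => //; apply/(gcell_sub_region eps0).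
move=> [p [px [q nq <-]]]; exists (pt p), (pt q); split=> //.
- by apply/latticeE; exists p.
- by apply/latticeE; exists q.
- by apply/(gcell_sub_region eps0).
Qed.

Lemma dist_ge0 x : (0 <= discrete_dist eps F x)%E.
Proof.
have ge p q : (0 <= (phi_hex_dual (pt p - pt q))%:E)%E.
  rewrite lee_fin phi_pt mulr_ge0 //; first by rewrite mulr_ge0 // ltW.
  by rewrite ler0z /hexnorm; lia.
have [Fx|nF] := pselect (F x); [rewrite dist_in //|rewrite dist_out //];
  by apply: le_ereal_inf_tmp => _ [p [_ [q _ <-]]].
Qed.

(** Only one cell passes through an interior point of a cell, so that the
    distance is constant on open cells. *)
Lemma dist_ocell p x : ocell p x ->
  discrete_dist eps F x = ereal_inf (if `[< P p >] then dists_compl p else dists_set p).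
Proof.
move=> px; have uniq q : gcell q x -> q = p by move=> qx; apply: (ocell_gcell eps0 qx px).
case: asboolP => Pp.
  rewrite dist_in; last by exists p => //; exact: sub_ocell.
  congr ereal_inf; apply/seteqP; split=> u; first by move=> [q [/uniq ->]].
  by move=> h; exists p; split=> //; exact: sub_ocell.
rewrite dist_out; last by move=> Fx; apply: Pp; apply: (region_ocell eps0 Fx px).
congr ereal_inf; apply/seteqP; split=> u; first by move=> [q [/uniq ->]].
by move=> h; exists p; split=> //; exact: sub_ocell.
Qed.

(** The sublevel sets are unions of cells, intersected with the reference set or
    with its complement. *)
Lemma dist_measurable (D : set T) : measurable D ->
  measurable_fun D (discrete_dist eps F : T -> \bar R).
Proof.
move=> mD; apply: (measurability _ (ErealGenInftyO.measurableE R)) => // _ [_ [t ->] <-].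
apply: measurableI => //.
pose Pin := [set p | exists2 u, dists_compl p u & (u < t%:E)%E].
pose Pout := [set p | exists2 u, dists_set p u & (u < t%:E)%E].
have -> : discrete_dist eps F @^-1` [set` `]-oo, t%:E[] =
    (F `&` region eps Pin) `|` (~` F `&` region eps Pout).
  apply/seteqP; split=> x.
    rewrite /= in_itv /=; have [Fx|nF] := pselect (F x).
      rewrite dist_in // => /ereal_inf_lt[u [p [px du]] ut]; left; split=> //.
      by exists p => //; exists u.
    rewrite dist_out // => /ereal_inf_lt[u [p [px du]] ut]; right; split=> //.
    by exists p => //; exists u.
  rewrite /= in_itv /=; case=> [[Fx [p [u du ut] px]]|[nF [p [u du ut] px]]].
    by rewrite dist_in //; apply: le_lt_trans ut; apply: ereal_inf_lbound; exists p.
  by rewrite dist_out //; apply: le_lt_trans ut; apply: ereal_inf_lbound; exists p.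
apply: measurableU; apply: measurableI.
- exact: region_measurable.
- exact: region_measurable.
- by apply: measurableC; exact: region_measurable.
- exact: region_measurable.
Qed.

End Dist.

(** * The energy as a sum over sites *)

Section Energy.
Variables (R : realType) (eps : R).
Hypothesis eps0 : 0 < eps.
Implicit Types (x y z : R * R) (p q : site) (P : set site).
Local Notation MR := (measurableTypeR R).
Local Notation T := (MR * MR)%type.
Local Notation mu := (@lebesgue2 R).
Local Notation s3 := (Num.sqrt (3 : R)).
Local Notation pt := (pt eps).
Local Notation gcell := (gcell eps).
Local Notation ocell := (ocell eps).

Variable J : hexbox.
Hypothesis tJ : tight J.
Let P : set site := [set p | p \in boxset J].
Let F := region eps P.
Let c0 : R := 3 / 4 * eps.

Let c0_gt0 : 0 < c0. Proof. by rewrite /c0 mulr_gt0. Qed.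

(** Each of the six coordinates changes by at most one along a step. *)
Lemma slack_le_hexnorm p q : inbox J p -> ~~ inbox J q ->
  slack J p <= hexnorm (p.1 - q.1, p.2 - q.2).
Proof. clear; rewrite /inbox /slack /hexnorm /=; lia. Qed.

(** Walking straight towards the nearest side leaves the hexagon after [slack]
    steps. *)
Lemma hexnorm_slack p : inbox J p ->
  exists2 q, ~~ inbox J q & hexnorm (p.1 - q.1, p.2 - q.2) = slack J p.
Proof.
clear; case: p => a b pJ.
have : [|| slack J (a, b) == a - amin J + 1, slack J (a, b) == amax J - a + 1,
  slack J (a, b) == b - bmin J + 1, slack J (a, b) == bmax J - b + 1,
  slack J (a, b) == a + b - smin J + 1 | slack J (a, b) == smax J - (a + b) + 1].
  by rewrite /slack /=; lia.
move: pJ; rewrite -slack_gt0; set s := slack J (a, b) => s0.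
case/or4P => [/eqP e|/eqP e|/eqP e|/or3P[] /eqP e].
- by exists (a - s, b); rewrite /inbox /hexnorm /=; lia.
- by exists (a + s, b); rewrite /inbox /hexnorm /=; lia.
- by exists (a, b - s); rewrite /inbox /hexnorm /=; lia.
- by exists (a, b + s); rewrite /inbox /hexnorm /=; lia.
- by exists (a - s, b); rewrite /inbox /hexnorm /=; lia.
- by exists (a + s, b); rewrite /inbox /hexnorm /=; lia.
Qed.

Lemma dists_compl_inf p : inbox J p -> ereal_inf (dists_compl eps P p) = (c0 * (slack J p)%:~R)%:E.
Proof.
move=> pJ; apply/eqP; rewrite eq_le; apply/andP; split.
  have [q nq hq] := hexnorm_slack pJ; apply: ereal_inf_lbound; exists q.
    by rewrite /P /= in_boxset; apply/negP.
  by rewrite (phi_pt eps0) hq.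
apply: le_ereal_inf_tmp => _ [q /= nq <-]; rewrite (phi_pt eps0) lee_fin ler_pM2l // ler_int.
by apply: slack_le_hexnorm => //; rewrite -in_boxset; apply/negP.
Qed.

(** Different sites are at distance at least 1, and the infimum is finite as a
    tight hexagon is not empty. *)
Lemma dists_set_inf p : ~~ inbox J p -> exists2 r : R, 1 <= r & ereal_inf (dists_set eps P p) = (c0 * r)%:E.
Proof.
move=> pJ; have [q0 hq0] : exists q0, inbox J q0.
  exists (amin J, bmax J); move: tJ; clear; rewrite /tight /inbox /=; lia.
have ub : (ereal_inf (dists_set eps P p) <= (phi_hex_dual (pt p - pt q0))%:E)%E.
  by apply: ereal_inf_lbound; exists q0 => //; rewrite /P /= in_boxset.
have lb : (c0%:E <= ereal_inf (dists_set eps P p))%E.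
  apply: le_ereal_inf_tmp => _ [q /= hq <-]; rewrite (phi_pt eps0) lee_fin.
  rewrite -[X in X <= _]mulr1 ler_pM2l // ler1z.
  have qJ : inbox J q by rewrite -in_boxset.
  move: pJ qJ; clear; case: p q => [a b] [c d] pJ qJ.
  have ne : (a, b) != (c, d) by apply: contraNneq pJ => ->.
  by move: ne; rewrite xpair_eqE /hexnorm /=; lia.
move: ub lb; case: (ereal_inf _) => [r| |] //.
rewrite !lee_fin => _ lb; exists (r / c0); first by rewrite ler_pdivlMr // mul1r.
by congr _%:E; rewrite mulrC divfK // gt_eqF.
Qed.

(** The value of the discrete distance on the cell of p, in units of
    3 eps / 4. *)
Definition depth p : R := if inbox J p then (slack J p)%:~R
  else fine (ereal_inf (dists_set eps P p)) / c0.

Lemma depth_in p : inbox J p -> depth p = (slack J p)%:~R.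
Proof. by rewrite /depth => ->. Qed.

Lemma depth_ge1 p : 1 <= depth p.
Proof.
rewrite /depth; case: ifP => [|/negbT] h.
  by rewrite ler1z; move: h; rewrite -slack_gt0; lia.
by have [r r1 ->] := dists_set_inf h; rewrite /= mulrC mulKf // gt_eqF.
Qed.

Lemma dist_depth p x : ocell p x -> discrete_dist eps F x = (c0 * depth p)%:E.
Proof.
move=> px; rewrite (dist_ocell eps0 _ px) /depth; case: asboolP => h; move: (h); rewrite /P /= in_boxset => h'.
  by rewrite h' dists_compl_inf.
have [r _ e] := dists_set_inf (introN idP h'); rewrite (negbTE (introN idP h')) e /=.
by rewrite mulrCA divff ?mulr1 // gt_eqF.
Qed.

Let cell_area : R := fine (area eps).
Lemma cell_areaE : area eps = cell_area%:E.
Proof.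
rewrite /cell_area fineK // fin_numE; have := area_gt0 eps0; have := area_lty eps0.
by case: (area eps).
Qed.
Lemma cell_area_gt0 : 0 < cell_area.
Proof. by rewrite -lte_fin -cell_areaE area_gt0. Qed.

Let interiors (s : seq site) : set T := \big[setU/set0]_(p <- s) ocell p.

Lemma in_interiors s x : interiors s x <-> exists2 p, p \in s & ocell p x.
Proof. by rewrite /interiors -bigcup_seq; split=> [[p ps px]|[p ps px]]; exists p. Qed.

Lemma integral_interiors s : uniq s ->
  (\int[mu]_(x in interiors s) discrete_dist eps F x = (\sum_(p <- s) cell_area * (c0 * depth p))%:E)%E.
Proof.
move=> us; rewrite ge0_integral_bigsetU //.
- rewrite -sumEFin; apply: eq_bigr => p _.
  transitivity ((c0 * depth p)%:E * mu (ocell p))%E.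
    transitivity (\int[mu]_(x in ocell p) (cst (c0 * depth p)%:E) x)%E.
      by apply: eq_integral => x; rewrite inE => /dist_depth.
    by apply: integral_cst; exact: ocell_measurable.
  by rewrite ocell_area cell_areaE -EFinM mulrC.
- by move=> p; exact: ocell_measurable.
- by move=> p q _ _ [x [px qx]]; apply: (ocell_gcell eps0 _ qx); exact: sub_ocell.
- apply: dist_measurable => //; apply: bigsetU_measurable => p _; exact: ocell_measurable.
- by move=> x _; exact: dist_ge0.
Qed.

Lemma null_seq (s : seq site) :
  mu (\big[setU/set0]_(p <- s) (gcell p `\` ocell p)) = 0%E.
Proof.
elim: s => [|p s IH]; first by rewrite big_nil measure0.
rewrite big_cons; apply/eqP; rewrite eq_le measure_ge0 andbT.
have mc q : measurable (gcell q `\` ocell q : set T).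
  by apply: measurableD; [exact: gcell_measurable|exact: ocell_measurable].
have ms : measurable (\big[setU/set0]_(p <- s) (gcell p `\` ocell p) : set T).
  by apply: bigsetU_measurable => q _.
by apply: le_trans (mu_setU (mc p) ms) _; rewrite (cell_boundary_null eps0) IH adde0.
Qed.

Definition sdiff (I : {fset site}) : seq site :=
  enum_fset (boxset J `\` I)%fset ++ enum_fset (I `\` boxset J)%fset.

Lemma sdiff_uniq I : uniq (sdiff I).
Proof.
rewrite cat_uniq !fset_uniq andbT /=; apply/hasPn => p.
by rewrite !inE => /andP[_ pI]; rewrite pI.
Qed.

Lemma interiors_sub (s : seq site) (Q : set site) :
  (forall p, p \in s -> Q p <> P p) -> interiors s `<=` (region eps Q `+` F).
Proof.
move=> h x /in_interiors[p ps px].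
have hp := h _ ps; have [Qp|nQ] := pselect (Q p).
  left; split; first by exists p => //; exact: sub_ocell.
  by move=> Fx; apply: hp; rewrite propeqE; split=> // _; apply: (region_ocell eps0 Fx px).
right; split.
  exists p; last exact: sub_ocell.
  by apply: contrapT => nP; apply: hp; rewrite propeqE.
by move=> Qx; apply: nQ; apply: (region_ocell eps0 Qx px).
Qed.

Lemma sdiff_measurable (Q : set site) : measurable (region eps Q `+` F : set T).
Proof.
by apply: measurableU; apply: measurableD; exact: region_measurable.
Qed.

(** Up to the boundaries of cells, which are null sets, the symmetric difference
    is a disjoint union of open cells, on each of which the distance is
    constant. *)
Lemma integral_sdiff (I : {fset site}) :
  (\int[mu]_(x in region eps [set p | p \in I] `+` F) discrete_dist eps F x =
   (\sum_(p <- sdiff I) cell_area * (c0 * depth p))%:E)%E.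
Proof.
set D := _ `+` F; have mD : measurable (D : set T) by exact: sdiff_measurable.
have mO : measurable (interiors (sdiff I)) by apply: bigsetU_measurable => p _; exact: ocell_measurable.
have sO : interiors (sdiff I) `<=` D.
  apply: interiors_sub => p; rewrite mem_cat !inE /P /= => /orP[]/andP[h1 h2] e.
    by case/negP: h1; rewrite e.
  by case/negP: h1; rewrite -e.
rewrite (@ge0_negligible_integral _ _ _ mu D (D `\` interiors (sdiff I))) //.
- by rewrite setDD setIidr // integral_interiors // sdiff_uniq.
- exact: measurableD.
- exact: dist_measurable.
- by move=> x _; exact: dist_ge0.
apply/eqP; rewrite eq_le measure_ge0 andbT -(null_seq (sdiff I)).
apply: le_measure; rewrite ?inE; first exact: measurableD.
  by apply: bigsetU_measurable => q _;
    apply: measurableD; [exact: gcell_measurable|exact: ocell_measurable].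
move=> x [Dx nO]; rewrite -bigcup_seq.
have [p ps px] : exists2 p, p \in sdiff I & gcell p x.
  case: Dx => -[[p /= pI px] nx]; exists p => //; rewrite mem_cat !inE /=.
    by rewrite pI andbT; apply/orP; right; apply/negP => pJ; apply: nx; exists p.
  by move: pI; rewrite /P /= => ->; rewrite andbT; apply/orP; left; apply/negP => pJ; apply: nx; exists p.
exists p => //; split=> // ox; apply: nO; apply/in_interiors; by exists p.
Qed.

(** Infinitely many cells outside the reference set, each of the same positive
    area and at distance bounded below. *)
Lemma integral_infinite (Q : set site) : infinite_set Q ->
  (\int[mu]_(x in region eps Q `+` F) discrete_dist eps F x = +oo)%E.
Proof.
move=> iQ; apply/eqyP => B B0.
have iQ' : infinite_set (Q `\` P).
  by apply: infinite_setD => //; exact: finite_fset.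
pose n := (Num.truncn (B / (cell_area * c0))).+1.
have [S sS nS] := infinite_set_fset n iQ'.
apply: (@le_trans _ _ (\int[mu]_(x in interiors S) discrete_dist eps F x)%E); last first.
  apply: ge0_subset_integral.
  - by apply: bigsetU_measurable => p _; exact: ocell_measurable.
  - exact: sdiff_measurable.
  - by apply: dist_measurable => //; exact: sdiff_measurable.
  - by move=> x _; exact: dist_ge0.
  - apply: interiors_sub => p pS; have [Qp nP] := sS _ pS; move=> e; apply: nP; by rewrite -e.
rewrite integral_interiors; last exact: fset_uniq.
have Ac : 0 < cell_area * c0 by rewrite mulr_gt0 // cell_area_gt0.
rewrite lee_fin; apply: (@le_trans _ _ (n%:R * (cell_area * c0))).
  by rewrite -ler_pdivrMr //; apply/ltW/truncnS_gt; rewrite divr_ge0 ?ltW.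
apply: (@le_trans _ _ (\sum_(p <- S) (cell_area * c0))).
  by rewrite big_const_seq count_predT iter_addr_0 -[leRHS]mulr_natl ler_pM2r // ler_nat.
apply: ler_sum => p _; rewrite ler_pM2l ?cell_area_gt0 // -[X in X <= _]mulr1 ler_pM2l //.
exact: depth_ge1.
Qed.

Variable tau : R.
Hypothesis tau0 : 0 < tau.
Let kappa : R := eps * s3 / 3.
Let lam : R := tau^-1 * (cell_area * c0) / kappa.

Lemma kappa_gt0 : 0 < kappa.
Proof. by rewrite !mulr_gt0 ?invr_gt0 // s3_gt0. Qed.
Lemma lam_gt0 : 0 < lam.
Proof. by rewrite !mulr_gt0 ?invr_gt0 ?cell_area_gt0 ?kappa_gt0. Qed.

(** The edge length kappa is the unit of energy; lam compares one unit of the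
    integral with it. *)
Lemma energy_cost (I : {fset site}) :
  energy tau eps (region eps [set p | p \in I]) F = (kappa * cost lam J depth I)%:E.
Proof.
rewrite /energy perimeter_region // integral_sdiff -EFinM -EFinD; congr _%:E.
rewrite /sdiff big_cat /= /cost /lam -/kappa -!mulr_sumr.
by field; rewrite !gt_eqF // kappa_gt0.
Qed.

(** A competitor with infinitely many cells has infinite energy, while the
    empty set has finite energy; for finite sets [cost_minimizer] applies. *)
Theorem energy_minimizer_box E : energy_minimizer tau eps F E ->
  exists I : {fset site}, [/\ E = region eps [set p | p \in I], (I `<=` boxset J)%fset &
    I = fset0 \/ exists2 H, tight H & I = boxset H].
Proof.
move=> [/(admissibleP eps)[Q ->] hmin].
have hI (X : {fset site}) : (energy tau eps (region eps Q) F <=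
    energy tau eps (region eps [set p | p \in X]) F)%E.
  by apply: hmin; apply/(admissibleP eps); exists [set p | p \in X].
have fQ : finite_set Q.
  apply: contrapT => iQ; have := hI fset0; rewrite energy_cost /energy integral_infinite //.
  rewrite gt0_muley ?lte_fin ?invr_gt0 // addey; first by rewrite leye_eq.
  rewrite gt_eqF // (@lt_le_trans _ _ 0%E) // /perimeter /hausdorff1.
  apply: le_ereal_sup_tmp; exists (hausdorff1_pre 1 (bdry (region eps Q))); first by exists (1 : R); [exact: ltr01|].
  apply: le_ereal_inf_tmp => _ [U _ <-]; apply: nneseries_ge0 => n _ _; exact: ediam_ge0.
have [I eI] : exists I : {fset site}, Q = [set p | p \in I].
  by have /finite_fsetP[I eI] := fQ; exists I.
exists I; rewrite {1}eI; rewrite eI in hI.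
have [sI hb] : (I `<=` boxset J)%fset /\ (I = fset0 \/ exists2 H, tight H & I = boxset H).
  apply: (cost_minimizer (d := depth) lam_gt0).
  - by move=> p _; exact: lt_le_trans ltr01 (depth_ge1 p).
  - exact: depth_in.
  - by move=> X; have := hI X; rewrite !energy_cost lee_fin ler_pM2l // kappa_gt0.
by split.
Qed.

End Energy.

(** * Hexagons cut out by six half-planes *)

Section Polygon.
Variable R : realType.
Implicit Types (x y z : R * R) (j k : 'I_6).
Local Notation s3 := (Num.sqrt (3 : R)).
Local Notation nrm := (@wulff_normal R).
Local Notation "j .S" := (ordS j) (at level 2, format "j .S").

(** The turns j, j + 1, ..., j + 5 exhaust the six indices; statements about a
    side and its neighbours are thus proved without fixing the side. *)
Lemma ord6P (Q : 'I_6 -> Prop) j :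
  Q j -> Q j.S -> Q j.S.S -> Q j.S.S.S -> Q j.S.S.S.S -> Q j.S.S.S.S.S -> forall k, Q k.
Proof.
move=> h0 h1 h2 h3 h4 h5 k.
have : [|| k == j, k == j.S, k == j.S.S, k == j.S.S.S, k == j.S.S.S.S | k == j.S.S.S.S.S].
  case: j {h0 h1 h2 h3 h4 h5} => j jP; case: k => k kP; rewrite -!val_eqE /=.
  by case: j jP => [|[|[|[|[|[|//]]]]]] _; case: k kP => [|[|[|[|[|[|//]]]]]] _.
by case/or4P => [/eqP->|/eqP->|/eqP->|/or3P[]/eqP->].
Qed.

Lemma ordS6 j : j.S.S.S.S.S.S = j.
Proof. by apply: val_inj; case: j => [[|[|[|[|[|[|]]]]]] ?]. Qed.

(** The coordinate in the direction of the j-th normal. *)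
Definition ncoord j x : R := dot (nrm j) x.

Lemma ncoordE j x : ncoord j x = nth 0 [:: x.2; - (s3 / 2 * x.1) + x.2 / 2; - (s3 / 2 * x.1) - x.2 / 2;
  - x.2; s3 / 2 * x.1 - x.2 / 2; s3 / 2 * x.1 + x.2 / 2] j.
Proof.
case: j => [[|[|[|[|[|[|//]]]]]] ?]; rewrite /ncoord /dot /wulff_normal /perp /eta3 /eta1 /eta2 /=.
- by rewrite oppr0 mul0r add0r mul1r.
- by field.
- by field.
- by field.
- by field.
- by field.
Qed.

Lemma ncoordS j x : ncoord j.S x = ncoord j x - ncoord j.S.S.S.S.S x.
Proof. by rewrite !ncoordE; case: j => [[|[|[|[|[|[|//]]]]]] ?] /=; field. Qed.

Lemma ncoord_opp j x : ncoord j.S.S.S x = - ncoord j x.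
Proof. by rewrite !ncoordE; case: j => [[|[|[|[|[|[|//]]]]]] ?] /=; field. Qed.

(** Consecutive normals satisfy n_(j-1) + n_(j+1) = n_j, so that all six
    coordinates are combinations of those with indices j and j - 1. *)
Lemma ncoord_all j x : [/\ ncoord j.S x = ncoord j x - ncoord j.S.S.S.S.S x, ncoord j.S.S x = - ncoord j.S.S.S.S.S x,
  ncoord j.S.S.S x = - ncoord j x & ncoord j.S.S.S.S x = ncoord j.S.S.S.S.S x - ncoord j x].
Proof.
have h := ncoord_opp j.S x; have h5 := ncoord_opp j.S.S x.
split; [exact: ncoordS|by rewrite h5 opprK|exact: ncoord_opp|by rewrite h ncoordS opprB].
Qed.

Lemma ncoord_inj j x y : ncoord j x = ncoord j y -> ncoord j.S.S.S.S.S x = ncoord j.S.S.S.S.S y -> x = y.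
Proof.
have s30 := s3_gt0 R.
move=> e1 e2; have [e3 e4 e5 e6] := ncoord_all j x.
have [f3 f4 f5 f6] := ncoord_all j y.
have all k : ncoord k x = ncoord k y.
  by apply: (@ord6P (fun k => ncoord k x = ncoord k y) j); rewrite ?e3 ?e4 ?e5 ?e6 ?f3 ?f4 ?f5 ?f6 ?e1 ?e2.
have h2 := all (@Ordinal 6 0 isT); have h1 := all (@Ordinal 6 5 isT).
rewrite !ncoordE /= in h1 h2; case: x y h1 h2 {e1 e2 e3 e4 e5 e6 f3 f4 f5 f6 all} => [a b] [c d] /= h1 h2.
rewrite h2 in h1 *; congr (_, _).
have c0 : s3 / 2 != 0 by rewrite gt_eqF // divr_gt0.
by move/addIr: h1 => h1; exact: (mulfI c0 h1).
Qed.

Lemma ncoordD j x y : ncoord j (x + y) = ncoord j x + ncoord j y.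
Proof. by rewrite /ncoord /dot !coordE; ring. Qed.
Lemma ncoordZ j (a : R) x : ncoord j (a *: x) = a * ncoord j x.
Proof. by rewrite /ncoord /dot !coordE; ring. Qed.
Lemma ncoordN j x : ncoord j (- x) = - ncoord j x.
Proof. by rewrite /ncoord /dot !coordE; ring. Qed.
Lemma ncoordB j x y : ncoord j (x - y) = ncoord j x - ncoord j y.
Proof. by rewrite ncoordD ncoordN. Qed.

Lemma ncoord_normal j : ncoord j (nrm j) = 1 /\ ncoord j.S.S.S.S.S (nrm j) = 2^-1.
Proof.
have s33 := s3_sq R.
rewrite !ncoordE; case: j => [[|[|[|[|[|[|//]]]]]] ?] /=; rewrite /wulff_normal /perp /eta3 /eta1 /eta2 /=;
  by split; (have e : s3 / 2 * (s3 / 2) = 3 / 4 by rewrite mulrACA s33; field); lra.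
Qed.

Variable h : 'I_6 -> R.
(** Up to a factor this is the length of the side j, cut out of its line by the
    lines of the two neighbouring sides. *)
Hypothesis side0 : forall j, 0 < h j.S.S.S.S.S + h j.S - h j.

Definition polygon : set (R * R) := [set x | forall j, ncoord j x <= h j].

(** The common point of the lines of the sides j - 1 and j. *)
Definition vertex j : R * R :=
  (4 / 3 * (h j.S.S.S.S.S - h j / 2)) *: nrm j.S.S.S.S.S + (4 / 3 * (h j - h j.S.S.S.S.S / 2)) *: nrm j.

Lemma ncoord_vertex j : ncoord j (vertex j) = h j /\ ncoord j.S.S.S.S.S (vertex j) = h j.S.S.S.S.S.
Proof.
have [n1 n2] := ncoord_normal j; have [m1 m2] := ncoord_normal j.S.S.S.S.S.
have e := ncoord_all j.S.S.S.S.S (nrm j.S.S.S.S.S); rewrite !ordS6 in m2 e.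
have m3 : ncoord j (nrm j.S.S.S.S.S) = 2^-1.
  by case: e => -> _ _ _; rewrite m1 m2; field.
by rewrite /vertex !ncoordD !ncoordZ n1 n2 m1 m3; split; field.
Qed.

Lemma ncoord_vertexS j : ncoord j (vertex j.S) = h j /\ ncoord j.S.S.S.S.S (vertex j.S) = h j - h j.S.
Proof.
have [e1 e2] := ncoord_vertex j.S; rewrite ordS6 in e2; split=> //.
by have := ncoordS j (vertex j.S); rewrite e1 e2 => e; rewrite e; ring.
Qed.

Definition side j : set (R * R) := segment (vertex j) (vertex j.S).

(** On the line of the side j the half-planes of the two neighbouring sides cut
    out the segment between the vertices, and the other three half-planes
    contain it, since all sides have positive length. *)
Lemma sideP j x : side j x <-> polygon x /\ ncoord j x = h j.
Proof.
have [a1 a2] := ncoord_vertex j; have [b1 b2] := ncoord_vertexS j.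
have s0 := side0 j; have s1 := side0 j.S; have s2 := side0 j.S.S; have s5 := side0 j.S.S.S.S.S.
rewrite !ordS6 in s0 s1 s2 s5.
split.
  move=> [t /= t01 <-]; move: t01; rewrite in_itv /= => /andP[t0 t1].
  have e1 : ncoord j (vertex j + t *: (vertex j.S - vertex j)) = h j.
    by rewrite ncoordD ncoordZ ncoordB a1 b1; ring.
  have e2 : ncoord j.S.S.S.S.S (vertex j + t *: (vertex j.S - vertex j)) =
      h j.S.S.S.S.S - t * (h j.S.S.S.S.S + h j.S - h j).
    by rewrite ncoordD ncoordZ ncoordB a2 b2; ring.
  split=> //; have [f1 f2 f3 f4] := ncoord_all j (vertex j + t *: (vertex j.S - vertex j)).
  have [l el] : exists l, l = h j.S.S.S.S.S + h j.S - h j by eexists.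
  rewrite -el in e2 s0.
  have tl0 : 0 <= t * l by rewrite mulr_ge0 // ltW.
  have tl1 : t * l <= l by rewrite -[X in _ <= X]mul1r ler_pM2r.
  by apply: (@ord6P _ j); rewrite ?f1 ?f2 ?f3 ?f4 ?e1 ?e2; lra.
move=> [Kx cx]; have K1 := Kx j.S; have K5 := Kx j.S.S.S.S.S.
have [f1 _ _ _] := ncoord_all j x; rewrite f1 cx in K1.
exists ((h j.S.S.S.S.S - ncoord j.S.S.S.S.S x) / (h j.S.S.S.S.S + h j.S - h j)) => /=.
  rewrite in_itv /=; apply/andP; split.
    by apply: divr_ge0; [rewrite subr_ge0|exact: ltW].
  by rewrite ler_pdivrMr // mul1r; lra.
apply: (@ncoord_inj j); first by rewrite ncoordD ncoordZ ncoordB a1 b1 cx; ring.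
by rewrite ncoordD ncoordZ ncoordB a2 b2; field; rewrite gt_eqF.
Qed.

Lemma ncoord_continuous j : continuous (ncoord j).
Proof.
move=> x; apply: cvgD; apply: cvgM; [exact: cvg_cst|exact: fst_continuous|exact: cvg_cst|exact: snd_continuous].
Qed.

Lemma near_ncoord x j (e : R) : 0 < e -> \forall y \near x, `|ncoord j x - ncoord j y| < e.
Proof. by move=> e0; have /cvgrPdist_lt/(_ _ e0) := @ncoord_continuous j x. Qed.

Lemma polygon_closed : closed polygon.
Proof.
move=> x clx j; rewrite leNgt; apply/negP => lt.
have e0 : 0 < ncoord j x - h j by rewrite subr_gt0.
have [y [Ky]] := clx _ (near_ncoord x j e0).
have := Ky j => hy; have := ler_norm (ncoord j x - ncoord j y); lra.
Qed.

Lemma polygon_interior x : (forall j, ncoord j x < h j) -> polygon^° x.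
Proof.
move=> hx; have nj j : \forall y \near x, ncoord j y <= h j.
  have e0 : 0 < h j - ncoord j x by rewrite subr_gt0.
  apply: filterS (near_ncoord x j e0) => y; rewrite distrC => lt.
  have := ler_norm (ncoord j y - ncoord j x); lra.
pose o : 'I_6 := ord0.
suff : \forall y \near x, polygon y by [].
near=> y; apply: (@ord6P (fun j => ncoord j y <= h j) o); near: y; exact: nj.
Unshelve. all: by end_near. Qed.

(** Where all six inequalities are strict the point is interior; where one is
    an equality, moving along its normal leaves the set. *)
Lemma polygon_bdry : bdry polygon = \bigcup_j side j.
Proof.
apply/seteqP; split=> x.
  rewrite /bdry -(closure_id _).1; last exact: polygon_closed.
  move=> [Kx nint].
  have [j hj] : exists j, ncoord j x = h j.
    apply: contrapT => hno; apply: nint; apply: polygon_interior => j.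
    by rewrite lt_neqAle Kx andbT; apply/eqP => e; apply: hno; exists j.
  by exists j => //; apply/sideP.
move=> [j _ /sideP[Kx cx]]; split; first exact: subset_closure.
move=> /nbhs_ballP[d /= d0 hd].
have s30 := s3_gt0 R.
have [n1 n2] := ncoord_normal j.
pose m := 1 + `|(nrm j).1| + `|(nrm j).2|.
have m0 : 0 < m by rewrite /m -addrA ltr_pwDl // addr_ge0.
have dm : 0 < d / m by rewrite divr_gt0.
have Ky : polygon (x + (d / m) *: nrm j).
  apply: hd; split; rewrite -ball_normE /ball_ /=.
    rewrite (_ : x.1 - (x.1 + _) = - (d / m * (nrm j).1)); last by rewrite opprD addrA subrr add0r.
    rewrite normrN normrM (gtr0_norm dm) mulrAC ltr_pdivrMr // ltr_pM2l // /m.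
    by have := normr_ge0 (nrm j).2; lra.
  rewrite (_ : x.2 - (x.2 + _) = - (d / m * (nrm j).2)); last by rewrite opprD addrA subrr add0r.
  rewrite normrN normrM (gtr0_norm dm) mulrAC ltr_pdivrMr // ltr_pM2l // /m.
  by have := normr_ge0 (nrm j).1; lra.
by have := Ky j; rewrite ncoordD ncoordZ n1 cx; lra.
Qed.

Lemma polygon_convex : convex_set polygon.
Proof.
apply/convex_setP => x y t Kx Ky /andP[t0 t1] j.
rewrite ncoordD !ncoordZ; have := Kx j; have := Ky j; nra.
Qed.

Lemma polygon_bounded : bounded_set polygon.
Proof.
have s30 := s3_gt0 R.
pose o : 'I_6 := @Ordinal 6 0 isT; pose o3 : 'I_6 := @Ordinal 6 3 isT.
pose o1 : 'I_6 := @Ordinal 6 1 isT; pose o5 : 'I_6 := @Ordinal 6 5 isT.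
have c0 : 0 < s3 / 2 by rewrite divr_gt0.
pose M := `|h o| + `|h o3|; pose M' := `|h o1| + `|h o5| + M.
have B x : polygon x -> `|x.2| <= M /\ `|x.1| <= M' / (s3 / 2).
  move=> Kx; have := Kx o; have := Kx o3; have := Kx o1; have := Kx o5; rewrite !ncoordE /=.
  have a0 := ler_norm (h o); have a3 := ler_norm (h o3).
  have a1 := ler_norm (h o1); have a5 := ler_norm (h o5).
  have b0 := normr_ge0 (h o); have b3 := normr_ge0 (h o3).
  have b1 := normr_ge0 (h o1); have b5 := normr_ge0 (h o5).
  move=> k5 k1 k3 k0; split; first by rewrite /M ler_norml; apply/andP; split; lra.
  rewrite ler_pdivlMr // -[X in _ * X](gtr0_norm c0) -normrM mulrC /M' /M ler_norml.
  by apply/andP; split; lra.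
exists (M + `|M' / (s3 / 2)|); split; first exact: num_real.
move=> N MN x /B[b2 b1]; have := ler_norm (M' / (s3 / 2)) => b3.
have := normr_ge0 x.2 => b4; have := normr_ge0 (M' / (s3 / 2)) => b5.
rewrite {1}/Num.norm /= ge_max; apply/andP; split; lra.
Qed.

Lemma polygon_wulff_boundary : wulff_boundary polygon vertex id.
Proof.
split=> //.
- by rewrite polygon_bdry.
- move=> j e; have [_ a] := ncoord_vertex j; have [_ b] := ncoord_vertexS j.
  have := side0 j; rewrite e in a; rewrite a in b; lra.
- move=> i k x nik /sideP[Kx ci] /sideP[_ ck].
  have [f1 f2 f3 f4] := ncoord_all i x.
  move: k nik ck; apply: (@ord6P _ i) => //.
  + move=> _ ck; left; split=> //; have [a1 a2] := ncoord_vertex i.S; rewrite ordS6 in a2.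
    by apply: (@ncoord_inj i.S); rewrite ?ordS6 ?a1 ?a2.
  + move=> _ ck; exfalso; have := Kx i.S; have := side0 i.S; rewrite ordS6 f1 ci.
    rewrite f2 in ck; lra.
  + move=> _ ck; exfalso; have := side0 i.S; have := side0 i.S.S; rewrite !ordS6.
    rewrite f3 in ck; lra.
  + move=> _ ck; exfalso; have := Kx i.S.S.S.S.S; have := side0 i.S.S.S.S.S; rewrite !ordS6.
    rewrite f4 in ck; lra.
  + move=> _ ck; right; rewrite ordS6; split=> //; have [a1 a2] := ncoord_vertex i.
    by apply: (@ncoord_inj i); rewrite ?a1 ?a2.
- by move=> j; have [a _] := ncoord_vertex j; have [b _] := ncoord_vertexS j; rewrite -/(ncoord _ _) ncoordB a b subrr.
- move=> j t /andP[t0 t1] x.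
  have /sideP[Kx cx] : side j x by exists t => //=; rewrite in_itv /= !ltW.
  have [n1 n2] := ncoord_normal j; have [m1 m2 m3 m4] := ncoord_all j (nrm j).
  have [f1 f2 f3 f4] := ncoord_all j x.
  have s1 := side0 j.S; have s2 := side0 j.S.S; have s5 := side0 j.S.S.S.S.S.
  rewrite !ordS6 in s1 s2 s5.
  have K1 := Kx j.S; have K5 := Kx j.S.S.S.S.S.
  have d1 := nbhs_right_lt s1; have d2 := nbhs_right_lt s2; have d5 := nbhs_right_lt s5.
  near=> s.
  have s0 : 0 < s by [].
  have l1 : s < h j + h j.S.S - h j.S by near: s.
  have l2 : s < h j.S + h j.S.S.S - h j.S.S by near: s.
  have l5 : s < h j.S.S.S.S + h j - h j.S.S.S.S.S by near: s.
  split; last by move=> /(_ j); rewrite ncoordD ncoordZ n1 cx; lra.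
  rewrite f1 in K1.
  apply: (@ord6P _ j); rewrite ncoordB ncoordZ ?f1 ?f2 ?f3 ?f4 ?m1 ?m2 ?m3 ?m4 ?n1 ?n2 ?cx; lra.
- by move=> j; left.
Unshelve. all: by end_near. Qed.

Lemma polygon_wulff_hexagon : wulff_hexagon polygon.
Proof.
split; [exact: polygon_closed|exact: polygon_convex|split; first exact: polygon_bounded].
by exists 6, vertex, id; exact: polygon_wulff_boundary.
Qed.

End Polygon.

(** * Wulff-like hexagons as intersections of half-planes *)

Section Halfplanes.
Variables (R : realType) (K : set (R * R)).
Implicit Types (x y z : R * R).
Hypotheses (cK : closed K) (vK : convex_set K).
Variables (m : nat) (p : 'I_m -> R * R) (j : 'I_m -> 'I_6).
Hypothesis wb : wulff_boundary K p j.
Local Notation nrm := (@wulff_normal R).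
Local Notation v i := (p (ordS i) - p i).

Lemma pair_eq x y : x.1 = y.1 -> x.2 = y.2 -> x = y.
Proof. by case: x y => [a b] [c d] /= -> ->. Qed.

Lemma bdry_sub : bdry K `<=` K.
Proof. by move=> x []; rewrite -(closure_id _).1. Qed.

Lemma side_sub i t : 0 <= t <= 1 -> K (p i + t *: v i).
Proof.
move=> ht; apply: bdry_sub; rewrite (wb_bdry wb); by exists i => //; exists t => //=.
Qed.

Lemma nrm_unit k : (nrm k).1 ^+ 2 + (nrm k).2 ^+ 2 = 1.
Proof. by have [h _] := ncoord_normal R k; rewrite -h /ncoord /dot !expr2. Qed.

(** Suppose that x in K lies beyond the line of the side i. By convexity K
    contains the triangle spanned by x and the side, hence the points just
    outside the middle of the side, against the choice of the normal. *)
Lemma halfplane_sub i x : K x -> ncoord (j i) (x - p i) <= 0.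
Proof.
move=> Kx; rewrite leNgt; apply/negP => d0.
have /convex_setP cvx := vK.
have [n en] : exists n, n = nrm (j i) by eexists.
have nn : n.1 ^+ 2 + n.2 ^+ 2 = 1 by rewrite en nrm_unit.
have [w ew] : exists w, w = v i by eexists.
have nv : n.1 * w.1 + n.2 * w.2 = 0 by rewrite en ew; exact: (wb_normal wb i).
have [d ed] : exists d, d = ncoord (j i) (x - p i) by eexists.
rewrite -ed in d0; rewrite /ncoord -en /dot in ed.
pose c := n.1 * w.2 - n.2 * w.1.
have wc : w = (- c * n.2, c * n.1).
  have w1 : w.1 = - c * n.2.
    rewrite /c; transitivity (w.1 * (n.1 ^+ 2 + n.2 ^+ 2)); first by rewrite nn mulr1.
    transitivity (w.1 * (n.1 ^+ 2 + n.2 ^+ 2) - n.1 * (n.1 * w.1 + n.2 * w.2)); first by rewrite nv mulr0 subr0.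
    ring.
  have w2 : w.2 = c * n.1.
    rewrite /c; transitivity (w.2 * (n.1 ^+ 2 + n.2 ^+ 2)); first by rewrite nn mulr1.
    transitivity (w.2 * (n.1 ^+ 2 + n.2 ^+ 2) - n.2 * (n.1 * w.1 + n.2 * w.2)); first by rewrite nv mulr0 subr0.
    ring.
  by rewrite -w1 -w2 -surjective_pairing.
have c0 : c != 0.
  apply/eqP => c0; apply: (wb_nondegenerate wb (i := i)); apply/eqP; rewrite eq_sym -subr_eq0 -ew wc c0.
  by rewrite oppr0 !mul0r.
pose y := p i + 2^-1 *: w.
pose a := (n.1 * (x - y).2 - n.2 * (x - y).1) / c.
have dy : d = n.1 * (x - y).1 + n.2 * (x - y).2.
  rewrite ed /y wc !coordE /=; ring.
have xy : x = y + d *: n + a *: w.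
  have q1 : (x - y).1 = d * n.1 + a * w.1.
    have -> : a * w.1 = - n.2 * (n.1 * (x - y).2 - n.2 * (x - y).1).
      by rewrite /a wc /=; field.
    rewrite dy -[LHS]mulr1 -nn; ring.
  have q2 : (x - y).2 = d * n.2 + a * w.2.
    have -> : a * w.2 = n.1 * (n.1 * (x - y).2 - n.2 * (x - y).1).
      by rewrite /a wc /=; field.
    rewrite dy -[LHS]mulr1 -nn; ring.
  by apply: pair_eq; rewrite !coordE; [have := q1|have := q2]; rewrite !coordE; lra.
have h01 : 0 < (2^-1 : R) < 1 by apply/andP; split; lra.
have /= := wb_exterior wb i h01.
rewrite -ew -en -/y => ext.
have a1 : 0 < 4 * (`|a| + 1) by have := normr_ge0 a; lra.
have e1 : 0 < d / 2 by rewrite divr_gt0.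
have e2 : 0 < d / (4 * (`|a| + 1)) by rewrite divr_gt0.
have [s [[[Ky nKy] s0] [s1 s2]]] := @filter_ex _ _ (at_right_proper_filter 0) _ (filterI (filterI ext (nbhs_right_gt 0))
  (filterI (nbhs_right_lt e1) (nbhs_right_lt e2))).
apply: nKy.
pose l := s / d.
have l0 : 0 < l by rewrite divr_gt0.
have l1 : l < 2^-1 by rewrite /l ltr_pdivrMr // mulrC.
have l2 : l * (4 * (`|a| + 1)) < 1.
  by rewrite /l mulrAC ltr_pdivrMr // mul1r -ltr_pdivlMr.
have b0 : l * `|a| <= 4^-1 by lra.
have la : `|l * a| <= 4^-1 by rewrite normrM (gtr0_norm l0).
pose t := 2^-1 - l * a / (1 - l).
have ht : 0 <= t <= 1.
  have q : `|l * a / (1 - l)| <= 2^-1.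
    have i0 : 0 < 1 - l by lra.
    by rewrite normrM normfV (gtr0_norm i0) ler_pdivrMr //; lra.
  by move: q; rewrite /t ler_norml => /andP[? ?]; apply/andP; split; lra.
(* The point y + s n divides the segment from a point of the side to x in the
   ratio in which its height s divides the height d of x. *)
have -> : y + s *: n = l *: x + (1 - l) *: (p i + t *: v i).
  have ll : 1 - l != 0 by rewrite gt_eqF //; lra.
  have sl : s = l * d by rewrite /l divfK // gt_eqF.
  rewrite xy -ew /t {2}/y sl.
  by rewrite /y; apply: pair_eq; rewrite !coordE; field.
by apply: cvx => //; [exact: side_sub|apply/andP; split; lra].
Qed.

(** Points just inside the middle of a side satisfy the inequality of this side
    strictly; a repeated midpoint satisfies all of them strictly. *)
Lemma strict_point : exists2 k0, K k0 & forall i, ncoord (j i) (k0 - p i) < 0.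
Proof.
have /convex_setP cvx := vK.
have m2 := wb_size wb.
suff [k Kk hk] : exists2 k, K k & forall i, i \in enum 'I_m -> ncoord (j i) (k - p i) < 0.
  by exists k => // i; apply: hk; rewrite mem_enum.
elim: (enum 'I_m) => [|i r [k Kk hk]].
  exists (p (Ordinal (ltnW (ltnW m2)))) => //.
  have := @side_sub (Ordinal (ltnW (ltnW m2))) 0; rewrite scale0r addr0; apply.
  by rewrite lexx ler01.
have h01 : 0 < (2^-1 : R) < 1 by apply/andP; split; lra.
have /= ext := wb_exterior wb i h01.
have [s [[Kx _] s0]] := @filter_ex _ _ (at_right_proper_filter 0) _ (filterI ext (nbhs_right_gt 0)).
set x := _ - _ in Kx.
have cx : ncoord (j i) (x - p i) < 0.
  rewrite /x ncoordB !ncoordD ncoordN ncoordZ ncoordZ (ncoord_normal R (j i)).1.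
  have -> : ncoord (j i) (v i) = 0 by exact: (wb_normal wb i).
  lra.
clearbody x.
exists (2^-1 *: k + (1 - 2^-1) *: x); first by apply: cvx => //; apply/andP; split; lra.
have e i' : ncoord (j i') (2^-1 *: k + (1 - 2^-1) *: x - p i') = 2^-1 * ncoord (j i') (k - p i') + (1 - 2^-1) * ncoord (j i') (x - p i').
  by rewrite !ncoordB ncoordD !ncoordZ; field.
move=> i'; rewrite inE e => /orP[/eqP->|/hk].
  have := halfplane_sub i Kk; lra.
have := halfplane_sub i' Kx; lra.
Qed.

(** Let z satisfy the inequalities. On the way from a point of K that satisfies
    them strictly to z they remain strict, except perhaps at z itself, so that
    no side and hence no boundary point of K is met. By connectedness the
    half-open segment stays in K, and K is closed. *)
Lemma halfplanesE : K = [set x | forall i, ncoord (j i) (x - p i) <= 0].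
Proof.
apply/seteqP; split=> [x Kx i|z hz]; first exact: halfplane_sub.
have [k Kk hk] := strict_point.
pose g (t : R) : R * R := k + t *: (z - k).
have cg : continuous g.
  move=> t; apply: cvgD; first exact: cvg_cst.
  by apply: cvgZl; exact: cvg_id.
have hg t : 0 <= t -> t < 1 -> forall i, ncoord (j i) (g t - p i) < 0.
  move=> t0 t1 i; have -> : ncoord (j i) (g t - p i) = (1 - t) * ncoord (j i) (k - p i) + t * ncoord (j i) (z - p i).
    by rewrite /g !ncoordB ncoordD ncoordZ ncoordB; ring.
  have := hz i; have := hk i; nra.
have Kg : `[0, 1[ `&` g @^-1` K = `[0, 1[%classic.
  have /connected_intervalP cn : is_interval (`[0, 1[%classic : set R).
    move=> a b /=; rewrite !in_itv /= => /andP[a0 _] /andP[_ b1] c /andP[ac cb].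
    by rewrite in_itv /= (le_trans a0 ac) (le_lt_trans cb b1).
  apply: cn.
  - by exists 0; split; rewrite /= ?in_itv /= ?lexx ?ltr01 // /g scale0r addr0.
  - exists (g @^-1` K^°).
      by apply: open_comp => [t _|]; [exact: cg|exact: open_interior].
    apply/seteqP; split=> t [/= t01 Kt]; split=> //; last exact: interior_subset Kt.
    apply: contrapT => nint; have : bdry K (g t) by split=> //; exact: subset_closure.
    rewrite (wb_bdry wb) => -[i _ [u _ eu]]; move: t01; rewrite in_itv /= => /andP[t0 t1].
    have := hg t t0 t1 i; rewrite -eu addrAC subrr add0r ncoordZ.
    by have -> : ncoord (j i) (v i) = 0 by [exact: (wb_normal wb i)]; rewrite mulr0 ltxx.
  - exists (g @^-1` K) => //.
    by apply: closed_comp => // t _; exact: cg.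
have g1 : g 1 = z by rewrite /g scale1r addrC subrK.
rewrite -g1; apply: contrapT => nK.
have on : open (g @^-1` ~` K) by apply: open_comp => [t _|]; [exact: cg|exact: closed_openC].
have nn : nbhs (1 : R) (g @^-1` ~` K) by exact: (open_nbhs_nbhs (conj on nK)).
have [t [[nKt t1] t0]] := @filter_ex _ _ (at_left_proper_filter 1) _ (filterI (filterI (cvg_within _ nn) (nbhs_left_lt 1)) (nbhs_left_gt ltr01)).
have : `[0, 1[%classic t by rewrite /= in_itv /= t1 ltW.
by rewrite -Kg => -[_].
Qed.
End Halfplanes.

(** * Discrete hexagons and tight boxes *)

(** The coordinate in direction n_j of a lattice point, in units of
    eps sqrt 3 / 2. *)
Definition level (j : 'I_6) (p : site) : int :=
  nth 0 [:: p.2; - p.1; - (p.1 + p.2); - p.2; p.1; p.1 + p.2] j.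
Definition bound (H : hexbox) (j : 'I_6) : int :=
  nth 0 [:: bmax H; - amin H; - smin H; - bmin H; amax H; smax H] j.

Lemma inbox_level H p : inbox H p <-> forall j, level j p <= bound H j.
Proof.
rewrite /inbox; split.
  by move=> h; case=> [[|[|[|[|[|[|//]]]]]] ?]; rewrite /level /bound /=; lia.
move=> h; have := h (@Ordinal 6 0 isT); have := h (@Ordinal 6 1 isT); have := h (@Ordinal 6 2 isT).
have := h (@Ordinal 6 3 isT); have := h (@Ordinal 6 4 isT); have := h (@Ordinal 6 5 isT).
rewrite /level /bound /=; lia.
Qed.

Lemma attains_level H A j : attains H A -> exists2 p : site, p \in A & level j p = bound H j.
Proof.
case=> [[[a1 a1A ea1] [a2 a2A ea2] [b1 b1A eb1] [b2 b2A eb2] [s1 s1A es1]] [s2 s2A es2]].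
case: j => [[|[|[|[|[|[|//]]]]]] ?]; rewrite /level /bound /=.
- by exists b2.
- by exists a1; rewrite ?ea1.
- by exists s1; rewrite ?es1.
- by exists b1; rewrite ?eb1.
- by exists a2.
- by exists s2.
Qed.

Section Hexagons.
Variables (R : realType) (eps : R).
Hypothesis eps0 : 0 < eps.
Implicit Types (x y z : R * R) (p q : site) (K : set (R * R)).
Local Notation s3 := (Num.sqrt (3 : R)).
Local Notation pt := (pt eps).
Local Notation gcell := (gcell eps).
Local Notation nrm := (@wulff_normal R).

Lemma ncoord_pt j p : ncoord j (pt p) = eps * (s3 / 2) * (level j p)%:~R.
Proof.
by rewrite ncoordE pt1 pt2 /level; case: j => [[|[|[|[|[|[|//]]]]]] ?] /=; rewrite ?(intrN, intrD); field.
Qed.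

Lemma ncoord_gcell j p x : gcell p x -> ncoord j x <= ncoord j (pt p) + eps * (s3 / 3).
Proof.
have s30 := s3_gt0 R; have s33 := s3_sq R.
move=> /cellE - /(_ eps0)[]; rewrite /yc1 /yc2 /yc3.
rewrite -lerBlDl -ncoordB ncoordE; set w := x - _; move: w.1 w.2 => a b; rewrite !ler_norml.
move=> /andP[h1 h1'] /andP[h2 h2'] /andP[h3 h3'].
rewrite -(ler_pM2l s30) (_ : s3 * (eps * (s3 / 3)) = eps); last first.
  by rewrite (_ : s3 * (eps * (s3 / 3)) = eps * (s3 * s3) / 3); [rewrite s33|]; field.
case: j => [[|[|[|[|[|[|//]]]]]] ?] /=; rewrite ?mulrBr ?mulrDr ?mulrN;
  rewrite ?[s3 * (s3 / 2 * a)]mulrA ?[s3 * (s3 / 2)]mulrA ?s33; lra.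
Qed.

(** The vertices of the hexagonal cell point in the six normal directions. *)
Lemma gcell_vertex j p : gcell p (pt p + (eps * (s3 / 3)) *: nrm j).
Proof.
have s30 := s3_gt0 R; have s33 := s3_sq R.
have c0 : 0 < eps * (s3 / 3) by rewrite mulr_gt0 // divr_gt0.
have e : eps / 2 = eps * (s3 / 3) * (s3 / 2).
  have -> : eps * (s3 / 3) * (s3 / 2) = eps * (s3 * s3) / 6 by field.
  by rewrite s33; field.
apply/cellE => //; rewrite addrAC subrr add0r e; apply/hexball_scale => //.
case: j => [[|[|[|[|[|[|//]]]]]] ?]; rewrite /wulff_normal /perp /eta3 /eta1 /eta2 /=;
  by split; rewrite /yc1 /yc2 /yc3 /= ler_norml; apply/andP; split; lra.
Qed.

(** Hence whether a cell lies in one of these half-planes depends on the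
    coordinate of its centre only. *)
Lemma gcell_halfplane j p c :
  gcell p `<=` [set x | ncoord j x <= c] <-> ncoord j (pt p) + eps * (s3 / 3) <= c.
Proof.
split=> [/(_ _ (gcell_vertex j p)) /=|h x /(ncoord_gcell j) le]; last exact: le_trans le h.
by rewrite ncoordD ncoordZ (ncoord_normal R j).1 mulr1.
Qed.

Lemma cells_unionE K : cells_union eps [set i | lattice eps i /\ cell eps i `<=` K] =
  region eps [set p | gcell p `<=` K].
Proof.
apply/seteqP; split=> [x [i [/latticeE[p ->] sK] hx]|x [p sK hx]]; first by exists p.
by exists (pt p) => //; split=> //; apply/latticeE; exists p.
Qed.

(** The smallest half-planes that contain the cells of H, when H is tight. *)
Definition height H (j : 'I_6) : R := eps * (s3 / 2) * (bound H j)%:~R + eps * (s3 / 3).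

Lemma height_side H j : tight H ->
  0 < height H (ordS (ordS (ordS (ordS (ordS j))))) + height H (ordS j) - height H j.
Proof.
move=> tH; have s30 := s3_gt0 R.
have t0 : 0 <= bound H (ordS (ordS (ordS (ordS (ordS j))))) + bound H (ordS j) - bound H j.
  move: tH; rewrite /tight /bound; case: j => [[|[|[|[|[|[|//]]]]]] ?] /=; lia.
have c0 : 0 < eps * (s3 / 3) by rewrite mulr_gt0 // divr_gt0.
have d0 : 0 <= eps * (s3 / 2) by rewrite mulr_ge0 ?divr_ge0 // ltW.
rewrite -(ler_int R) intrB intrD in t0.
by have := mulr_ge0 d0 t0; rewrite /height mulrBr mulrDr; lra.
Qed.

(** The hexagon cut out by the half-planes [height] contains exactly the cells
    of the sites of H; it has nondegenerate sides because H is tight. *)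
Lemma boxset_hexagon H : tight H ->
  discrete_wulff_hexagon eps (region eps [set p | p \in boxset H]).
Proof.
move=> tH; have s30 := s3_gt0 R.
have d0 : 0 < eps * (s3 / 2) by rewrite mulr_gt0 // divr_gt0.
split; first by apply/(admissibleP eps); eexists.
exists (polygon (height H)); first by apply: polygon_wulff_hexagon => j; exact: height_side.
rewrite cells_unionE; congr (region eps _); apply/seteqP; split=> p /=.
  rewrite in_boxset => /inbox_level h x hx j.
  apply: le_trans (ncoord_gcell j hx) _; rewrite /height ncoord_pt lerD2r ler_pM2l // ler_int; exact: h.
move=> h; rewrite in_boxset; apply/inbox_level => j.
have : gcell p `<=` [set x | ncoord j x <= height H j] by move=> x /h hx; exact: hx.
by move/gcell_halfplane; rewrite ncoord_pt /height lerD2r ler_pM2l // ler_int.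
Qed.

(** A hexagon that is too small to contain a cell. *)
Lemma region0_hexagon : discrete_wulff_hexagon eps (region eps [set p | p \in fset0]).
Proof.
have s30 := s3_gt0 R.
have c0 : 0 < eps * (s3 / 6) by rewrite mulr_gt0 // divr_gt0.
split; first by apply/(admissibleP eps); eexists.
exists (polygon (fun=> eps * (s3 / 6))); first by apply: polygon_wulff_hexagon => j; lra.
rewrite cells_unionE; congr (region eps _); apply/seteqP; split=> p //= h.
pose j : 'I_6 := ord0; pose j3 := ordS (ordS (ordS j)).
have : gcell p `<=` [set x | ncoord j x <= eps * (s3 / 6)] by move=> x /h hx; exact: hx.
have : gcell p `<=` [set x | ncoord j3 x <= eps * (s3 / 6)] by move=> x /h hx; exact: hx.
move=> /gcell_halfplane h3 /gcell_halfplane h0; move: h3 h0; rewrite /j3 ncoord_opp; lra.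
Qed.

(** The cells inside K are those whose sites satisfy a linear inequality for
    each side of K. Boundedness makes them finitely many; each of the
    inequalities carries over from the sites at which the six coordinates are
    extreme to all sites of the lattice hexagon that these span. *)
Lemma hexagon_boxset E : discrete_wulff_hexagon eps E ->
  E = set0 \/ exists2 H, tight H & E = region eps [set p | p \in boxset H].
Proof.
move=> [_ [K [cK vK [bK [m [p [j wb]]]]] ->]]; rewrite cells_unionE.
have s30 := s3_gt0 R.
have d0 : 0 < eps * (s3 / 2) by rewrite mulr_gt0 // divr_gt0.
set P := [set p | _].
have fP : finite_set P.
  have [M [_ hM]] := bK.
  have [N hN] : exists N : int, 2 * (M + 1) / (eps * (s3 / 2)) < N%:~R.
    by exists (Num.floor (2 * (M + 1) / (eps * (s3 / 2))) + 1); exact: floorD1_gt.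
  rewrite ltr_pdivrMr // [N%:~R * _]mulrC in hN.
  apply: (@sub_finite_set _ _ [set q | q \in boxset (Box (- N) N (- N) N (- N) N)]);
    last exact: finite_fset.
  move=> q /= sq; rewrite in_boxset; apply/inbox_level => k.
  have Kq : K (pt q) by apply: sq; apply: sub_ocell => //; exact: pt_ocell.
  have := hM (M + 1); rewrite ltrDl ltr01 => /(_ isT _ Kq).
  rewrite {1}/Num.norm /= ge_max => /andP[q1 q2].
  have -> : bound (Box (- N) N (- N) N (- N) N) k = N.
    by rewrite /bound; case: k => [[|[|[|[|[|[|//]]]]]] ?] /=; rewrite ?opprK.
  rewrite -(ler_int R) -(ler_pM2l d0) -ncoord_pt; apply: le_trans _ (ltW hN).
  have s32 : s3 / 2 <= 1 by have := s3_sq R; nra.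
  have s20 : 0 <= s3 / 2 by rewrite divr_ge0 // ltW.
  have q1' : `|s3 / 2 * (pt q).1| <= M + 1.
    rewrite normrM (ger0_norm s20); apply: le_trans q1.
    by rewrite -[X in _ <= X]mul1r ler_wpM2r.
  move: q1' q2; rewrite ncoordE; move: (pt q).1 (pt q).2 => u w; rewrite !ler_norml => /andP[h1 h2] /andP[h3 h4].
  by case: k => [[|[|[|[|[|[|//]]]]]] ?] /=; lra.
have [A eA] : exists A : {fset site}, P = [set p | p \in A].
  by have /finite_fsetP[A eA] := fP; exists A.
have [A0|A0] := eqVneq A fset0; first by left; rewrite eA A0; apply/seteqP; split=> // x [].
right; have [H [sH tH atH]] := extreme_hull A0; exists H => //; rewrite eA.
congr (region eps _); apply/seteqP; split=> q /=; first by move/(fsubsetP sH).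
rewrite in_boxset => /inbox_level hq.
suff : P q by rewrite eA.
rewrite /P /= (halfplanesE cK vK wb) => x hx i.
have [r rA er] := attains_level (j i) atH.
have Pr : P r by rewrite eA.
have : gcell r `<=` [set x | ncoord (j i) x <= ncoord (j i) (p i)].
  by move=> y /Pr; rewrite {1}(halfplanesE cK vK wb) => /(_ i); rewrite ncoordB subr_le0.
move=> /gcell_halfplane h; rewrite ncoordB subr_le0.
apply: le_trans (ncoord_gcell (j i) hx) _; apply: le_trans _ h.
by rewrite lerD2r !ncoord_pt ler_pM2l // ler_int er.
Qed.

(** Two disjoint hexagons exist, so that no nonempty hexagon is contained in
    all of them. *)
Lemma envelope_nonempty (W : set (R * R)) : ~ wulff_envelope set0 W.
Proof.
move=> [[cW vW [_ [m [p [j wb]]]]] _ hW].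
have i : 'I_m by exact: Ordinal (ltnW (ltnW (wb_size wb))).
have Wp : W (p i).
  by have := side_sub cW wb i (t := 0); rewrite scale0r addr0; apply; rewrite lexx ler01.
have h1 : W `<=` polygon (fun=> 1 : R) by apply: hW => //; apply: polygon_wulff_hexagon => k; lra.
have h2 : W `<=` polygon (fun k => 1 + ncoord k (0, 10%:R : R)).
  by apply: hW => //; apply: polygon_wulff_hexagon => k; rewrite (ncoordS k); lra.
have := h1 _ Wp (@Ordinal 6 0 isT); have := h2 _ Wp (@Ordinal 6 3 isT); rewrite !ncoordE /=; lra.
Qed.

End Hexagons.

(** * The minimizing movement *)

Theorem proposition3p4 (R : realType) (gamma eps tau : R)
    (E : nat -> set (R * R)) :
  0 < gamma -> 0 < eps -> tau = gamma * eps ->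
  discrete_wulff_hexagon eps (E 0%N) ->
  (forall k, (1 <= k)%N -> energy_minimizer tau eps (E k.-1) (E k)) ->
  forall k, (1 <= k)%N ->
    (exists2 delta : R, 0 < delta &
       forall l, (l < k)%N ->
         exists2 W, wulff_envelope (E l) W & sides_larger_than delta W) ->
    discrete_wulff_hexagon eps (E k) /\ E k `<=` E k.-1.
Proof.
move=> gamma0 eps0 tauE E0 minE.
have tau0 : 0 < tau by rewrite tauE mulr_gt0.
(* The envelope excludes that E k is empty; thus it is the union of the cells
   of a tight hexagon, and so is E k.+1 unless it is empty. *)
have step k : discrete_wulff_hexagon eps (E k) -> (exists W, wulff_envelope (E k) W) ->
    discrete_wulff_hexagon eps (E k.+1) /\ E k.+1 `<=` E k.
  move=> /(hexagon_boxset eps0)[->[W /envelope_nonempty]//|[J tJ EJ] _].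
  have := minE k.+1 isT; rewrite /= EJ => /(energy_minimizer_box eps0 tJ tau0)[I [-> sI hI]].
  split; last by move=> x [p pI hx]; exists p => //; exact: (fsubsetP sI).
  by case: hI => [->|[H tH ->]]; [exact: region0_hexagon|exact: boxset_hexagon].
case=> // k _ [delta _]; elim: k => [|k IH] env.
  by apply: step => //; have [W] := env 0%N isT; exists W.
have [Ek _] : discrete_wulff_hexagon eps (E k.+1) /\ E k.+1 `<=` E k.
  by apply: IH => l lk; apply: env; exact: leqW.
by apply: step => //; have [W] := env k.+1 (ltnSn _); exists W.
Qed.
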